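(* Let $\rho\in\mathcal S(\mathbb R^{2n+1})$ be a mollifier satisfying $\int\rho(x)\,dx=1$ and $\int x^\alpha\rho(x)\,dx=0$ for every nonzero multi-index $\alpha\in\mathbb N^{2n+1}$. Let $\rho_\varepsilon(x)=\varepsilon^{-(2n+1)}\rho(x/\varepsilon)$ for $\varepsilon\in(0,1)$. Then $T_\varepsilon(u)=\rho_\varepsilon *_{H_n}u$ (convolution on the Heisenberg group $H_n=\mathbb R^{2n+1}$) is a rapidly converging approximation on $\mathbb R^{2n+1}$, i.e. the integral kernels of the operators $T_\varepsilon$ lie in $\mathcal S(\mathbb R^{2n+1}\times\mathbb R^{2n+1})$ and the following hold: (a) for every $u\in\mathcal E'(\mathbb R^{2n+1})$ the net $T_\varepsilon(u)$ is a moderate net in $C^\infty(\mathbb R^{2n+1})$ and $\lim_{\varepsilon\to0}T_\varepsilon(u)=u$; that is, $T_\varepsilon:\mathcal E'(\mathbb R^{2n+1})\to\mathcal G^s(\mathbb R^{2n+1})$ is a well-defined injective map; (b) for every $f\in C_c^\infty(\mathbb R^{2n+1})$, the regularization converges rapidly, that is, $T_\varepsilon(f)-f$ is a negligible net in $C^\infty(\mathbb R^{2n+1})$ (it represents $0$ in $\mathcal G^s(\mathbb R^{2n+1})$); (c) the regularization preserves supports: for every $u\in\mathcal E'(\mathbb R^{2n+1})$, $\operatorname{supp}u$ equals the support of $\langle T_\varepsilon(u)\rangle$ in $\mathcal G^s(\mathbb R^{2n+1})$.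
   Context: $H_n=\mathbb R^{2n}\times\mathbb R$ with group law $(x,\xi,t)\circ(y,\eta,s)=\big(x+y,\xi+\eta,t+s+\tfrac12(x\cdot\eta-y\cdot\xi)\big)$; Lebesgue measure is left and right invariant. Convolution is $(g*_{H_n}f)(p)=\int_{H_n}g(q)f(q^{-1}p)\,dq$, extended to $g\in\mathcal S(\mathbb R^{2n+1})$ and compactly supported distributions $f$. $\mathcal S$ denotes Schwartz functions and $\mathcal E'$ compactly supported distributions. A smooth net $(0,1)\ni\varepsilon\mapsto f_\varepsilon\in C^\infty(\mathbb R^m)$ is moderate if for every continuous seminorm $p$ on $C^\infty(\mathbb R^m)$ there is $N\in\mathbb Z$ with $p(f_\varepsilon)=O(\varepsilon^N)$ as $\varepsilon\to0$, and negligible if for every $p$ this holds for all $N\in\mathbb Z$. $\mathcal G^s(\mathbb R^m)$ (the special Colombeau algebra with smooth nets) is the quotient of moderate nets by negligible nets, with classes $\langle f_\varepsilon\rangle$. Replacing $\mathbb R^m$ by open subsets gives a sheaf, and the support of an element is the complement of the largest open set on which it restricts to $0$.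
   Formalization: The kernels of T_ε never lie in S(R^{2n+1}×R^{2n+1}), since ρ_ε(pq⁻¹) is constant along {(rq,q)}; instead it is proved that the kernel becomes Schwartz in (p,q) after multiplication by any χ(p) or χ(q) with χ in C_c^∞. *)

(* Defs.v *)
From HB Require Import structures.
From mathcomp Require Import all_boot all_order all_algebra.
From mathcomp Require Import all_classical all_reals all_analysis.
From mathcomp Require Import complex.

Set Implicit Arguments.
Unset Strict Implicit.
Unset Printing Implicit Defensive.
Import Order.TTheory GRing.Theory Num.Theory.
Import numFieldNormedType.Exports.
Local Open Scope classical_set_scope.
Local Open Scope ring_scope.
Local Open Scope complex_scope.

(* The sigma-algebra on m.-tuple R is the product one; Lebesgue measure on
   R^(m+1) is the image of (Lebesgue on R) \x (Lebesgue on R^m) under cons. *)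
Section cons_measure.
Context d (T : measurableType d) (R : realType) (m : nat).
Variable nu : {sigma_finite_measure set T -> \bar R}.
Variable mu : {sigma_finite_measure set (m.-tuple T) -> \bar R}.

Definition tcons (z : T * m.-tuple T) : m.+1.-tuple T :=
  [the m.+1.-tuple T of z.1 :: z.2].

Lemma measurable_tcons : measurable_fun setT tcons.
Proof. exact: measurable_cons measurable_fst measurable_snd. Qed.

Definition cons_measure : set (m.+1.-tuple T) -> \bar R :=
  pushforward (nu \x mu)%E tcons.

HB.instance Definition _ := Measure.copy cons_measure
  (measure_function_pushforward__canonical__measure_function_Measure
     (nu \x mu)%E measurable_tcons).

Let cons_measure_sigma_finite : sigma_finite setT cons_measure.
Proof.
have /sigma_finiteP[F [FT ndF Ffin]] := sigma_finiteT nu.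
have /sigma_finiteP[G [GT ndG Gfin]] := sigma_finiteT mu.
pose S k := (@thead m T) @^-1` F k `&`
            (fun t : m.+1.-tuple T => [tuple of behead t]) @^-1` G k.
exists S.
  apply/esym; rewrite -subTset => t _.
  have [i _ Fi] : (\bigcup_i F i) (thead t) by rewrite -FT.
  have [j _ Gj] : (\bigcup_i G i) [tuple of behead t] by rewrite -GT.
  exists (maxn i j) => //; split.
  - have /subsetPset := ndF i (maxn i j) (leq_maxl _ _); exact.
  - have /subsetPset := ndG j (maxn i j) (leq_maxr _ _); exact.
move=> k; have [mF Fk] := Ffin k; have [mG Gk] := Gfin k; split.
  apply: measurableI; rewrite -[X in measurable X]setTI.
    exact: measurable_tnth.
  exact: measurable_behead.
rewrite /cons_measure /pushforward (_ : tcons @^-1` _ = F k `*` G k).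
  by rewrite product_measure1E// lte_mul_pinfty// ge0_fin_numE.
apply/seteqP; split => -[x t]; rewrite /S /tcons /= theadE;
  have -> : [tuple of behead [the m.+1.-tuple T of x :: t]] = t by exact: val_inj.
- by [].
- by [].
Qed.

HB.instance Definition _ :=
  Measure_isSigmaFinite.Build _ _ _ cons_measure cons_measure_sigma_finite.

End cons_measure.

Fixpoint lebesgue_tuple (R : realType) (m : nat) :
    {sigma_finite_measure set (m.-tuple (measurableTypeR R)) -> \bar R} :=
  match m with
  | 0%N => [the {sigma_finite_measure set _ -> \bar R} of
              dirac ([tuple] : 0.-tuple (measurableTypeR R))]
  | m'.+1 => [the {sigma_finite_measure set _ -> \bar R} of
              cons_measure lebesgue_measure (lebesgue_tuple R m')]
  end.

Section calculus.
Context {R : realType}.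

(* R^m is 'rV[R]_m; all functions, distributions and generalized functions are
   complex-valued. *)

Definition tuple_row m (t : m.-tuple R) : 'rV[R]_m := \row_i tnth t i.

Definition integralRm m (f : 'rV[R]_m -> R[i]) : R[i] :=
  (\int[lebesgue_tuple R m]_t complex.Re (f (tuple_row t))) +i*
  (\int[lebesgue_tuple R m]_t complex.Im (f (tuple_row t))).

Definition cmod (z : R[i]) : R := Normc.normc z.

Definition partial m (i : 'I_m) (f : 'rV[R]_m -> R[i]) (x : 'rV[R]_m) : R[i] :=
  ('D_(delta_mx 0 i) (fun y => complex.Re (f y)) x) +i*
  ('D_(delta_mx 0 i) (fun y => complex.Im (f y)) x).

Fixpoint partials m (s : seq 'I_m) (f : 'rV[R]_m -> R[i]) : 'rV[R]_m -> R[i] :=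
  if s is i :: s' then partial i (partials s' f) else f.

Definition cdifferentiable m (f : 'rV[R]_m -> R[i]) (x : 'rV[R]_m) : Prop :=
  differentiable (fun y => complex.Re (f y)) x /\
  differentiable (fun y => complex.Im (f y)) x.

(* f \in C^oo(U), for U open; the values of f outside U are irrelevant. *)
Definition smooth m (U : set 'rV[R]_m) (f : 'rV[R]_m -> R[i]) : Prop :=
  forall (s : seq 'I_m) x, U x -> cdifferentiable (partials s f) x.

(* sup of |d^s f| over K and over all iterated partial derivatives of order
   at most k; these seminorms, for K compact in U, define the topology of
   C^oo(U). *)
Definition Cinf_norm m (K : set 'rV[R]_m) (k : nat) (f : 'rV[R]_m -> R[i]) : R :=
  sup [set r | exists s x,
    [/\ (size s <= k)%N, K x & r = cmod (partials s f x)]].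

(* The seminorms Cinf_norm K k being directed, a seminorm is continuous iff it
   is dominated by a multiple of one of them. *)
Definition continuous_seminorm m (U : set 'rV[R]_m)
    (p : ('rV[R]_m -> R[i]) -> R) : Prop :=
  [/\ forall f g, smooth U f -> smooth U g ->
        p (fun x => f x + g x) <= p f + p g,
      forall (a : R[i]) f, smooth U f -> p (fun x => a * f x) = cmod a * p f
    & exists K k (B : R), [/\ compact K, K `<=` U
        & forall f, smooth U f -> p f <= B * Cinf_norm K k f]].

Definition fsupp m (f : 'rV[R]_m -> R[i]) : set 'rV[R]_m :=
  closure [set x | f x != 0].

Definition test_function m (f : 'rV[R]_m -> R[i]) : Prop :=
  smooth setT f /\ compact (fsupp f).

Definition monomial m (a : 'I_m -> nat) (x : 'rV[R]_m) : R :=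
  \prod_i x 0 i ^+ a i.

Definition schwartz m (f : 'rV[R]_m -> R[i]) : Prop :=
  smooth setT f /\
  forall (a : 'I_m -> nat) (s : seq 'I_m), exists B : R, forall x,
    cmod ((monomial a x)%:C * partials s f x) <= B.

(* E'(R^m) is the dual of C^oo(R^m): u only matters on smooth functions. *)
Definition compact_distribution m (u : ('rV[R]_m -> R[i]) -> R[i]) : Prop :=
  (forall (a : R[i]) f g, smooth setT f -> smooth setT g ->
     u (fun x => a * f x + g x) = a * u f + u g) /\
  exists K k (B : R), compact K /\
    forall f, smooth setT f -> cmod (u f) <= B * Cinf_norm K k f.

Definition distribution_eq m (u v : ('rV[R]_m -> R[i]) -> R[i]) : Prop :=
  forall f, smooth setT f -> u f = v f.

Definition distribution_supp m (u : ('rV[R]_m -> R[i]) -> R[i]) :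
    set 'rV[R]_m :=
  ~` \bigcup_(V in [set V : set 'rV[R]_m | open V /\
       forall f, test_function f -> fsupp f `<=` V -> u f = 0]) V.

(* Weak convergence, in D'(R^m), of functions f_e to u as e -> 0+. *)
Definition cvg_distribution m (f : R -> 'rV[R]_m -> R[i])
    (u : ('rV[R]_m -> R[i]) -> R[i]) : Prop :=
  forall phi, test_function phi ->
    cmod (integralRm (fun x => f e x * phi x) - u phi) @[e --> 0^'+] --> (0 : R).

(* A net is a function of e in (0,1); its values at other e are irrelevant.
   It is smooth on U when e |-> f e is a C^oo curve from (0,1) to the Frechet
   space C^oo(U); g k is its derivative of order k. *)
Definition smooth_net m (U : set 'rV[R]_m) (f : R -> 'rV[R]_m -> R[i]) : Prop :=
  exists g : nat -> R -> 'rV[R]_m -> R[i],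
  [/\ g 0%N = f,
      forall k (e : R), 0 < e < 1 -> smooth U (g k e)
    & forall k (e : R) p, 0 < e < 1 -> continuous_seminorm U p ->
        p (fun x => (h^-1)%:C * (g k (e + h) x - g k e x) - g k.+1 e x)
          @[h --> 0^'] --> (0 : R)].

Definition moderate m (U : set 'rV[R]_m) (f : R -> 'rV[R]_m -> R[i]) : Prop :=
  smooth_net U f /\
  forall p, continuous_seminorm U p ->
    exists N : int, exists B : R, \forall e \near 0^'+, p (f e) <= B * e ^ N.

Definition negligible_net m (U : set 'rV[R]_m) (f : R -> 'rV[R]_m -> R[i]) :
    Prop :=
  smooth_net U f /\
  forall p, continuous_seminorm U p ->
    forall N : int, exists B : R, \forall e \near 0^'+, p (f e) <= B * e ^ N.

(* Elements of G^s(U) are the classes of moderate nets modulo negligible ones. *)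
Definition gs_class m (U : set 'rV[R]_m) (f : R -> 'rV[R]_m -> R[i]) :
    set (R -> 'rV[R]_m -> R[i]) :=
  [set g | moderate U g /\ negligible_net U (fun e x => g e x - f e x)].

Definition Gs m (U : set 'rV[R]_m) : set (set (R -> 'rV[R]_m -> R[i])) :=
  [set A | exists2 f, moderate U f & A = gs_class U f].

Definition gs_zero m (U : set 'rV[R]_m) : set (R -> 'rV[R]_m -> R[i]) :=
  gs_class U (fun _ _ => 0).

Definition gs_restrict m (V : set 'rV[R]_m)
    (A : set (R -> 'rV[R]_m -> R[i])) : set (R -> 'rV[R]_m -> R[i]) :=
  \bigcup_(f in A) gs_class V f.

Definition gs_supp m (A : set (R -> 'rV[R]_m -> R[i])) : set 'rV[R]_m :=
  ~` \bigcup_(V in [set V : set 'rV[R]_m |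
       open V /\ gs_restrict V A = gs_zero V]) V.

End calculus.

Section heisenberg.
Context {R : realType} {n : nat}.
Local Notation H := 'rV[R]_(n + n + 1).

Definition hx (p : H) : 'rV[R]_n := lsubmx (lsubmx p).
Definition hxi (p : H) : 'rV[R]_n := rsubmx (lsubmx p).
Definition ht (p : H) : R := rsubmx p 0 0.

Definition dotp (x y : 'rV[R]_n) : R := \sum_i x 0 i * y 0 i.

Definition hmul (p q : H) : H :=
  row_mx (row_mx (hx p + hx q) (hxi p + hxi q))
    (ht p + ht q + 2^-1 * (dotp (hx p) (hxi q) - dotp (hx q) (hxi p)))%:M.

Definition hinv (p : H) : H := - p.

Lemma hmulV (p : H) : hmul p (hinv p) = 0.
Proof.
rewrite /hmul /hinv /hx /hxi /ht !linearN /= !subrr !mxE subrr add0r.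
rewrite (_ : _ - _ = 0) ?mulr0 ?raddf0 ?row_mx0//.
by apply/eqP; rewrite subr_eq0; apply/eqP/eq_bigr => i _; rewrite !mxE mulrN mulNr.
Qed.

Lemma hmulVp (p : H) : hmul (hinv p) p = 0.
Proof. by have := hmulV (hinv p); rewrite {2}/hinv opprK. Qed.

Definition hconv (g f : H -> R[i]) (p : H) : R[i] :=
  integralRm (fun q => g q * f (hmul (hinv q) p)).

(* Extension of hconv to distributions: for a function f, the change of variable
   r = q^-1 p (which preserves Lebesgue measure) gives
   hconv g f p = \int g (p r^-1) f r dr, the pairing of f with
   r |-> g (p r^-1). *)
Definition hconvD (g : H -> R[i]) (u : (H -> R[i]) -> R[i]) (p : H) : R[i] :=
  u (fun r => g (hmul p (hinv r))).

Definition mollify (rho : H -> R[i]) (e : R) (x : H) : R[i] :=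
  (e ^- (2 * n + 1))%:C * rho (e^-1 *: x).

(* K is the integral kernel of convolution by g, both on test functions and on
   compactly supported distributions. *)
Definition conv_kernel (g : H -> R[i])
    (K : 'rV[R]_((n + n + 1) + (n + n + 1)) -> R[i]) : Prop :=
  (forall f p, test_function f ->
     hconv g f p = integralRm (fun q => K (row_mx p q) * f q)) /\
  (forall u p, compact_distribution u ->
     hconvD g u p = u (fun q => K (row_mx p q))).

End heisenberg.

(* K(p,q) becomes a Schwartz function of (p,q) once either variable is localized
   by a test function.  K in S(R^m x R^m) would be too strong: the kernel
   g(p q^-1) of convolution by g is constant on each set {(r q, q) : q}, so it is
   not Schwartz in (p,q) jointly unless g = 0. *)
Definition localized_schwartz {R : realType} {m : nat}
    (K : 'rV[R]_(m + m) -> R[i]) : Prop :=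
  forall chi : 'rV[R]_m -> R[i], test_function chi ->
    schwartz (fun z => chi (lsubmx z) * K z) /\
    schwartz (fun z => K z * chi (rsubmx z)).

(* Main.v *)
Require Import Defs.
From HB Require Import structures.
From mathcomp Require Import all_boot all_order all_algebra.
From mathcomp Require Import all_classical all_reals all_analysis.
From mathcomp Require Import measurable_realfun complex.
From mathcomp Require Import ring lra.
Set Implicit Arguments.
Unset Strict Implicit.
Unset Printing Implicit Defensive.
Import Order.TTheory GRing.Theory Num.Theory.
Import numFieldNormedType.Exports.
Local Open Scope classical_set_scope.
Local Open Scope ring_scope.
Local Open Scope complex_scope.

(** The operators T_e are studied through three estimates.

    Approximation.  After the substitution q -> e q, the regularization of a test
    function f at p is the integral of rho(q) f((e q)^-1 p).  Expanding in powers
    of e by Taylor's formula, the term of order k >= 1 is a polynomial in q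
    without constant term, multiplied by a derivative of f, and the moment
    conditions kill it.  Hence the difference with f is O(e^N) for every N,
    uniformly on compact sets (moment_expansion, hconv_approximation).  The same
    holds for the transposed operators, which map phi to the integral of
    rho(q) phi((e q) r) (pairing_approximation).  This controls values only;
    derivatives follow by interpolation, since a net with moderate derivatives and
    rapidly small values has rapidly small derivatives (interpolate_complex).

    Moderateness.  The kernel e^-(2n+1) rho(e^-1 (p r^-1)) is a smooth function of
    (e, p, r) jointly, whose derivatives are bounded by powers of 1 / e on compact
    sets (kern_M).  A compactly supported distribution in the variable r can be
    differentiated in its parameters (distr_param_partials), so T_e u is a smooth
    and moderate net (reg_is_moderate).

    Locality.  Off the diagonal p = r the kernel is smaller than every power of e,
    because rho decreases rapidly (kern_N); so T_e u is negligible wherever u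
    vanishes (reg_off_support, vanish_negligible).

    Rapid convergence on test functions is the first estimate.  A distribution
    commutes with the integration of a parameter (distr_integral, proved with
    Riemann sums), so the pairing of T_e u with a test function phi is u applied
    to the transposed regularization of phi, which converges to phi in C^oo; this
    gives the convergence of T_e u to u (hconvD_cvg).  If T_e u is negligible on an
    open set V, its pairings with test functions supported in V tend both to 0 and
    to the values of u, so u vanishes on V (negligible_vanish).  With V the whole
    space this is injectivity, and together with locality it is the preservation of
    supports.  The kernel is rapidly decreasing in p r^-1, and
    when p or r stays bounded this is rapid decrease in (p, r)
    (hkernel_localized). *)

(** * Iterated partial derivatives of real functions *)

Section partials.
Context {R : realType}.

Lemma ler_coord_norm m (x : 'rV[R]_m) i : `|x 0 i| <= `|x|.
Proof.
rewrite [leRHS]/Num.norm /= mx_normrE; apply/bigmax_geP; right => /=.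
by exists (0, i).
Qed.

Lemma row_norm_le m (x : 'rV[R]_m) (C : R) :
  0 <= C -> (forall i, `|x 0 i| <= C) -> `|x| <= C.
Proof.
move=> C0 xC; rewrite [leLHS]/Num.norm /= mx_normrE; apply/bigmax_leP.
by split => // -[i j] _ /=; rewrite ord1.
Qed.

Lemma row_mx_norm m1 m2 (x : 'rV[R]_m1) (y : 'rV[R]_m2) :
  `|row_mx x y| = Num.max `|x| `|y|.
Proof.
apply/eqP; rewrite eq_le; apply/andP; split.
  apply: row_norm_le => [|i]; first by rewrite le_max normr_ge0.
  rewrite mxE; case: splitP => j _; rewrite le_max ler_coord_norm ?orbT//.
rewrite ge_max; apply/andP; split; apply: row_norm_le => // i.
  by rewrite -(row_mxEl x y) ler_coord_norm.
by rewrite -(row_mxEr x y) ler_coord_norm.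
Qed.

Definition rpartial m (i : 'I_m) (f : 'rV[R]_m -> R) (x : 'rV[R]_m) : R :=
  'D_(delta_mx 0 i) f x.

Fixpoint rpartials m (s : seq 'I_m) (f : 'rV[R]_m -> R) : 'rV[R]_m -> R :=
  if s is i :: s' then rpartial i (rpartials s' f) else f.

Lemma rpartials_cat m (s t : seq 'I_m) f :
  rpartials (s ++ t) f = rpartials s (rpartials t f).
Proof. by elim: s => //= i s ->. Qed.

Lemma rpartials_rcons m (s : seq 'I_m) i f :
  rpartials (rcons s i) f = rpartials s (rpartial i f).
Proof. by rewrite -cats1 rpartials_cat. Qed.

Lemma Re_partials m (s : seq 'I_m) (f : 'rV[R]_m -> R[i]) x :
  complex.Re (partials s f x) = rpartials s (fun y => complex.Re (f y)) x.
Proof.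
elim: s x => //= i s IH x; congr ('D__ _ x); exact/funext.
Qed.

Lemma Im_partials m (s : seq 'I_m) (f : 'rV[R]_m -> R[i]) x :
  complex.Im (partials s f x) = rpartials s (fun y => complex.Im (f y)) x.
Proof.
elim: s x => //= i s IH x; congr ('D__ _ x); exact/funext.
Qed.

Lemma differentiable_approx (V : normedModType R) (g : V -> R) x
    (L : {linear V -> R}) : continuous L ->
  (forall e : R, 0 < e ->
    \forall v \near 0, `|g (x + v) - g x - L v| <= e * `|v|) ->
  differentiable g x /\ 'd g x = L :> (V -> R).
Proof.
move=> cL H; have E : g \o shift x = cst (g x) + L +o_ 0 id.
  apply/eqaddoP => e e0; move: (H e e0); apply: filterS => v.
  suff -> : (g \o shift x - (cst (g x) + L)) v = g (x + v) - g x - L v by [].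
  by rewrite !fctE /= opprD addrA [v + x]addrC.
have dE := diff_unique cL E.
by split=> //; apply/diff_locallyP; rewrite dE.
Qed.

Lemma differentiable_increment (V : normedModType R) (f : V -> R) (x : V)
    (e : R) : differentiable f x -> 0 < e ->
  \forall v \near 0, `|f (x + v) - f x - 'd f x v| <= e * `|v|.
Proof.
move=> /diff_locallyP[_ /eqaddoP /[apply]]; apply: filterS => v.
suff -> : (f \o shift x - (cst (f x) + 'd f x)) v = f (x + v) - f x - 'd f x v.
  by [].
by rewrite !fctE /= opprD addrA [v + x]addrC.
Qed.

Lemma near_eq_differentiable (V : normedModType R) (f g : V -> R) x :
  (\forall y \near x, f y = g y) -> differentiable f x -> differentiable g x.
Proof.
move=> fg df; have fgx : f x = g x by exact: nbhs_singleton fg.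
have [] // := @differentiable_approx V g x ('d f x).
  by move: df => /diff_locallyP[].
move=> e e0; have fg0 : \forall v \near 0, f (x + v) = g (x + v).
  have := fg; rewrite (near_shift 0 x).
  by rewrite subr0; apply: filterS => v /=; rewrite addrC.
near=> v; rewrite -fgx -(near fg0 v)//.
by near: v; exact: differentiable_increment.
Unshelve. all: by end_near. Qed.

(** A quadratic remainder is what a linear functional transmits: this is how
    functions defined by distributions are shown to be differentiable. *)
Lemma differentiable_quadratic m (g : 'rV[R]_m -> R) (x : 'rV[R]_m) (a : 'I_m -> R) (C d : R) :
  0 < d -> (forall v : 'rV[R]_m, `|v| < d ->
    `|g (x + v) - g x - \sum_i v 0 i * a i| <= C * `|v| ^+ 2) ->
  differentiable g x /\ forall i, 'D_(delta_mx 0 i) g x = a i.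
Proof.
move=> d0 H; pose L (v : 'rV[R]_m) := \sum_i v 0 i * a i.
have Llin : linear L.
  move=> k u v; rewrite /L scaler_sumr -big_split; apply: eq_bigr => i _ /=.
  by rewrite !mxE mulrDl -[_ *: _]/(_ * _) mulrA.
pose glM := GRing.isLinear.Build _ _ _ _ _ Llin.
pose gL : {linear 'rV[R]_m -> R} := HB.pack L glM.
have Lcont : continuous gL.
  have Ldiff y : differentiable (fun v : 'rV[R]_m => \sum_i v 0 i * a i) y.
    rewrite (_ : (fun v : 'rV[R]_m => _) =
      \sum_i (fun v : 'rV[R]_m => v 0 i * a i)); last first.
      by apply/funext => v; rewrite fct_sumE.
    apply: differentiable_sum => i; apply: differentiableM => //.
    exact: differentiable_coord.
  by move=> y; apply: differentiable_continuous (Ldiff y).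
have [gd dE] : differentiable g x /\ 'd g x = gL :> ('rV[R]_m -> R).
  apply: differentiable_approx => // e e0.
  have e1 : 0 < Num.min d (e / (`|C| + 1)).
    by rewrite lt_min d0 divr_gt0// ltr_pwDr.
  apply: (filterS _ (@nbhs0_lt _ 'rV[R]_m _ e1)) => v.
  rewrite lt_min => /andP[vd ve].
  rewrite (le_trans (H _ vd))// expr2 mulrA ler_wpM2r//.
  rewrite (@le_trans _ _ ((`|C| + 1) * `|v|))//.
    by rewrite ler_wpM2r// (le_trans (ler_norm C))// lerDl.
  by rewrite mulrC -ler_pdivlMr ?ltr_pwDr// ltW.
split=> // i; rewrite deriveE// dE /= /L (bigD1 i)//= big1 ?addr0 => [|j ji].
  by rewrite mxE !eqxx mul1r.
by rewrite mxE (negbTE ji) andbF mul0r.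
Qed.

Lemma partial_local m (U : set 'rV[R]_m) i f g : open U ->
  (forall x, U x -> f x = g x) -> forall x, U x -> rpartial i f x = rpartial i g x.
Proof.
move=> oU fg x Ux; apply: near_eq_derive.
by apply: (filterS fg); exact: open_nbhs_nbhs.
Qed.

Lemma differentiable_local m (U : set 'rV[R]_m) (f g : 'rV[R]_m -> R) : open U ->
  (forall x, U x -> f x = g x) ->
  forall x, U x -> differentiable f x -> differentiable g x.
Proof.
move=> oU fg x Ux; apply: near_eq_differentiable.
by apply: (filterS fg); exact: open_nbhs_nbhs.
Qed.

Lemma partials_local m (U : set 'rV[R]_m) s f g : open U ->
  (forall x, U x -> f x = g x) ->
  forall x, U x -> rpartials s f x = rpartials s g x.
Proof. by move=> oU fg; elim: s => //= i s IH x; exact: partial_local. Qed.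

Lemma linear_sum_coord m (L : {linear 'rV[R]_m -> R}) v :
  L v = \sum_i v 0 i * L (delta_mx 0 i).
Proof.
by rewrite {1}[v]row_sum_delta linear_sum; apply: eq_bigr => i _; rewrite linearZZ.
Qed.

Lemma derive_partials m (f : 'rV[R]_m -> R) x v : differentiable f x ->
  'D_v f x = \sum_i v 0 i * rpartial i f x.
Proof.
move=> df; rewrite deriveE// linear_sum_coord.
by apply: eq_bigr => i _; rewrite /rpartial deriveE.
Qed.

End partials.

(** * Smooth functions with controlled growth *)

Section smooth_growth.
Context {R : realType}.

(** A class bd encodes the size required of every derivative: no condition, a
    bound by a power of a weight, or decay faster than every power of it.
    Domination is tested on U only, because derivatives carry no information
    elsewhere. *)
Record growth m (U : set 'rV[R]_m) (bd : set ('rV[R]_m -> R)) : Prop := Growth {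
  growth0 : bd (fun=> 0);
  growth_le : forall f g, (forall x, U x -> `|g x| <= `|f x|) -> bd f -> bd g;
  growthD : forall f g, bd f -> bd g -> bd (fun x => f x + g x) }.

(** Only this version, with derivatives up to order k, goes through the inductions
    below; sm is its limit as k grows. *)
Definition smooth_upto m (k : nat) (U : set 'rV[R]_m) (bd : set ('rV[R]_m -> R)) f :=
  forall s, (size s <= k)%N ->
    (forall x, U x -> differentiable (rpartials s f) x) /\ bd (rpartials s f).

Definition sm m (U : set 'rV[R]_m) (bd : set ('rV[R]_m -> R)) f :=
  forall s, (forall x, U x -> differentiable (rpartials s f) x) /\
    bd (rpartials s f).

Lemma smE m (U : set 'rV[R]_m) bd f : sm U bd f <-> forall k, smooth_upto k U bd f.
Proof. by split=> [sf k s _|sf s]; [exact: sf|exact: (sf (size s))]. Qed.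

Lemma sm_diff m (U : set 'rV[R]_m) bd f x : sm U bd f -> U x -> differentiable f x.
Proof. by move=> /(_ [::])[+ _]; exact. Qed.

Lemma smkS m k (U : set 'rV[R]_m) bd f : smooth_upto k.+1 U bd f <->
  [/\ forall x, U x -> differentiable f x, bd f &
     forall i, smooth_upto k U bd (rpartial i f)].
Proof.
split=> [sf|[df bf sf] s].
  split; [exact: (sf [::] isT).1|exact: (sf [::] isT).2|move=> i s sk].
  by rewrite -rpartials_rcons; apply: sf; rewrite size_rcons.
by case/lastP: s => [//|s i]; rewrite size_rcons rpartials_rcons; exact: sf.
Qed.

Lemma smk0 m (U : set 'rV[R]_m) bd f : smooth_upto 0 U bd f <->
  (forall x, U x -> differentiable f x) /\ bd f.
Proof. by split=> [/(_ [::])|? []//]; exact. Qed.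

Lemma smkW m k (U : set 'rV[R]_m) bd f : smooth_upto k.+1 U bd f -> smooth_upto k U bd f.
Proof. by move=> sf s sk; apply: sf; exact: leqW. Qed.

Lemma sm_partials m (U : set 'rV[R]_m) bd f s : sm U bd f -> sm U bd (rpartials s f).
Proof. by move=> sf t; rewrite -rpartials_cat; exact: sf. Qed.

Lemma sm_partial m (U : set 'rV[R]_m) bd f i : sm U bd f -> sm U bd (rpartial i f).
Proof. exact: (sm_partials [:: i]). Qed.

Lemma sm_sub m (U V : set 'rV[R]_m) (bd bd' : set ('rV[R]_m -> R)) f :
  V `<=` U -> bd `<=` bd' -> sm U bd f -> sm V bd' f.
Proof. by move=> VU bb sf s; split=> [x /VU|]; [apply: (sf s).1|exact/bb/(sf s).2]. Qed.

Section closure.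
Variables (m : nat) (U : set 'rV[R]_m).
Hypothesis oU : open U.

Section one_class.
Variable bd : set ('rV[R]_m -> R).
Hypothesis gbd : growth U bd.

Lemma growth_eq f g : (forall x, U x -> f x = g x) -> bd f -> bd g.
Proof. by move=> fg; apply: (growth_le gbd) => x Ux; rewrite fg. Qed.

Lemma smk_eq k f g : (forall x, U x -> f x = g x) -> smooth_upto k U bd f -> smooth_upto k U bd g.
Proof.
move=> fg sf s sk; have [df bf] := sf s sk; have fgs := partials_local s oU fg.
split=> [x Ux|]; last exact: growth_eq bf.
exact: (differentiable_local oU fgs Ux (df _ Ux)).
Qed.

Lemma sm_eq f g : (forall x, U x -> f x = g x) -> sm U bd f -> sm U bd g.
Proof. by move=> fg /smE sf; apply/smE => k; exact: smk_eq (sf k). Qed.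

Lemma smkD k f g : smooth_upto k U bd f -> smooth_upto k U bd g -> smooth_upto k U bd (fun x => f x + g x).
Proof.
elim: k f g => [|k IH] f g.
  move=> /smk0[df bf] /smk0[dg bg]; apply/smk0; split; last exact: (growthD gbd).
  by move=> x Ux; apply: differentiableD; [exact: df|exact: dg].
move=> /smkS[df bf sf] /smkS[dg bg sg]; apply/smkS; split.
- by move=> x Ux; apply: differentiableD; [exact: df|exact: dg].
- exact: (growthD gbd).
- move=> i; apply: (smk_eq _ (IH _ _ (sf i) (sg i))) => x Ux.
  by rewrite /rpartial deriveD//; apply: diff_derivable; [exact: df|exact: dg].
Qed.

Lemma smk_cst0 k : smooth_upto k U bd (fun=> 0).
Proof.
elim: k => [|k IH].
  by apply/smk0; split=> [x Ux|]; [exact: differentiable_cst|exact: (growth0 gbd)].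
apply/smkS; split=> [x Ux||i]; [exact: differentiable_cst|exact: (growth0 gbd)|].
by apply: (smk_eq _ IH) => x Ux; rewrite /rpartial derive_cst.
Qed.

Lemma smk_sum k (I : Type) (r : seq I) (f : I -> 'rV[R]_m -> R) :
  (forall i, smooth_upto k U bd (f i)) -> smooth_upto k U bd (fun x => \sum_(i <- r) f i x).
Proof.
move=> sf; elim: r => [|i r IH].
  by apply: (smk_eq _ (@smk_cst0 k)) => x _; rewrite big_nil.
by apply: (smk_eq _ (smkD (sf i) IH)) => x _; rewrite big_cons.
Qed.

Lemma smD f g : sm U bd f -> sm U bd g -> sm U bd (fun x => f x + g x).
Proof. by move=> /smE sf /smE sg; apply/smE => k; exact: smkD. Qed.

Lemma sm_cst c : bd (fun=> c) -> sm U bd (fun=> c).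
Proof.
move=> bc; apply/smE => -[|k].
  by apply/smk0; split=> // x Ux; exact: differentiable_cst.
apply/smkS; split=> [x Ux|//|i]; first exact: differentiable_cst.
by apply: (smk_eq _ (@smk_cst0 k)) => x Ux; rewrite /rpartial derive_cst.
Qed.

Lemma sm_sum (I : Type) (r : seq I) (f : I -> 'rV[R]_m -> R) :
  (forall i, sm U bd (f i)) -> sm U bd (fun x => \sum_(i <- r) f i x).
Proof. by move=> sf; apply/smE => k; apply: smk_sum => i; move: k; apply/smE. Qed.

Lemma sm_coord (i : 'I_m) : bd (fun x => x 0 i) -> bd (fun=> 1) ->
  sm U bd (fun x => x 0 i).
Proof.
move=> bi b1; have dc x : differentiable (fun x : 'rV[R]_m => x 0 i) x.
  exact: differentiable_coord.
have s1 : sm U bd (fun=> 1) by exact: sm_cst.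
apply/smE => -[|k]; first by apply/smk0.
apply/smkS; split=> // j.
have E (x : 'rV[R]_m) : rpartial j (fun x => x 0 i) x = (i == j)%:R.
  have [|_] := @differentiable_quadratic _ _ (fun x : 'rV[R]_m => x 0 i) x
    (fun j => (i == j)%:R) 0 1 ltr01; last exact.
  move=> v _; rewrite mul0r mxE (bigD1 i)//= eqxx mulr1 big1 ?addr0.
    by rewrite [x 0 i + _]addrC addrK subrr normr0.
  by move=> l; rewrite eq_sym => /negbTE ->; rewrite mulr0.
have [ij|ij] := eqVneq i j.
  by apply: (smk_eq _ ((smE _ _ _).1 s1 k)) => x _; rewrite E ij eqxx.
by apply: (smk_eq _ (@smk_cst0 k)) => x _; rewrite E (negbTE ij).
Qed.

End one_class.

Section products.
Variables bd1 bd2 bd3 : set ('rV[R]_m -> R).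
Hypothesis gbd3 : growth U bd3.
Hypothesis bdM : forall f g, bd1 f -> bd2 g -> bd3 (fun x => f x * g x).

Lemma smkM k f g : smooth_upto k U bd1 f -> smooth_upto k U bd2 g -> smooth_upto k U bd3 (fun x => f x * g x).
Proof.
elim: k f g => [|k IH] f g.
  move=> /smk0[df bf] /smk0[dg bg]; apply/smk0; split; last exact: bdM.
  by move=> x Ux; apply: differentiableM; [exact: df|exact: dg].
move=> sfk sgk.
move: (sfk) (sgk) => /smkS[df bf sf] /smkS[dg bg sg]; apply/smkS; split.
- by move=> x Ux; apply: differentiableM; [exact: df|exact: dg].
- exact: bdM.
- move=> i; apply: (smk_eq gbd3 _ (smkD gbd3 (IH _ _ (smkW sfk) (sg i))
      (IH _ _ (sf i) (smkW sgk)))) => x Ux.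
  rewrite /rpartial deriveM; last 2 first.
  + exact/diff_derivable/df.
  + exact/diff_derivable/dg.
  by rewrite -![_ *: _]/(_ * _) [g x * _]mulrC.
Qed.

Lemma smM f g : sm U bd1 f -> sm U bd2 g -> sm U bd3 (fun x => f x * g x).
Proof. by move=> /smE sf /smE sg; apply/smE => k; exact: smkM. Qed.

End products.

Section composition.
Variables bd1 bd2 : set ('rV[R]_m -> R).
Hypothesis gbd2 : growth U bd2.
Hypothesis bdM : forall f g, bd2 f -> bd1 g -> bd2 (fun x => f x * g x).

(** The chain rule expresses a derivative of the composite by products of a
    composite with the first derivatives of Psi, whence the asymmetric hypothesis
    bdM and an induction on the order. *)
Lemma sm_comp p (f : 'rV[R]_p -> R) (Psi : 'rV[R]_m -> 'rV[R]_p) :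
  (forall s x, differentiable (rpartials s f) x) ->
  (forall s, bd2 (fun x => rpartials s f (Psi x))) ->
  (forall j, sm U bd1 (fun x => Psi x 0 j)) ->
  sm U bd2 (fun x => f (Psi x)).
Proof.
move=> df bf sPsi; apply/smE => k.
have dPsi x : U x -> differentiable Psi x.
  move=> Ux; rewrite (_ : Psi = \sum_j (fun x => Psi x 0 j *: delta_mx 0 j)).
    apply: differentiable_sum => j; apply: differentiableZl.
    exact: sm_diff (sPsi j) Ux.
  by apply/funext => y; rewrite fct_sumE [LHS]row_sum_delta.
elim: k f df bf => [|k IH] f df bf.
  apply/smk0; split; last exact: (bf [::]).
  move=> x Ux; apply: differentiable_comp; [exact: dPsi|exact: (df [::])].
apply/smkS; split; last 1 first.
- move=> i; apply: (@smk_eq _ gbd2 k (fun x => \sum_j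
      rpartial j f (Psi x) * rpartial i (fun x => Psi x 0 j) x)).
  + move=> x Ux; have dc := differentiable_comp (dPsi _ Ux) (df [::] (Psi x)).
    rewrite /rpartial -[RHS]/('D_(delta_mx 0 i) (f \o Psi) x) deriveE//.
    rewrite diff_comp//=; last 2 first.
    * exact: dPsi.
    * exact: (df [::]).
    rewrite -deriveE; last exact: (df [::]).
    rewrite derive_partials; last exact: (df [::]).
    apply: eq_bigr => j _; rewrite mulrC; congr (_ * _).
    rewrite -deriveE; last exact: dPsi.
    by rewrite derive_mx ?mxE//; exact/diff_derivable/dPsi.
  + apply: smk_sum => // j; apply: (smkM gbd2 bdM).
      apply: IH => [s x|s]; first by rewrite -rpartials_rcons; exact: df.
      by under eq_fun do rewrite -rpartials_rcons; exact: bf.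
    by move: k {IH}; apply/smE; exact: sm_partial.
- move=> x Ux; apply: differentiable_comp; [exact: dPsi|exact: (df [::])].
- exact: (bf [::]).
Qed.

(** A family B closed under derivation replaces the iterated derivatives of a
    function of one variable. *)
Lemma sm_comp1 (B : set (R -> R)) (V : set R) (l : 'rV[R]_m -> R) :
  (forall b, B b -> exists2 b', B b' & forall y : R, V y -> is_derive y 1 b (b' y)) ->
  (forall b, B b -> bd2 (fun x => b (l x))) ->
  (forall x, U x -> V (l x)) ->
  sm U bd1 l -> forall b, B b -> sm U bd2 (fun x => b (l x)).
Proof.
move=> dB bB UV sl b Bb; apply/smE => k; elim: k b Bb => [|k IH] b Bb.
  apply/smk0; split; last exact: bB.
  move=> x Ux; have [b' _ b'P] := dB _ Bb.
  apply: (@differentiable_comp _ _ _ _ l b); first exact: sm_diff sl Ux.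
  by apply/derivable1_diffP; have [] := b'P _ (UV _ Ux).
have [b' Bb' b'P] := dB _ Bb.
have db x : U x -> differentiable b (l x).
  by move=> Ux; apply/derivable1_diffP; have [] := b'P _ (UV _ Ux).
have dl x : U x -> differentiable l x by exact: sm_diff.
apply/smkS; split; last 1 first.
- move=> i; apply: (@smk_eq _ gbd2 k (fun x => b' (l x) * rpartial i l x)).
    move=> x Ux; rewrite /rpartial -[RHS]/('D_(delta_mx 0 i) (b \o l) x).
    rewrite [RHS]deriveE; last by apply: (@differentiable_comp _ _ _ _ l b); [exact: dl|exact: db].
    rewrite diff_comp//=; [|exact: dl|exact: db].
    rewrite -(deriveE _ (dl _ Ux)) -[X in 'd b _ X]mulr1 -[_ * 1]/(_ *: 1) linearZ.
    rewrite -(deriveE _ (db _ Ux)) mulrC; congr (_ * _).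
    by have := b'P _ (UV _ Ux) => -[_ ->].
  apply: (smkM gbd2 bdM); first exact: IH.
  by move: k {IH}; apply/smE; exact: sm_partial.
- by move=> x Ux; apply: (@differentiable_comp _ _ _ _ l b); [exact: dl|exact: db].
- exact: bB.
Qed.

End composition.
End closure.
End smooth_growth.

(** * Mean value estimates, symmetry of second derivatives, Taylor bounds *)

Section mean_value.
Context {R : realType}.

Definition rsmooth m (U : set 'rV[R]_m) (f : 'rV[R]_m -> R) :=
  forall s x, U x -> differentiable (rpartials s f) x.

Lemma growthT m (U : set 'rV[R]_m) : growth U setT.
Proof. by []. Qed.

Lemma rsmoothE m (U : set 'rV[R]_m) f : rsmooth U f <-> sm U setT f.
Proof. by split=> sf s; [split=> // x; exact: sf|exact: (sf s).1]. Qed.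

Lemma sm_rsmooth m (U : set 'rV[R]_m) bd f : sm U bd f -> rsmooth U f.
Proof. by move=> sf s; exact: (sf s).1. Qed.

Lemma rsmooth_partials m (U : set 'rV[R]_m) s f : rsmooth U f -> rsmooth U (rpartials s f).
Proof. by move=> sf t x Ux; rewrite -rpartials_cat; exact: sf. Qed.

Lemma rsmooth_partial m (U : set 'rV[R]_m) i f : rsmooth U f -> rsmooth U (rpartial i f).
Proof. exact: (rsmooth_partials [:: i]). Qed.

Lemma rsmooth_diff m (U : set 'rV[R]_m) f x : rsmooth U f -> U x -> differentiable f x.
Proof. by move=> /(_ [::]); exact. Qed.

Lemma is_derive_line m (f : 'rV[R]_m -> R) x v (t : R) :
  differentiable f (x + t *: v) ->
  is_derive t 1 (fun t => f (x + t *: v)) ('D_v f (x + t *: v)).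
Proof.
move=> df; have E : (fun h : R => h^-1 *: (((fun t => f (x + t *: v)) \o shift t)
      (h *: 1) - f (x + t *: v))) =
    (fun h => h^-1 *: ((f \o shift (x + t *: v)) (h *: v) - f (x + t *: v))).
  apply/funext => h; rewrite /shift /=; congr (_ *: (f _ - _)).
  by rewrite -[h *: 1]/(h * 1) mulr1 scalerDl addrCA.
apply: DeriveDef; rewrite /derivable /derive E //.
exact: diff_derivable.
Qed.

Lemma increment_mean_value m (f : 'rV[R]_m -> R) x v :
  (forall t : R, 0 <= t <= 1 -> differentiable f (x + t *: v)) ->
  exists2 t : R, 0 <= t <= 1 & f (x + v) - f x = 'D_v f (x + t *: v).
Proof.
move=> df; pose g (t : R) := f (x + t *: v).
have dg (t : R) : 0 <= t <= 1 -> is_derive t 1 g ('D_v f (x + t *: v)).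
  by move=> t01; apply: is_derive_line; exact: df.
have [||t] := @MVT_segment R g (fun t => 'D_v f (x + t *: v)) 0 1 ler01.
- by move=> t; rewrite in_itv /= => /andP[/ltW t0 /ltW t1]; apply: dg; rewrite t0.
- apply: derivable_within_continuous => t; rewrite in_itv /= => t01.
  by have [] := dg _ t01.
- rewrite in_itv /= => t01; rewrite subr0 mulr1 /g scale1r scale0r addr0 => E.
  by exists t.
Qed.

Lemma sum_coord_le m (v : 'rV[R]_m) (a : 'I_m -> R) C :
  (forall i, `|a i| <= C) -> `|\sum_i v 0 i * a i| <= m%:R * C * `|v|.
Proof.
move=> aC; apply: (le_trans (ler_norm_sum _ _ _)).
apply: (@le_trans _ _ (\sum_(i < m) C * `|v|)).
  apply: ler_sum => i _; rewrite normrM mulrC ler_pM//; exact: ler_coord_norm.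
by rewrite sumr_const card_ord -mulrA mulr_natl.
Qed.

Lemma lipschitz_partials m (f : 'rV[R]_m -> R) x v C :
  (forall t : R, 0 <= t <= 1 -> differentiable f (x + t *: v)) ->
  (forall (t : R) i, 0 <= t <= 1 -> `|rpartial i f (x + t *: v)| <= C) ->
  `|f (x + v) - f x| <= m%:R * C * `|v|.
Proof.
move=> df fC; have [t t01 ->] := increment_mean_value df.
rewrite derive_partials; last exact: df.
by apply: sum_coord_le => i; exact: fC.
Qed.

Lemma quadratic_partials m (f : 'rV[R]_m -> R) x v C : 0 <= C ->
  (forall t : R, 0 <= t <= 1 -> differentiable f (x + t *: v)) ->
  (forall (t : R) i, 0 <= t <= 1 -> differentiable (rpartial i f) (x + t *: v)) ->
  (forall (t : R) i j, 0 <= t <= 1 ->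
     `|rpartial j (rpartial i f) (x + t *: v)| <= C) ->
  `|f (x + v) - f x - \sum_i v 0 i * rpartial i f x| <= m%:R ^+ 2 * C * `|v| ^+ 2.
Proof.
move=> C0 df d2f fC; have [t t01 ->] := increment_mean_value df.
have [t0 t1] := andP t01.
rewrite derive_partials; last exact: df.
rewrite -sumrB; under eq_bigr do rewrite -mulrBr.
rewrite (_ : m%:R ^+ 2 * C * `|v| ^+ 2 = m%:R * (m%:R * C * `|v|) * `|v|); last by ring.
apply: sum_coord_le => i.
apply: (@le_trans _ _ (m%:R * C * `|t *: v|)).
  apply: lipschitz_partials => [r|r j] /andP[r0 r1]; rewrite scalerA.
    by apply: d2f; rewrite mulr_ge0//= mulr_ile1.
  by apply: fC; rewrite mulr_ge0//= mulr_ile1.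
rewrite ler_wpM2l ?mulr_ge0// normrZ ger0_norm//.
by rewrite ler_piMl.
Qed.

Lemma norm_delta m (i : 'I_m) : `|delta_mx 0 i : 'rV[R]_m| <= 1.
Proof.
by apply: row_norm_le => // j; rewrite mxE; case: (_ && _); rewrite ?normr1 ?normr0.
Qed.

Lemma increment_partial m (f : 'rV[R]_m -> R) x i (h : R) :
  (forall t : R, 0 <= t <= 1 -> differentiable f (x + (t * h) *: delta_mx 0 i)) ->
  exists2 t : R, 0 <= t <= 1 & f (x + h *: delta_mx 0 i) - f x =
    h * rpartial i f (x + (t * h) *: delta_mx 0 i).
Proof.
move=> df; have [|t t01 ->] := @increment_mean_value _ f x (h *: delta_mx 0 i).
  by move=> t t01; rewrite scalerA; exact: df.
exists t => //; rewrite scalerA /rpartial deriveE; last exact: df.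
by rewrite linearZ -deriveE; last exact: df.
Qed.

(** The second difference is symmetric in i and j, so that letting h tend to 0
    gives the symmetry of second derivatives. *)
Lemma second_difference m (f : 'rV[R]_m -> R) x i j (h : R) : 0 <= h ->
  (forall y, `|y - x| <= h + h -> differentiable f y) ->
  (forall y, `|y - x| <= h + h -> differentiable (rpartial i f) y) ->
  exists2 y, `|y - x| <= h + h &
    f (x + h *: delta_mx 0 i + h *: delta_mx 0 j) - f (x + h *: delta_mx 0 i)
    - (f (x + h *: delta_mx 0 j) - f x) = h ^+ 2 * rpartial j (rpartial i f) y.
Proof.
move=> h0 df dif.
have le_delta (t : R) k : 0 <= t <= 1 -> `|(t * h) *: (delta_mx 0 k : 'rV[R]_m)| <= h.
  move=> /andP[t0 t1]; rewrite normrZ ger0_norm ?mulr_ge0//.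
  apply: (@le_trans _ _ (t * h * 1)); last by rewrite mulr1 ler_piMl.
  by rewrite ler_wpM2l ?mulr_ge0 ?norm_delta.
have le_delta1 k : `|h *: (delta_mx 0 k : 'rV[R]_m)| <= h.
  by have := @le_delta 1 k; rewrite mul1r lexx ler01; exact.
pose g y := f (y + h *: delta_mx 0 j) - f y.
have dg (t : R) : 0 <= t <= 1 ->
    differentiable (fun y => f (y + h *: delta_mx 0 j)) (x + (t * h) *: delta_mx 0 i).
  move=> t01; apply: (@differentiable_comp _ _ _ _ (fun y => y + h *: delta_mx 0 j) f) => //.
  apply: df; rewrite /= addrAC [x + _]addrC addrK.
  by rewrite (le_trans (ler_normD _ _))// lerD// le_delta.
have dg' (t : R) : 0 <= t <= 1 -> differentiable f (x + (t * h) *: delta_mx 0 i).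
  move=> t01; apply: df; rewrite addrC addKr.
  by rewrite (le_trans (le_delta _ _ t01))// lerDl.
have [t t01 E] : exists2 t : R, 0 <= t <= 1 & g (x + h *: delta_mx 0 i) - g x =
    h * rpartial i g (x + (t * h) *: delta_mx 0 i).
  apply: increment_partial => t t01; apply: differentiableB; [exact: dg|exact: dg'].
have [r r01 E2] : exists2 r : R, 0 <= r <= 1 &
    rpartial i f (x + (t * h) *: delta_mx 0 i + h *: delta_mx 0 j)
      - rpartial i f (x + (t * h) *: delta_mx 0 i) =
    h * rpartial j (rpartial i f)
      (x + (t * h) *: delta_mx 0 i + (r * h) *: delta_mx 0 j).
  apply: increment_partial => r r01; apply: dif.
  by rewrite addrAC [x + _]addrC addrK (le_trans (ler_normD _ _))// lerD// le_delta.
exists (x + (t * h) *: delta_mx 0 i + (r * h) *: delta_mx 0 j).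
  by rewrite addrAC [x + _]addrC addrK (le_trans (ler_normD _ _))// lerD// le_delta.
rewrite expr2 -mulrA -E2 -[LHS]/(g (x + h *: delta_mx 0 i) - g x) E; congr (_ * _).
rewrite /rpartial /g deriveB; last 2 first.
- exact/diff_derivable/dg.
- exact/diff_derivable/dg'.
congr (_ - _).
have Es : (fun k : R => k^-1 *: (((fun y => f (y + h *: delta_mx 0 j)) \o
    shift (x + (t * h) *: delta_mx 0 i)) (k *: delta_mx 0 i)
    - f (x + (t * h) *: delta_mx 0 i + h *: delta_mx 0 j))) =
  (fun k => k^-1 *: ((f \o shift (x + (t * h) *: delta_mx 0 i + h *: delta_mx 0 j))
     (k *: delta_mx 0 i) - f (x + (t * h) *: delta_mx 0 i + h *: delta_mx 0 j))).
  by apply/funext => k; rewrite /shift /= !addrA.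
by rewrite /derive Es.
Qed.

Lemma partialC m (U : set 'rV[R]_m) f i j x : open U -> rsmooth U f -> U x ->
  rpartial i (rpartial j f) x = rpartial j (rpartial i f) x.
Proof.
move=> oU sf Ux; apply/eqP; rewrite -subr_eq0 -normr_le0.
apply/ler_addgt0Pr => e e0; rewrite add0r.
have c k l : {for x, continuous (rpartial k (rpartial l f))}.
  exact: (differentiable_continuous (sf [:: k; l] x Ux)).
have e20 : 0 < e / 2 by rewrite divr_gt0.
have nU : \forall y \near x, U y by exact: open_nbhs_nbhs.
have /cvgrPdist_lt/(_ _ e20) n1 := c i j.
have /cvgrPdist_lt/(_ _ e20) n2 := c j i.
have [d d0 dP] := (nbhs_normP _ _).1 (filterI nU (filterI n1 n2)).
have {}d0 : 0 < d by [].
have {}dP y : `|x - y| < d -> [/\ U y,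
    `|rpartial i (rpartial j f) x - rpartial i (rpartial j f) y| < e / 2 &
    `|rpartial j (rpartial i f) x - rpartial j (rpartial i f) y| < e / 2].
  by move=> /dP[Uy [y1 y2]]; split; [exact: Uy|exact: y1|exact: y2].
pose h := d / 3.
have h0 : 0 < h by rewrite divr_gt0.
have hP y : `|y - x| <= h + h -> `|x - y| < d.
  by move=> yx; rewrite distrC (le_lt_trans yx)// /h; lra.
have dfy y : `|y - x| <= h + h -> differentiable f y.
  by move=> /hP/dP[Uy _ _]; exact: (sf [::]).
have dfk k y : `|y - x| <= h + h -> differentiable (rpartial k f) y.
  by move=> /hP/dP[Uy _ _]; exact: (sf [:: k]).
have [y /hP/dP[_ y1 y2] E1] := @second_difference _ f x i j h (ltW h0) dfy (dfk i).
have [z /hP/dP[_ z1 z2] E2] := @second_difference _ f x j i h (ltW h0) dfy (dfk j).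
have key (a b l k D1 D2 : R) : D1 = h ^+ 2 * l -> D2 = h ^+ 2 * k -> D1 = D2 ->
    `|a - k| < e / 2 -> `|b - l| < e / 2 -> `|a - b| <= e.
  move=> -> -> /(mulfI _) -> ; last by rewrite expf_neq0// gt_eqF.
  move=> ak bk; rewrite (_ : a - b = (a - k) - (b - k)); last by ring.
  by rewrite (le_trans (ler_normB _ _))// (splitr e) lerD// ltW.
apply: (key _ _ _ _ _ _ E1 E2 _ z1 y2).
rewrite [x + h *: delta_mx 0 j + _]addrAC; generalize (f (x + h *: delta_mx 0 i)).
by generalize (f (x + h *: delta_mx 0 j)) => u v; ring.
Qed.

Lemma partials_partialC m (U : set 'rV[R]_m) f i s x : open U -> rsmooth U f -> U x ->
  rpartials s (rpartial i f) x = rpartial i (rpartials s f) x.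
Proof.
move=> oU sf; elim: s x => //= j s IH x Ux.
rewrite (partial_local _ oU IH Ux).
exact: (partialC _ _ oU (rsmooth_partials _ sf) Ux).
Qed.

Lemma partials_comm m (U : set 'rV[R]_m) f s t x : open U -> rsmooth U f -> U x ->
  rpartials s (rpartials t f) x = rpartials t (rpartials s f) x.
Proof.
move=> oU sf; elim: t x => //= i t IH x Ux.
rewrite (partials_partialC _ _ oU (rsmooth_partials _ sf) Ux).
exact: (partial_local _ oU IH Ux).
Qed.

Lemma compact_bounded_fun (T : topologicalType) (K : set T) (f : T -> R) :
  compact K -> (forall x, K x -> {for x, continuous f}) ->
  exists2 C, 0 <= C & forall x, K x -> `|f x| <= C.
Proof.
move=> cK cf; have [->|/set0P K0] := eqVneq K set0; first by exists 0.
have [|x _ xP] := @compact_EVT_max T R (fun x => `|f x|) K K0 cK.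
  apply: continuous_in_subspaceT => x /set_mem Kx.
  by apply: continuous_comp; [exact: cf|exact: norm_continuous].
by exists `|f x| => // y Ky; apply: xP; exact/mem_set.
Qed.

Definition cbox m (c : 'rV[R]_m) (r : R) : set 'rV[R]_m := [set x | `|x - c| <= r].

Lemma closed_cbox m (c : 'rV[R]_m) r : closed (cbox c r).
Proof.
rewrite /cbox -[X in closed X]/((fun x => `|x - c|) @^-1` [set t | t <= r]).
apply: closed_comp; last exact: closed_le.
move=> x _; apply: continuous_comp; last exact: norm_continuous.
by apply: continuousB => //; exact: cst_continuous.
Qed.

Lemma compact_cbox m (c : 'rV[R]_m) r : compact (cbox c r).
Proof.
apply: bounded_closed_compact; last exact: closed_cbox.
exists (`|c| + r); split; first exact: num_real.
move=> t tM x xr; apply: ltW; apply: le_lt_trans tM.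
rewrite -[x](subrK c) (le_trans (ler_normD _ _))// addrC lerD2l//.
Qed.

Lemma compact_cboxP m (K : set 'rV[R]_m) : compact K ->
  exists2 r, 0 <= r & K `<=` cbox 0 r.
Proof.
move=> cK; have [x _|C C0 CP] := @compact_bounded_fun _ K (fun x => `|x|) cK.
  exact: norm_continuous.
by exists C => // x Kx; rewrite /cbox /= subr0 -(normr_id x) CP.
Qed.

(** By induction on N: the derivative of the remainder is the remainder of lower
    order of the shifted chain, to which the mean value theorem applies. *)
Lemma taylor_bound (N : nat) (phi : nat -> R -> R) (C e : R) : 0 <= e ->
  (forall k (t : R), is_derive t 1 (phi k) (phi k.+1 t)) ->
  (forall t, 0 <= t <= e -> `|phi N t| <= C) ->
  `|phi 0%N e - \sum_(k < N) phi k 0 * (e ^+ k / k`!%:R)| <= C * e ^+ N.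
Proof.
elim: N phi e => [|N IH] phi e e0 dphi phiC.
  by rewrite big_ord0 subr0 mulr1 phiC// e0 lexx.
pose psi t := phi 0%N t - \sum_(k < N.+1) phi k 0 * (t ^+ k / k`!%:R).
pose dpsi t := phi 1%N t - \sum_(k < N) phi k.+1 0 * (t ^+ k / k`!%:R).
have dP (t : R) : is_derive t 1 psi (dpsi t).
  rewrite (_ : psi = phi 0%N - (cst (phi 0%N 0) + \sum_(k < N)
      (fun t : R => phi k.+1 0 * (t ^+ k.+1 / k.+1`!%:R)))); last first.
    apply/funext => r; rewrite /psi big_ord_recl /= expr0 fact0 invr1 !mulr1.
    by rewrite !fctE fct_sumE.
  have D (k : 'I_N) : is_derive t 1 (fun t => phi k.+1 0 * (t ^+ k.+1 / k.+1`!%:R))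
      (phi k.+1 0 * (t ^+ k / k`!%:R)).
    rewrite (_ : (fun t => _) =
      (phi k.+1 0 / k.+1`!%:R) *: (fun r : R => r ^+ k.+1)); last first.
      by apply/funext => r /=; rewrite -[RHS]/(_ * _) mulrAC -mulrA.
    apply: DeriveDef; first by apply: derivableZ; exact: exprn_derivable.
    rewrite deriveZ; last exact: exprn_derivable.
    rewrite exp_derive /= -![_ *: _]/(_ * _) mulr1 factS natrM.
    have k0 : k.+1%:R != 0 :> R by rewrite pnatr_eq0.
    have f0 : k`!%:R != 0 :> R by rewrite pnatr_eq0 -lt0n fact_gt0.
    by field; rewrite f0 addrC natr1 k0.
  have := is_deriveB (dphi 0%N t) (is_deriveD (is_derive_cst (phi 0%N 0) t 1)
    (is_derive_sum D)).
  by rewrite add0r.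
have psi0 : psi 0 = 0.
  rewrite /psi big_ord_recl /= expr0 fact0 invr1 !mulr1 big1 ?addr0 ?subrr// => k _.
  by rewrite expr0n /= mul0r mulr0.
have [|t t0e E] := @MVT_segment R psi dpsi 0 e e0 (fun t _ => dP t).
  by apply: derivable_within_continuous => t _; have [] := dP t.
have /andP[t0 te] : 0 <= t <= e by move: t0e; rewrite in_itv.
move: E; rewrite psi0 !subr0 /psi => ->; rewrite normrM (ger0_norm e0) exprSr mulrA.
rewrite ler_wpM2r//.
apply: (@le_trans _ _ (C * t ^+ N)).
  apply: (IH (fun k => phi k.+1)) => // r /andP[r0 rt].
  by apply: phiC; rewrite r0 (le_trans rt).
rewrite ler_wpM2l//; last by rewrite lerXn2r// ?nnegrE.
by apply: le_trans (phiC 0 _); rewrite ?lexx ?e0.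
Qed.

End mean_value.

(** * Growth classes *)

Section growth_classes.
Context {R : realType} {m : nat} {A : Type}.
Variables (U : set 'rV[R]_m) (S : A -> set 'rV[R]_m) (w : 'rV[R]_m -> R).

(** For w = 1 / e this is moderateness in e, for w = 1 + |z| slow growth at infinity. *)
Definition wmoderate (f : 'rV[R]_m -> R) := forall a, exists C : R, exists L : nat,
  0 <= C /\ forall x, U x -> S a x -> `|f x| <= C * w x ^+ L.

(** For w = 1 / e this is negligibility, for w = 1 + |z| rapid decrease at infinity. *)
Definition wrapid (f : 'rV[R]_m -> R) := forall a (N : nat), exists C : R,
  0 <= C /\ forall x, U x -> S a x -> `|f x| * w x ^+ N <= C.

Hypothesis w1 : forall a x, U x -> S a x -> 1 <= w x.

Lemma wmoderate_growth : growth U wmoderate.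
Proof.
split.
- by move=> a; exists 0, 0%N; split=> // x _ _; rewrite normr0 mul0r.
- move=> f g fg bf a; have [C [L [C0 fC]]] := bf a; exists C, L; split=> // x Ux Sx.
  by rewrite (le_trans (fg _ Ux))// fC.
- move=> f g bf bg a.
  have [C [L [C0 fC]]] := bf a; have [D [M [D0 gD]]] := bg a.
  exists (C + D), (maxn L M); split; first exact: addr_ge0.
  move=> x Ux Sx; have wx := w1 Ux Sx.
  rewrite (le_trans (ler_normD _ _))// mulrDl lerD//.
    rewrite (le_trans (fC _ Ux Sx))// ler_wpM2l//.
    by rewrite ler_weXn2l// leq_maxl.
  rewrite (le_trans (gD _ Ux Sx))// ler_wpM2l//.
  by rewrite ler_weXn2l// leq_maxr.
Qed.

Lemma wrapid_growth : growth U wrapid.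
Proof.
split.
- by move=> a N; exists 0; split=> // x _ _; rewrite normr0 mul0r.
- move=> f g fg bf a N; have [C [C0 fC]] := bf a N; exists C; split=> // x Ux Sx.
  apply: le_trans (fC _ Ux Sx); rewrite ler_wpM2r ?fg// exprn_ge0//.
  exact: le_trans (w1 Ux Sx).
- move=> f g bf bg a N; have [C [C0 fC]] := bf a N; have [D [D0 gD]] := bg a N.
  exists (C + D); split; first exact: addr_ge0.
  move=> x Ux Sx; apply: (@le_trans _ _ ((`|f x| + `|g x|) * w x ^+ N)).
    rewrite ler_wpM2r ?ler_normD// exprn_ge0//; exact: le_trans (w1 Ux Sx).
  by rewrite mulrDl lerD// ?fC ?gD.
Qed.

Lemma wmoderateM f g : wmoderate f -> wmoderate g -> wmoderate (fun x => f x * g x).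
Proof.
move=> bf bg a.
have [C [L [C0 fC]]] := bf a; have [D [M [D0 gD]]] := bg a.
exists (C * D), (L + M)%N; split; first exact: mulr_ge0.
move=> x Ux Sx; rewrite normrM exprD mulrACA.
by rewrite ler_pM// ?fC ?gD.
Qed.

Lemma wrapidM f g : wrapid f -> wmoderate g -> wrapid (fun x => f x * g x).
Proof.
move=> bf bg a N; have [D [M [D0 gD]]] := bg a; have [C [C0 fC]] := bf a (M + N)%N.
exists (C * D); split; first exact: mulr_ge0.
move=> x Ux Sx; have w0 : 0 <= w x by exact: le_trans (w1 Ux Sx).
rewrite normrM -mulrA.
apply: (@le_trans _ _ (`|f x| * (D * w x ^+ M * w x ^+ N))).
  by rewrite ler_wpM2l// ler_wpM2r ?exprn_ge0// gD.
rewrite (_ : _ * (_ * _ * _) = `|f x| * w x ^+ (M + N) * D); last by rewrite exprD; ring.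
by rewrite ler_wpM2r// fC.
Qed.

Lemma wmoderate_bounded f : (forall a, exists2 C : R, 0 <= C &
  forall x, U x -> S a x -> `|f x| <= C) -> wmoderate f.
Proof.
move=> fb a; have [C C0 fC] := fb a; exists C, 0%N; split=> // x Ux Sx.
by rewrite mulr1 fC.
Qed.

Lemma wmoderate_cst c : wmoderate (fun=> c).
Proof. by apply: wmoderate_bounded => a; exists `|c|. Qed.

End growth_classes.

(** * Plateau functions *)

Section plateau.
Context {R : realType}.

Lemma smD_r m (U : set 'rV[R]_m) f g : open U -> rsmooth U f -> rsmooth U g ->
  rsmooth U (fun x => f x + g x).
Proof.
by move=> oU /rsmoothE sf /rsmoothE sg; apply/rsmoothE/(smD oU (growthT U)).
Qed.

Lemma smM_r m (U : set 'rV[R]_m) f g : open U -> rsmooth U f -> rsmooth U g ->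
  rsmooth U (fun x => f x * g x).
Proof.
move=> oU /rsmoothE sf /rsmoothE sg; apply/rsmoothE.
exact: (smM oU (growthT U) _ sf sg).
Qed.

Lemma rsmooth_cst m (U : set 'rV[R]_m) (c : R) : open U -> rsmooth U (fun=> c).
Proof. by move=> oU; apply/rsmoothE/(sm_cst oU (growthT U)). Qed.

Lemma rsmooth_coord m (U : set 'rV[R]_m) i : open U -> rsmooth U (fun x => x 0 i).
Proof. by move=> oU; apply/rsmoothE/(sm_coord oU (growthT U)). Qed.

Lemma rsmooth_sum m (U : set 'rV[R]_m) (I : Type) (r : seq I) f : open U ->
  (forall i, rsmooth U (f i)) -> rsmooth U (fun x => \sum_(i <- r) f i x).
Proof.
move=> oU sf; apply/rsmoothE/(sm_sum oU (growthT U)) => i.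
exact/rsmoothE/sf.
Qed.

Lemma rsmooth_eq m (U : set 'rV[R]_m) f g : open U ->
  (forall x, U x -> f x = g x) -> rsmooth U f -> rsmooth U g.
Proof. by move=> oU fg /rsmoothE sf; apply/rsmoothE/(sm_eq oU (growthT U) fg). Qed.

Lemma rsmooth_prod m (U : set 'rV[R]_m) (I : Type) (r : seq I) f : open U ->
  (forall i, rsmooth U (f i)) -> rsmooth U (fun x => \prod_(i <- r) f i x).
Proof.
move=> oU sf; elim: r => [|i r IH].
  by apply: (rsmooth_eq oU _ (rsmooth_cst 1 oU)) => x _; rewrite big_nil.
by apply: (rsmooth_eq oU _ (smM_r oU (sf i) IH)) => x _; rewrite big_cons.
Qed.

Lemma rsmooth_comp m p (U : set 'rV[R]_m) (f : 'rV[R]_p -> R) (Psi : 'rV[R]_m -> 'rV[R]_p) :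
  open U -> rsmooth setT f -> (forall j, rsmooth U (fun x => Psi x 0 j)) ->
  rsmooth U (fun x => f (Psi x)).
Proof.
move=> oU sf sPsi; apply/rsmoothE.
apply: (@sm_comp _ _ _ oU setT setT (growthT U)) => //.
  by move=> s x; exact: sf.
by move=> j; exact/rsmoothE/sPsi.
Qed.

(** A family containing the inverse to which sm_comp1 applies. *)
Definition inverse_powers : set (R -> R) := [set b | exists (c : R) (k : nat),
  b = fun y => c * y^-1 ^+ k].

Lemma inverse_powers_derive b : inverse_powers b ->
  exists2 b', inverse_powers b' & forall y : R, y != 0 -> is_derive y 1 b (b' y).
Proof.
move=> [c [k ->]]; exists (fun y => - (c * k%:R) * y^-1 ^+ k.+1).
  by exists (- (c * k%:R)), k.+1.
move=> y y0; have dV : is_derive y 1 (fun y : R => y^-1) (- y ^- 2 *: 1).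
  exact: is_deriveV.
rewrite (_ : (fun y => _) = c *: (fun y : R => y^-1) ^+ k); last first.
  by apply/funext => x; rewrite /GRing.scale /= fctE; congr (_ * _); elim: k => [|k IH]; rewrite ?expr0// !exprS -IH.
apply: (is_derive_eq (is_deriveZ c (is_deriveX k dV))).
rewrite /GRing.scale /= mulr1; case: k => [|k] /=; first by rewrite !mulr0 !mul0r oppr0 mul0r mulr0.
by rewrite !exprS expr0 mulr1; field.
Qed.

Lemma rsmooth_inv m (U : set 'rV[R]_m) g : open U -> rsmooth U g ->
  (forall x, U x -> g x != 0) -> rsmooth U (fun x => (g x)^-1).
Proof.
move=> oU /rsmoothE sg g0; apply/rsmoothE.
have := @sm_comp1 _ _ _ oU setT setT (growthT U) _ inverse_powers [set y | y != 0] g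
  inverse_powers_derive _ _ sg (fun y => 1 * y^-1 ^+ 1).
rewrite (_ : (fun x => 1 * (g x)^-1 ^+ 1) = (fun x => (g x)^-1)); last first.
  by apply/funext => x; rewrite mul1r.
by apply=> //; exists 1, 1%N.
Qed.

(** With p = 1 this is the smooth function exp (- 1 / x) extended by 0; the factor
    p makes the family closed under derivation. *)
Definition flat (p : {poly R}) (x : R) : R :=
  if 0 < x then p.[x^-1] * expR (- x^-1) else 0.

Lemma horner_bound (p : {poly R}) : exists2 C, 0 <= C &
  forall y, 1 <= y -> `|p.[y]| <= C * y ^+ size p.
Proof.
exists (\sum_(i < size p) `|p`_i|); first by rewrite sumr_ge0.
move=> y y1; rewrite horner_coef (le_trans (ler_norm_sum _ _ _))// mulr_suml.
apply: ler_sum => i _; rewrite normrM ler_wpM2l// ger0_norm.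
  by rewrite ler_weXn2l// ltnW.
by rewrite exprn_ge0// (le_trans ler01).
Qed.

(** Exponential decay beats the polynomial in 1 / x; the exponent 2 gives
    differentiability at 0 with derivative 0. *)
Lemma flat_bound p : exists2 C, 0 <= C & forall x, `|x| <= 1 -> `|flat p x| <= C * x ^+ 2.
Proof.
have [C C0 pC] := horner_bound p; pose k := (size p).+1.
exists (C * (k.+1)`!%:R); first by rewrite mulr_ge0.
move=> x x1; rewrite /flat; case: ifPn => x0; last by rewrite normr0 mulr_ge0 ?sqr_ge0// mulr_ge0.
move: x1; rewrite gtr0_norm// => x1; set y := x^-1.
have y1 : 1 <= y by rewrite /y invf_ge1.
have y0 : 0 < y by rewrite (lt_le_trans ltr01).
rewrite normrM (gtr0_norm (expR_gt0 _)) expRN.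
have e1 : y ^+ k.+1 / (k.+1)`!%:R <= expR y.
  by have := expR_ge1Dxn k (ltW y0); apply: le_trans; rewrite lerDr.
have f0 : 0 < (k.+1)`!%:R :> R by rewrite ltr0n fact_gt0.
rewrite ler_pdivrMr ?expR_gt0//.
apply: (le_trans (pC _ y1)).
apply: (@le_trans _ _ (C * (k.+1)`!%:R * x ^+ 2 * (y ^+ k.+1 / (k.+1)`!%:R))).
  rewrite le_eqVlt; apply/orP; left; apply/eqP.
  have -> : y ^+ k.+1 = y ^+ size p * y ^+ 2 by rewrite -exprD addn2.
  have -> : x ^+ 2 = (y ^+ 2)^-1 by rewrite /y exprVn invrK.
  by field; rewrite !gt_eqF.
by rewrite ler_wpM2l// mulr_ge0 ?sqr_ge0// mulr_ge0.
Qed.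

Lemma flat_derive p (x : R) :
  is_derive x 1 (flat p) (flat ('X^2 * (p - p^`())) x).
Proof.
have [x0|x0|x0] := ltgtP x 0.
- rewrite [flat (_ * _) x](_ : _ = 0); last by rewrite /flat ltNge (ltW x0).
  apply: (@near_eq_is_derive _ _ _ (cst (0 : R))).
  near=> y; rewrite /flat ltNge (_ : y <= 0)//.
  by apply: ltW; near: y; exact: lt_nbhsl.
- rewrite [flat (_ * _) x]/flat x0.
  have dV : is_derive x 1 (fun y : R => y^-1) (- x ^- 2 *: 1).
    by apply: is_deriveV; rewrite gt_eqF.
  have d1 := is_derive1_comp (is_derive_poly p x^-1) dV.
  have d2 := @is_derive1_comp _ expR (- (fun y : R => y^-1)) x _ _ (is_derive_expR _) (is_deriveN dV).
  apply: (near_eq_is_derive _ (is_derive_eq (is_deriveM d1 d2) _)).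
    near=> y; rewrite /flat /= (_ : 0 < y)//.
    by near: y; exact: lt_nbhsr.
  rewrite /GRing.scale /= hornerM hornerXn hornerD hornerN exprVn.
  by ring.
- subst x; rewrite [flat (_ * _) 0](_ : _ = 0); last by rewrite /flat ltxx.
  have [C C0 fC] := flat_bound p.
  pose L : {linear R -> R} := \0.
  have [|d dE] := @differentiable_approx R R (flat p) 0 L (@cst_continuous _ _ _).
    move=> e e0.
    have e1 : 0 < Num.min 1 (e / (C + 1)) by rewrite lt_min ltr01 divr_gt0// ltr_wpDl.
    apply: (filterS _ (@nbhs0_lt _ R _ e1)) => v.
    rewrite lt_min => /andP[v1 ve].
    rewrite add0r [flat p 0](_ : _ = 0) /= ?subr0; last by rewrite /flat ltxx.
    rewrite (le_trans (fC _ (ltW v1)))//.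
    rewrite -real_normK ?num_real// expr2 mulrA ler_wpM2r//.
    rewrite (@le_trans _ _ ((C + 1) * `|v|))//.
      by rewrite ler_wpM2r// lerDl.
    by rewrite mulrC -ler_pdivlMr ?ltr_wpDl// ltW.
  by apply: DeriveDef; [exact: diff_derivable|rewrite deriveE// dE].
Unshelve. all: by end_near. Qed.

Lemma rsmooth_flat m (U : set 'rV[R]_m) g : open U -> rsmooth U g ->
  rsmooth U (fun x => flat 1 (g x)).
Proof.
move=> oU /rsmoothE sg; apply/rsmoothE.
apply: (@sm_comp1 _ _ _ oU setT setT (growthT U) _ (range flat) setT g) => //.
move=> _ [p _ <-]; exists (flat ('X^2 * (p - p^`()))) => // y _.
exact: flat_derive.
Qed.

Lemma flat_gt0 x : 0 < x -> 0 < flat 1 x.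
Proof. by move=> x0; rewrite /flat x0 hornerC mul1r expR_gt0. Qed.

Lemma flat_ge0 x : 0 <= flat 1 x.
Proof. by rewrite /flat; case: ifP => // _; rewrite hornerC mul1r expR_ge0. Qed.

Lemma flat_le0 x : x <= 0 -> flat 1 x = 0.
Proof. by move=> x0; rewrite /flat ltNge x0. Qed.

Definition step (x : R) : R := flat 1 x / (flat 1 x + flat 1 (1 - x)).

Lemma step_den_gt0 x : 0 < flat 1 x + flat 1 (1 - x).
Proof.
have [x0|x0] := ltP 0 x; first by rewrite ltr_pwDl ?flat_gt0 ?flat_ge0.
by rewrite ltr_wpDl ?flat_ge0// flat_gt0//; lra.
Qed.

Lemma step1 x : 1 <= x -> step x = 1.
Proof.
move=> x1; rewrite /step [X in _ + X]flat_le0; last by lra.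
by rewrite addr0 divff// gt_eqF// flat_gt0; lra.
Qed.

Lemma step0 x : x <= 0 -> step x = 0.
Proof. by move=> x0; rewrite /step flat_le0// mul0r. Qed.

Lemma rsmooth_step m (U : set 'rV[R]_m) g : open U -> rsmooth U g ->
  rsmooth U (fun x => step (g x)).
Proof.
move=> oU sg; apply: (smM_r oU); first exact: rsmooth_flat.
have s1 : rsmooth U (fun x => flat 1 (1 - g x)).
  apply: rsmooth_flat => //.
  apply: (rsmooth_eq oU _ (smD_r oU (rsmooth_cst 1 oU) (smM_r oU (rsmooth_cst (-1) oU) sg))) => x _.
  by rewrite mulN1r.
apply: rsmooth_inv => //.
  by apply: smD_r => //; exact: rsmooth_flat.
by move=> x _; rewrite gt_eqF// step_den_gt0.
Qed.

Lemma plateau m (c : 'rV[R]_m) (r : R) : 0 < r -> exists psi : 'rV[R]_m -> R,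
  [/\ rsmooth setT psi, forall x, `|x - c| <= r -> psi x = 1 &
      forall x, r + r <= `|x - c| -> psi x = 0].
Proof.
move=> r0; pose a (x : 'rV[R]_m) i := (x 0 i - c 0 i) / r.
exists (fun x => \prod_i (step (2 - a x i) * step (2 + a x i))).
have sa k i : rsmooth setT (fun x => 2 + k * a x i).
  apply: (rsmooth_eq openT _ (smD_r openT (rsmooth_cst (2 - k * (c 0 i / r)) openT)
    (smM_r openT (rsmooth_cst (k / r) openT) (rsmooth_coord i openT)))) => x _.
  by rewrite /a; field; rewrite gt_eqF.
split.
- apply: rsmooth_prod; first exact: openT.
  move=> i; apply: (smM_r openT).
    apply: (rsmooth_eq openT _ (rsmooth_step openT (sa (-1) i))) => x _.
    by rewrite mulN1r.
  apply: (rsmooth_eq openT _ (rsmooth_step openT (sa 1 i))) => x _.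
  by rewrite mul1r.
- move=> x xr; rewrite big1// => i _.
  have : `|a x i| <= 1.
    rewrite normrM normfV (gtr0_norm r0) ler_pdivrMr// mul1r.
    by apply: le_trans xr; have := ler_coord_norm (x - c) i; rewrite !mxE.
  by rewrite ler_norml => /andP[a1 a2]; rewrite !step1 ?mulr1//; lra.
- move=> x xr; have [|[j i] /= E] := @mx_norm_neq0 _ _ _ (x - c).
    rewrite -[mx_norm _]/`|x - c| gt_eqF// (lt_le_trans _ xr)// addr_gt0//.
  rewrite (bigD1 i)//= [X in X * _](_ : _ = 0) ?mul0r//.
  have : 2 <= `|a x i|.
    rewrite normrM normfV (gtr0_norm r0) ler_pdivlMr//.
    rewrite -[mx_norm _]/`|x - c| in E.
    have : r + r <= `|x 0 i - c 0 i|.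
      by rewrite (le_trans xr)// E ord1 !mxE.
    lra.
  rewrite ler_normr => /orP[h|h].
    by rewrite step0 ?mul0r//; lra.
  by rewrite mulrC step0 ?mul0r//; lra.
Qed.

End plateau.

(** * Complex-valued smooth functions and the seminorms of C^oo *)

Section complex_functions.
Context {R : realType}.
Implicit Types z w : R[i].

Lemma ReD z w : complex.Re (z + w) = complex.Re z + complex.Re w.
Proof. by case: z; case: w. Qed.

Lemma ImD z w : complex.Im (z + w) = complex.Im z + complex.Im w.
Proof. by case: z; case: w. Qed.

Lemma ReN z : complex.Re (- z) = - complex.Re z.
Proof. by case: z. Qed.

Lemma ImN z : complex.Im (- z) = - complex.Im z.
Proof. by case: z. Qed.

Lemma ReM z w : complex.Re (z * w) =
  complex.Re z * complex.Re w - complex.Im z * complex.Im w.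
Proof. by case: z; case: w. Qed.

Lemma ImM z w : complex.Im (z * w) =
  complex.Re z * complex.Im w + complex.Im z * complex.Re w.
Proof. by case: z; case: w. Qed.

Lemma Re_sum I (r : seq I) (F : I -> R[i]) :
  complex.Re (\sum_(i <- r) F i) = \sum_(i <- r) complex.Re (F i).
Proof. by elim: r => [|i r IH]; rewrite ?big_nil// !big_cons ReD IH. Qed.

Lemma Im_sum I (r : seq I) (F : I -> R[i]) :
  complex.Im (\sum_(i <- r) F i) = \sum_(i <- r) complex.Im (F i).
Proof. by elim: r => [|i r IH]; rewrite ?big_nil// !big_cons ImD IH. Qed.

Lemma ReZ (c : R) z : complex.Re (c%:C * z) = c * complex.Re z.
Proof. by rewrite ReM /= mul0r subr0. Qed.

Lemma ImZ (c : R) z : complex.Im (c%:C * z) = c * complex.Im z.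
Proof. by rewrite ImM /= mul0r addr0. Qed.

Lemma complex_ext z w : complex.Re z = complex.Re w -> complex.Im z = complex.Im w -> z = w.
Proof. by case: z => a b; case: w => c d /= -> ->. Qed.

Lemma cmodE z : cmod z = Num.sqrt (complex.Re z ^+ 2 + complex.Im z ^+ 2).
Proof. by case: z. Qed.

Lemma cmod_ge0 z : 0 <= cmod z.
Proof. by rewrite cmodE sqrtr_ge0. Qed.

Lemma cmod0 : cmod (0 : R[i]) = 0.
Proof. exact: Normc.normc0. Qed.

Lemma cmodD z w : cmod (z + w) <= cmod z + cmod w.
Proof. exact: le_normcD. Qed.

Lemma cmodM z w : cmod (z * w) = cmod z * cmod w.
Proof. exact: Normc.normcM. Qed.

Lemma cmodN z : cmod (- z) = cmod z.
Proof. exact: normcN. Qed.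

Lemma cmodB z w : cmod (z - w) <= cmod z + cmod w.
Proof. by rewrite -(cmodN w) cmodD. Qed.

Lemma cmod_real (c : R) : cmod c%:C = `|c|.
Proof. by rewrite cmodE /= expr0n addr0 sqrtr_sqr. Qed.

Lemma Re_cmod z : `|complex.Re z| <= cmod z.
Proof. by rewrite cmodE -sqrtr_sqr ler_wsqrtr// lerDl sqr_ge0. Qed.

Lemma Im_cmod z : `|complex.Im z| <= cmod z.
Proof. by rewrite cmodE -sqrtr_sqr ler_wsqrtr// lerDr sqr_ge0. Qed.

Lemma cmod_le_ReIm z : cmod z <= `|complex.Re z| + `|complex.Im z|.
Proof.
rewrite cmodE -(@ler_pXn2r _ 2)// ?nnegrE ?sqrtr_ge0 ?addr_ge0//.
rewrite sqr_sqrtr ?addr_ge0 ?sqr_ge0// sqrrD !real_normK ?num_real//.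
rewrite -addrA [_ *+ 2 + _]addrC addrA lerDl mulrn_wge0// mulr_ge0//.
Qed.

Definition re_fun m (f : 'rV[R]_m -> R[i]) x := complex.Re (f x).
Definition im_fun m (f : 'rV[R]_m -> R[i]) x := complex.Im (f x).

Lemma re_fun_partials m s (f : 'rV[R]_m -> R[i]) :
  re_fun (partials s f) = rpartials s (re_fun f).
Proof. by apply/funext => x; exact: Re_partials. Qed.

Lemma im_fun_partials m s (f : 'rV[R]_m -> R[i]) :
  im_fun (partials s f) = rpartials s (im_fun f).
Proof. by apply/funext => x; exact: Im_partials. Qed.

Lemma smoothP m (U : set 'rV[R]_m) (f : 'rV[R]_m -> R[i]) :
  smooth U f <-> rsmooth U (re_fun f) /\ rsmooth U (im_fun f).
Proof.
split=> [sf|[rf jf] s x Ux].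
  split=> s x Ux; have [] := sf s x Ux.
    by rewrite -re_fun_partials.
  by rewrite -im_fun_partials.
by split; [have := rf s x Ux; rewrite -re_fun_partials
          |have := jf s x Ux; rewrite -im_fun_partials].
Qed.

Lemma partials_eq m (f g : 'rV[R]_m -> R[i]) s t x :
  rpartials s (re_fun f) x = rpartials t (re_fun g) x ->
  rpartials s (im_fun f) x = rpartials t (im_fun g) x ->
  partials s f x = partials t g x.
Proof. by move=> fr fi; apply: complex_ext; rewrite ?Re_partials ?Im_partials. Qed.

Lemma cpartials_cat m (s t : seq 'I_m) (f : 'rV[R]_m -> R[i]) :
  partials (s ++ t) f = partials s (partials t f).
Proof. by elim: s => //= i s ->. Qed.

Lemma smooth_partials m (U : set 'rV[R]_m) s f : smooth U f -> smooth U (partials s f).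
Proof. by move=> sf t; rewrite -cpartials_cat; exact: sf. Qed.

Lemma cpartials_local m (U : set 'rV[R]_m) s (f g : 'rV[R]_m -> R[i]) : open U ->
  (forall x, U x -> f x = g x) ->
  forall x, U x -> partials s f x = partials s g x.
Proof.
move=> oU fg x Ux; apply: partials_eq.
  by apply: (partials_local _ oU) Ux => y Uy; rewrite /re_fun fg.
by apply: (partials_local _ oU) Ux => y Uy; rewrite /im_fun fg.
Qed.

Lemma smooth_local m (U : set 'rV[R]_m) (f g : 'rV[R]_m -> R[i]) : open U ->
  (forall x, U x -> f x = g x) -> smooth U f -> smooth U g.
Proof.
move=> oU fg /smoothP[rf jf]; apply/smoothP; split.
  by apply: (rsmooth_eq oU) rf => y Uy; rewrite /re_fun fg.
by apply: (rsmooth_eq oU) jf => y Uy; rewrite /im_fun fg.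
Qed.

Lemma smoothW m (U V : set 'rV[R]_m) (f : 'rV[R]_m -> R[i]) : V `<=` U -> smooth U f -> smooth V f.
Proof. by move=> VU sf s x /VU; exact: sf. Qed.

Lemma rpartialsD m (U : set 'rV[R]_m) s (f g : 'rV[R]_m -> R) : open U ->
  rsmooth U f -> rsmooth U g -> forall x, U x ->
  rpartials s (fun y => f y + g y) x = rpartials s f x + rpartials s g x.
Proof.
move=> oU sf sg; elim: s => //= i s IH x Ux.
rewrite (partial_local _ oU IH Ux) /rpartial deriveD//.
  exact/diff_derivable/sf.
exact/diff_derivable/sg.
Qed.

Lemma rpartialsZ m (U : set 'rV[R]_m) s (f : 'rV[R]_m -> R) c : open U ->
  rsmooth U f -> forall x, U x ->
  rpartials s (fun y => c * f y) x = c * rpartials s f x.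
Proof.
move=> oU sf; elim: s => //= i s IH x Ux.
rewrite (partial_local _ oU IH Ux) /rpartial (@deriveZ _ _ _ (rpartials s f))//.
exact/diff_derivable/sf.
Qed.

Lemma smoothD m (U : set 'rV[R]_m) (f g : 'rV[R]_m -> R[i]) : open U ->
  smooth U f -> smooth U g -> smooth U (fun x => f x + g x).
Proof.
move=> oU /smoothP[rf jf] /smoothP[rg jg]; apply/smoothP; split.
  by apply: (rsmooth_eq oU _ (smD_r oU rf rg)) => x _; rewrite /re_fun ReD.
by apply: (rsmooth_eq oU _ (smD_r oU jf jg)) => x _; rewrite /im_fun ImD.
Qed.

Lemma smoothM m (U : set 'rV[R]_m) (f g : 'rV[R]_m -> R[i]) : open U ->
  smooth U f -> smooth U g -> smooth U (fun x => f x * g x).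
Proof.
move=> oU /smoothP[rf jf] /smoothP[rg jg]; apply/smoothP; split.
  apply: (rsmooth_eq oU _ (smD_r oU (smM_r oU rf rg)
    (smM_r oU (rsmooth_cst (-1) oU) (smM_r oU jf jg)))) => x _.
  by rewrite /re_fun ReM mulN1r.
apply: (rsmooth_eq oU _ (smD_r oU (smM_r oU rf jg) (smM_r oU jf rg))) => x _.
by rewrite /im_fun ImM.
Qed.

Lemma smooth_cst m (U : set 'rV[R]_m) (c : R[i]) : open U -> smooth U (fun=> c).
Proof. by move=> oU; apply/smoothP; split; exact: rsmooth_cst. Qed.

Lemma smoothZ m (U : set 'rV[R]_m) (c : R[i]) f : open U ->
  smooth U f -> smooth U (fun x => c * f x).
Proof. by move=> oU; apply: smoothM => //; exact: smooth_cst. Qed.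

Lemma smoothB m (U : set 'rV[R]_m) (f g : 'rV[R]_m -> R[i]) : open U ->
  smooth U f -> smooth U g -> smooth U (fun x => f x - g x).
Proof.
move=> oU sf /(smoothZ (-1) oU) sg.
apply: (smooth_local oU _ (smoothD oU sf sg)) => x _; by rewrite mulN1r.
Qed.

Lemma smooth_sum m (U : set 'rV[R]_m) (I : Type) (r : seq I) F : open U ->
  (forall i, smooth U (F i)) -> smooth U (fun x => \sum_(i <- r) F i x).
Proof.
move=> oU sF; apply/smoothP; split.
  apply: (rsmooth_eq oU _ (rsmooth_sum r oU (fun i => ((smoothP _ _).1 (sF i)).1))).
  by move=> x _; rewrite /re_fun Re_sum.
apply: (rsmooth_eq oU _ (rsmooth_sum r oU (fun i => ((smoothP _ _).1 (sF i)).2))).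
by move=> x _; rewrite /im_fun Im_sum.
Qed.

Lemma smooth_real m (U : set 'rV[R]_m) (f : 'rV[R]_m -> R) : open U ->
  rsmooth U f -> smooth U (fun x => (f x)%:C).
Proof. by move=> oU sf; apply/smoothP; split=> //; exact: rsmooth_cst. Qed.

Lemma smooth_comp m p (U : set 'rV[R]_m) (f : 'rV[R]_p -> R[i]) (Psi : 'rV[R]_m -> 'rV[R]_p) :
  open U -> smooth setT f -> (forall j, rsmooth U (fun x => Psi x 0 j)) ->
  smooth U (fun x => f (Psi x)).
Proof.
move=> oU /smoothP[rf jf] sPsi; apply/smoothP; split.
  exact: (rsmooth_comp oU rf sPsi).
exact: (rsmooth_comp oU jf sPsi).
Qed.

Lemma partialsD m (U : set 'rV[R]_m) s (f g : 'rV[R]_m -> R[i]) : open U ->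
  smooth U f -> smooth U g -> forall x, U x ->
  partials s (fun y => f y + g y) x = partials s f x + partials s g x.
Proof.
move=> oU /smoothP[rf jf] /smoothP[rg jg] x Ux.
apply: complex_ext; rewrite ?ReD ?ImD ?Re_partials ?Im_partials.
  rewrite -(rpartialsD _ oU rf rg Ux); congr (rpartials s _ x).
  by apply/funext => y; exact: ReD.
rewrite -(rpartialsD _ oU jf jg Ux); congr (rpartials s _ x).
by apply/funext => y; exact: ImD.
Qed.

Lemma partialsZ m (U : set 'rV[R]_m) s (c : R) (f : 'rV[R]_m -> R[i]) : open U ->
  smooth U f -> forall x, U x ->
  partials s (fun y => c%:C * f y) x = c%:C * partials s f x.
Proof.
move=> oU /smoothP[rf jf] x Ux.
apply: complex_ext; rewrite ?ReZ ?ImZ ?Re_partials ?Im_partials.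
  rewrite -(rpartialsZ _ c oU rf Ux); congr (rpartials s _ x).
  by apply/funext => y; exact: ReZ.
rewrite -(rpartialsZ _ c oU jf Ux); congr (rpartials s _ x).
by apply/funext => y; exact: ImZ.
Qed.

Lemma partialsB m (U : set 'rV[R]_m) s (f g : 'rV[R]_m -> R[i]) : open U ->
  smooth U f -> smooth U g -> forall x, U x ->
  partials s (fun y => f y - g y) x = partials s f x - partials s g x.
Proof.
move=> oU sf sg x Ux; have sg' := smoothZ ((-1)%:C) oU sg.
rewrite -mulN1r -[-1](_ : (-1)%:C = -1); last by apply/eqP; rewrite eq_complex /= oppr0 !eqxx.
rewrite -(partialsZ s _ oU sg Ux) -(partialsD s oU sf sg' Ux).
congr (partials s _ x); apply/funext => y.
by rewrite (_ : (-1)%:C = -1) ?mulN1r//; apply/eqP; rewrite eq_complex /= oppr0 !eqxx.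
Qed.

Lemma partials_cst0 m (s : seq 'I_m) x : partials s (fun _ : 'rV[R]_m => 0 : R[i]) x = 0.
Proof.
have := @partialsZ m setT s 0 (fun=> 0) openT (smooth_cst 0 openT) x I.
move=> E; transitivity (0%:C * partials s (fun _ : 'rV[R]_m => 0 : R[i]) x).
  by rewrite -E; congr (partials s _ x); apply/funext => y; rewrite mulr0.
by rewrite [0%:C](_ : _ = 0)// mul0r.
Qed.

Lemma partials_sum m (U : set 'rV[R]_m) s (I : Type) (r : seq I) F : open U ->
  (forall i : I, smooth U (F i)) -> forall x, U x ->
  partials s (fun y => \sum_(i <- r) F i y) x = \sum_(i <- r) partials s (F i) x.
Proof.
move=> oU sF x Ux; elim: r => [|i r IH].
  rewrite big_nil -[RHS](partials_cst0 s x); congr (partials s _ x).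
  by apply/funext => y; rewrite big_nil.
rewrite big_cons -IH -(partialsD s oU (sF i) (smooth_sum r oU sF) Ux).
by congr (partials s _ x); apply/funext => y; rewrite big_cons.
Qed.

Lemma Cinf_norm_le m (K : set 'rV[R]_m) k f C : 0 <= C ->
  (forall s x, (size s <= k)%N -> K x -> cmod (partials s f x) <= C) ->
  Cinf_norm K k f <= C.
Proof.
move=> C0 fC; rewrite /Cinf_norm; set E := [set r | _].
have [E0|/set0P E0] := eqVneq E set0; first by rewrite E0 sup0.
by apply: ge_sup => // r [s [x [sk Kx ->]]]; exact: fC.
Qed.

Lemma Cinf_norm_ge0 m (K : set 'rV[R]_m) k f : 0 <= Cinf_norm K k f.
Proof.
rewrite /Cinf_norm; set E := [set r | _].
have [[[r Er] bE]|/sup_out ->//] := pselect (has_sup E).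
apply: (@le_trans _ _ r); last exact: ub_le_sup.
by case: Er => s [x [_ _ ->]]; exact: cmod_ge0.
Qed.

(** There are finitely many multi-indices of bounded length, so that a bound may be
    chosen for each of them separately. *)
Lemma seq_bound m k (c : seq 'I_m -> nat) :
  exists N, forall s, (size s <= k)%N -> (c s <= N)%N.
Proof.
elim: k c => [|k IH] c; first by exists (c [::]) => -[].
have [N NP] := IH (fun s => \sum_(i < m) c (i :: s))%N.
exists (c [::] + N)%N => -[|i s] /= sk; first exact: leq_addr.
by rewrite (leq_trans _ (leq_addl _ _))// (leq_trans _ (NP s sk))// (bigD1 i)//= leq_addr.
Qed.

Lemma seq_bound_ex m k (P : seq 'I_m -> nat -> Prop) :
  (forall s N M, (N <= M)%N -> P s N -> P s M) -> (forall s, exists N, P s N) ->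
  exists N, forall s, (size s <= k)%N -> P s N.
Proof.
move=> mP /choice[c cP]; have [N NP] := seq_bound k c.
by exists N => s sk; apply: mP (cP s); exact: NP.
Qed.

Lemma real_nat_bound (C : R) : exists N : nat, C <= N%:R.
Proof.
exists (Num.truncn C).+1; have := real_truncnS_gt (num_real C); exact: ltW.
Qed.

Lemma smooth_continuous_cmod m (U : set 'rV[R]_m) (f : 'rV[R]_m -> R[i]) x : smooth U f -> U x ->
  {for x, continuous (fun y => `|re_fun f y| + `|im_fun f y|)}.
Proof.
move=> /smoothP[rf jf] Ux.
apply: continuousD; (apply: continuous_comp; last exact: norm_continuous).
  exact: differentiable_continuous (rf [::] x Ux).
exact: differentiable_continuous (jf [::] x Ux).
Qed.

Lemma smooth_bounded m (U K : set 'rV[R]_m) (f : 'rV[R]_m -> R[i]) :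
  smooth U f -> compact K -> K `<=` U ->
  exists2 C, 0 <= C & forall x, K x -> cmod (f x) <= C.
Proof.
move=> sf cK KU.
have [|C C0 CP] := @compact_bounded_fun R _ K (fun y => `|re_fun f y| + `|im_fun f y|) cK.
  by move=> x /KU; exact: smooth_continuous_cmod.
exists C => // x Kx; rewrite (le_trans (cmod_le_ReIm _))//.
by rewrite (le_trans _ (CP _ Kx))// ler_norm.
Qed.

Lemma Cinf_norm_ge m (U K : set 'rV[R]_m) k f s x : smooth U f -> compact K ->
  K `<=` U -> (size s <= k)%N -> K x -> cmod (partials s f x) <= Cinf_norm K k f.
Proof.
move=> sf cK KU sk Kx; apply: ub_le_sup; last by exists s, x.
have [|t|N NP] := @seq_bound_ex m k (fun s N => forall x, K x -> cmod (partials s f x) <= N%:R).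
- move=> t N M NM tN y Ky; rewrite (le_trans (tN _ Ky))// ler_nat//.
- have [C C0 CP] := smooth_bounded (smooth_partials t sf) cK KU.
  have [N NC] := real_nat_bound C.
  by exists N => y Ky; rewrite (le_trans (CP _ Ky)).
by exists N%:R => r [t [y [tk Ky ->]]]; exact: NP.
Qed.

End complex_functions.

(** * Distributions depending on parameters *)

Lemma cpartials_comm (R : realType) m (U : set 'rV[R]_m) s t f x : open U ->
  smooth U f -> U x -> partials s (partials t f) x = partials t (partials s f) x.
Proof.
move=> oU /smoothP[rf jf] Ux; apply: partials_eq; rewrite !(re_fun_partials, im_fun_partials).
  exact: (partials_comm s t oU rf Ux).
exact: (partials_comm s t oU jf Ux).
Qed.

Section parameters.
Context {R : realType} {a m : nat}.

Lemma rpartial_slice_r (F : 'rV[R]_(a + m) -> R) y i r :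
  rpartial i (fun r => F (row_mx y r)) r = rpartial (rshift a i) F (row_mx y r).
Proof.
have E : (fun h : R => h^-1 *: (((fun r => F (row_mx y r)) \o shift r)
      (h *: delta_mx 0 i) - F (row_mx y r))) =
    (fun h => h^-1 *: ((F \o shift (row_mx y r)) (h *: delta_mx 0 (rshift a i))
      - F (row_mx y r))).
  apply/funext => h; rewrite /shift /=; congr (_ *: (F _ - _)).
  apply/rowP => j; rewrite !mxE /=; case: splitP => k jk; rewrite ?mxE.
    rewrite (_ : j == rshift a i = false) ?andbF ?mulr0 ?add0r//.
    by apply/eqP => /(congr1 val) /=; rewrite jk => E; have := ltn_ord k; rewrite E -ltn_subRL subnn.
  congr (_ * _%:R + _); congr (_ && _); rewrite -!val_eqE /= jk.
  by rewrite eqnE eqn_add2l.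
by rewrite /rpartial /derive E.
Qed.

Lemma rpartial_slice_l (F : 'rV[R]_(a + m) -> R) r i y :
  rpartial i (fun y => F (row_mx y r)) y = rpartial (lshift m i) F (row_mx y r).
Proof.
have E : (fun h : R => h^-1 *: (((fun y => F (row_mx y r)) \o shift y)
      (h *: delta_mx 0 i) - F (row_mx y r))) =
    (fun h => h^-1 *: ((F \o shift (row_mx y r)) (h *: delta_mx 0 (lshift m i))
      - F (row_mx y r))).
  apply/funext => h; rewrite /shift /=; congr (_ *: (F _ - _)).
  apply/rowP => j; rewrite !mxE /=; case: splitP => k jk; rewrite ?mxE.
    by congr (_ * _%:R + _); congr (_ && _); rewrite -!val_eqE /= jk.
  rewrite (_ : j == lshift m i = false) ?andbF ?mulr0 ?add0r//.
  by apply/eqP => /(congr1 val) /=; rewrite jk => E; have := ltn_ord i; rewrite -E -ltn_subRL subnn.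
by rewrite /rpartial /derive E.
Qed.

Lemma rpartials_slice_r (F : 'rV[R]_(a + m) -> R) y s r :
  rpartials s (fun r => F (row_mx y r)) r =
  rpartials (map (@rshift a m) s) F (row_mx y r).
Proof.
elim: s r => //= i s IH r; rewrite -rpartial_slice_r.
by congr (rpartial i _ r); apply/funext.
Qed.

Lemma partials_slice_r (G : 'rV[R]_(a + m) -> R[i]) y s r :
  partials s (fun r => G (row_mx y r)) r =
  partials (map (@rshift a m) s) G (row_mx y r).
Proof.
apply: complex_ext; rewrite ?Re_partials ?Im_partials.
  exact: (rpartials_slice_r (re_fun G)).
exact: (rpartials_slice_r (im_fun G)).
Qed.

Lemma rsmooth_row_r (U : set 'rV[R]_a) (F : 'rV[R]_(a + m) -> R) y : U y ->
  rsmooth [set z | U (lsubmx z)] F -> rsmooth setT (fun r => F (row_mx y r)).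
Proof.
move=> Uy sF s r _.
rewrite (_ : rpartials s _ = fun r => rpartials (map (@rshift a m) s) F (row_mx y r)); last first.
  by apply/funext => t; exact: rpartials_slice_r.
apply: (@differentiable_comp _ _ _ _ (fun r => row_mx y r) (rpartials _ F)).
  rewrite (_ : (fun r => _) = (fun r => \sum_j (row_mx y r) 0 j *: delta_mx 0 j)); last first.
    by apply/funext => t; rewrite [LHS]row_sum_delta.
  rewrite (_ : (fun r => _) = \sum_j (fun r => (row_mx y r) 0 j *: delta_mx 0 j)); last first.
    by apply/funext => t; rewrite fct_sumE.
  apply: differentiable_sum => j; apply: differentiableZl.
  rewrite (_ : (fun r => _) = match fintype.split j with inl k => cst (y 0 k) | inr k => fun r : 'rV[R]_m => r 0 k end).
    case: (fintype.split j) => k; first exact: differentiable_cst.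
    exact: differentiable_coord.
  by apply/funext => t; rewrite mxE; case: (fintype.split j).
by apply: sF; rewrite /= row_mxKl.
Qed.

Lemma smooth_row_r (U : set 'rV[R]_a) (G : 'rV[R]_(a + m) -> R[i]) y : U y ->
  smooth [set z | U (lsubmx z)] G -> smooth setT (fun r => G (row_mx y r)).
Proof.
move=> Uy /smoothP[rG jG]; apply/smoothP; split.
  exact: (rsmooth_row_r Uy rG).
exact: (rsmooth_row_r Uy jG).
Qed.

Lemma open_lsubmx (U : set 'rV[R]_a) : open U -> open [set z : 'rV[R]_(a + m) | U (lsubmx z)].
Proof.
move=> oU; apply: open_comp => // z _.
exact/differentiable_continuous/differentiable_lsubmx.
Qed.

Definition cylinder (y : 'rV[R]_a) (d M : R) : set 'rV[R]_(a + m) :=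
  [set z | `|lsubmx z - y| <= d /\ `|rsubmx z| <= M].

Lemma compact_cylinder y d M : compact (cylinder y d M).
Proof.
have H (z : 'rV[R]_(a + m)) : cylinder y d M z -> `|z| <= Num.max (`|y| + d) M.
  move=> [zd zM]; rewrite -(hsubmxK z) row_mx_norm ge_max !le_max zM orbT andbT.
  rewrite -[lsubmx z](subrK y) (le_trans (ler_normD _ _)) ?(addrC `|y|) ?lerD2r//.
apply: bounded_closed_compact.
  exists (Num.max (`|y| + d) M); split; first exact: num_real.
  by move=> t tM z /H zM; exact: le_trans zM (ltW tM).
rewrite (_ : cylinder y d M = [set z | cbox y d (lsubmx z)] `&` [set z | cbox 0 M (rsubmx z)]); last first.
  by apply/funext => z; rewrite /cylinder /cbox /setI /= subr0.
apply: closedI; apply: closed_comp; try exact: closed_cbox.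
  move=> z _; exact/differentiable_continuous/differentiable_lsubmx.
by move=> z _; exact/differentiable_continuous/differentiable_rsubmx.
Qed.

(** Uniformity over the compact set of all r with |r| <= M makes the estimate
    survive the application of a distribution acting on r. *)
Lemma slice_quadratic (U : set 'rV[R]_a) (F : 'rV[R]_(a + m) -> R) y d M :
  cbox y d `<=` U -> rsmooth [set z | U (lsubmx z)] F ->
  exists N : nat, forall h r, `|h| <= d -> `|r| <= M ->
    `|F (row_mx (y + h) r) - F (row_mx y r)
      - \sum_i h 0 i * rpartial (lshift m i) F (row_mx y r)| <= N%:R * `|h| ^+ 2.
Proof.
move=> dU sF.
have KU : cylinder y d M `<=` [set z | U (lsubmx z)] by move=> z [zd _]; exact: dU.
have [N NP] : exists N : nat, forall s, (size s <= 2)%N -> forall z, cylinder y d M z ->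
    `|rpartials s F z| <= N%:R.
  apply: (@seq_bound_ex _ 2 (fun s N => forall z, cylinder y d M z ->
    `|rpartials s F z| <= N%:R)) => [s N N' NN sN z Kz|s].
    by rewrite (le_trans (sN _ Kz))// ler_nat.
  have [|C C0 CP] := @compact_bounded_fun R _ _ (rpartials s F) (@compact_cylinder y d M).
    by move=> z Kz; apply: differentiable_continuous; exact: sF (KU _ Kz).
  have [N CN] := real_nat_bound C.
  by exists N => z Kz; rewrite (le_trans (CP _ Kz)).
have [N' NN'] := real_nat_bound ((a + m)%:R ^+ 2 * N%:R : R).
exists N' => h r hd rM.
have seg (t : R) : 0 <= t <= 1 -> cylinder y d M (row_mx y r + t *: row_mx h 0).
  move=> /andP[t0 t1]; rewrite scale_row_mx add_row_mx; split.
    rewrite row_mxKl addrC addKr normrZ ger0_norm//.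
    by rewrite (le_trans _ hd)// ler_piMl.
  by rewrite row_mxKr scaler0 addr0.
rewrite (_ : row_mx (y + h) r = row_mx y r + row_mx h 0); last first.
  by rewrite add_row_mx addr0.
have -> : \sum_i h 0 i * rpartial (lshift m i) F (row_mx y r) =
    \sum_i (row_mx h (0 : 'rV[R]_m)) 0 i * rpartial i F (row_mx y r).
  rewrite big_split_ord /= [X in _ = _ + X]big1 ?addr0.
    by apply: eq_bigr => i _; rewrite row_mxEl.
  by move=> i _; rewrite row_mxEr mxE mul0r.
have hn : `|row_mx h (0 : 'rV[R]_m)| = `|h|.
  by rewrite row_mx_norm normr0 max_l.
apply: (@le_trans _ _ ((a + m)%:R ^+ 2 * N%:R * `|row_mx h (0 : 'rV[R]_m)| ^+ 2)).
  apply: quadratic_partials => // [t t01|t i t01|t i j t01].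
  - exact: (sF [::] _ (KU _ (seg _ t01))).
  - exact: (sF [:: i] _ (KU _ (seg _ t01))).
  - exact: (NP [:: j; i] isT _ (seg _ t01)).
by rewrite hn ler_wpM2r// sqr_ge0.
Qed.

Definition remainder (G : 'rV[R]_(a + m) -> R[i]) y h r :=
  G (row_mx (y + h) r) - G (row_mx y r)
  - \sum_i (h 0 i)%:C * partial (lshift m i) G (row_mx y r).

Lemma partials_remainder (U : set 'rV[R]_a) G y h s r : open U -> U y -> U (y + h) ->
  smooth [set z | U (lsubmx z)] G ->
  partials s (remainder G y h) r = remainder (partials (map (@rshift a m) s) G) y h r.
Proof.
move=> oU Uy Uh sG.
have s1 := smooth_row_r Uh sG; have s2 := smooth_row_r Uy sG.
have s3 i := smooth_row_r Uy (smooth_partials [:: lshift m i] sG).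
have s4 i : smooth setT (fun r => (h 0 i)%:C * partial (lshift m i) G (row_mx y r)).
  exact: smoothZ (openT) (s3 i).
rewrite /remainder.
rewrite (partialsB s openT (smoothB openT s1 s2) (smooth_sum _ openT s4))//.
rewrite (partialsB s openT s1 s2)// (partials_sum s _ openT s4)// !partials_slice_r.
congr (_ - _); apply: eq_bigr => i _.
rewrite (partialsZ s (h 0 i) openT (s3 i))//; congr (_ * _).
rewrite (partials_slice_r (partial (lshift m i) G)).
apply: (cpartials_comm _ [:: lshift m i] (open_lsubmx oU) sG).
by rewrite /= row_mxKl.
Qed.

Lemma cmod_remainder_le G y h r :
  cmod (remainder G y h r) <=
  `|re_fun G (row_mx (y + h) r) - re_fun G (row_mx y r)
      - \sum_i h 0 i * rpartial (lshift m i) (re_fun G) (row_mx y r)| +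
  `|im_fun G (row_mx (y + h) r) - im_fun G (row_mx y r)
      - \sum_i h 0 i * rpartial (lshift m i) (im_fun G) (row_mx y r)|.
Proof.
rewrite (le_trans (cmod_le_ReIm _))//.
have -> : complex.Re (remainder G y h r) = re_fun G (row_mx (y + h) r)
    - re_fun G (row_mx y r)
    - \sum_i h 0 i * rpartial (lshift m i) (re_fun G) (row_mx y r).
  rewrite /remainder !ReD !ReN Re_sum; congr (_ - _).
  by apply: eq_bigr => i _; rewrite ReZ.
have -> // : complex.Im (remainder G y h r) = im_fun G (row_mx (y + h) r)
    - im_fun G (row_mx y r)
    - \sum_i h 0 i * rpartial (lshift m i) (im_fun G) (row_mx y r).
rewrite /remainder !ImD !ImN Im_sum; congr (_ - _).
by apply: eq_bigr => i _; rewrite ImZ.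
Qed.

Lemma remainder_bound (U : set 'rV[R]_a) G y d M k : open U ->
  0 <= d -> cbox y d `<=` U -> smooth [set z | U (lsubmx z)] G ->
  exists N : nat, forall h s r, `|h| <= d -> (size s <= k)%N -> `|r| <= M ->
    cmod (partials s (remainder G y h) r) <= N%:R * `|h| ^+ 2.
Proof.
move=> oU d0 dU sG.
have [s N N' NN H h r hd rM|s|N NP] := @seq_bound_ex m k (fun s N => forall h r,
    `|h| <= d -> `|r| <= M -> cmod (partials s (remainder G y h) r) <= N%:R * `|h| ^+ 2).
- rewrite (le_trans (H _ _ hd rM))// ler_wpM2r ?sqr_ge0// ler_nat//.
- have [rG jG] := (smoothP _ _).1 (smooth_partials (map (@rshift a m) s) sG).
  have [N1 P1] := slice_quadratic M dU rG; have [N2 P2] := slice_quadratic M dU jG.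
  exists (N1 + N2)%N => h r hd rM.
  rewrite (partials_remainder _ _ oU _ _ sG); last 2 first.
  - by apply: dU; rewrite /cbox /= subrr normr0.
  - by apply: dU; rewrite /cbox /= addrC addKr.
  rewrite (le_trans (cmod_remainder_le _ _ _ _))// natrD mulrDl.
  by apply: lerD; [exact: P1|exact: P2].
- by exists N => h s r hd sk rM; exact: NP.
Qed.

End parameters.

Section distributions.
Context {R : realType} {m : nat}.
Variable u : ('rV[R]_m -> R[i]) -> R[i].
Hypothesis cu : compact_distribution u.

Lemma distr0 : u (fun=> 0) = 0.
Proof.
have s0 := smooth_cst (m := m) (0 : R[i]) openT.
have := cu.1 1 (fun=> 0) (fun=> 0) s0 s0.
rewrite (_ : (fun x => 1 * 0 + 0) = fun=> 0); last first.
  by apply/funext => x; rewrite mulr0 addr0.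
by rewrite mul1r => /eqP; rewrite -subr_eq0 opprD addrA subrr sub0r oppr_eq0 => /eqP.
Qed.

Lemma distrD f g : smooth setT f -> smooth setT g ->
  u (fun x => f x + g x) = u f + u g.
Proof.
move=> sf sg; have := cu.1 1 f g sf sg; rewrite mul1r => <-; congr u.
by apply/funext => x; rewrite mul1r.
Qed.

Lemma distrZ c f : smooth setT f -> u (fun x => c * f x) = c * u f.
Proof.
move=> sf; have := cu.1 c f (fun=> 0) sf (smooth_cst _ openT).
rewrite distr0 addr0 => <-; congr u; by apply/funext => x; rewrite addr0.
Qed.

Lemma distrB f g : smooth setT f -> smooth setT g ->
  u (fun x => f x - g x) = u f - u g.
Proof.
move=> sf sg; have := distrD sf (smoothZ (-1) openT sg).
rewrite distrZ// mulN1r => <-; congr u.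
by apply/funext => x; rewrite mulN1r.
Qed.

Lemma distr_sum (I : Type) (r : seq I) (F : I -> 'rV[R]_m -> R[i]) :
  (forall i, smooth setT (F i)) ->
  u (fun x => \sum_(i <- r) F i x) = \sum_(i <- r) u (F i).
Proof.
move=> sF; elim: r => [|i r IH].
  rewrite big_nil -[RHS]distr0; congr u; by apply/funext => x; rewrite big_nil.
rewrite big_cons -IH -distrD//; last exact: smooth_sum openT sF.
by congr u; apply/funext => x; rewrite big_cons.
Qed.

Lemma distr_bound : exists (M : R) (k B : nat), 0 <= M /\ forall f C,
  smooth setT f -> 0 <= C ->
  (forall s x, (size s <= k)%N -> `|x| <= M -> cmod (partials s f x) <= C) ->
  cmod (u f) <= B%:R * C.
Proof.
have [_ [K [k [B [cK uB]]]]] := cu.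
have [M M0 KM] := compact_cboxP cK; have [N BN] := real_nat_bound B.
exists M, k, N; split=> // f C sf C0 fC.
rewrite (le_trans (uB f sf))// (le_trans (ler_wpM2r (Cinf_norm_ge0 _ _ _) BN))//.
rewrite ler_wpM2l//; apply: Cinf_norm_le => // s x sk /KM.
by rewrite /cbox /= subr0; exact: fC.
Qed.

Variables (a : nat) (U : set 'rV[R]_a).
Hypothesis oU : open U.

Let g (G : 'rV[R]_(a + m) -> R[i]) y := u (fun r => G (row_mx y r)).

Lemma distr_param_quadratic G y : U y -> smooth [set z | U (lsubmx z)] G ->
  exists d C : R, 0 < d /\ forall h, `|h| < d ->
    cmod (g G (y + h) - g G y - \sum_i (h 0 i)%:C * g (partial (lshift m i) G) y)
    <= C * `|h| ^+ 2.
Proof.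
move=> Uy sG; have [d d0 dU] := (nbhs_normP _ _).1 (open_nbhs_nbhs (conj oU Uy)).
have {}d0 : 0 < d by [].
have {}dU : cbox y (d / 2) `<=` U.
  move=> x xd; apply: dU; rewrite /ball_ /= distrC (le_lt_trans xd)//.
  by rewrite ltr_pdivrMr// ltr_pMr// ltrDl.
have d20 : 0 < d / 2 by rewrite divr_gt0.
have [M [k [B [M0 uB]]]] := distr_bound.
have [N NP] := remainder_bound M k oU (ltW d20) dU sG.
exists (d / 2), (B%:R * N%:R); split=> // h hd.
have Uh : U (y + h) by apply: dU; rewrite /cbox /= addrC addKr ltW.
have s1 := smooth_row_r Uh sG; have s2 := smooth_row_r Uy sG.
have s3 i := smooth_row_r Uy (smooth_partials [:: lshift m i] sG).
have s4 i : smooth setT (fun r => (h 0 i)%:C * partial (lshift m i) G (row_mx y r)).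
  exact: smoothZ (openT) (s3 i).
have s5 := smoothB openT (smoothB openT s1 s2) (smooth_sum (index_enum _) openT s4).
rewrite (_ : _ - _ = u (remainder G y h)); last first.
  rewrite /remainder (distrB (smoothB openT s1 s2) (smooth_sum _ openT s4)).
  rewrite (distrB s1 s2) (distr_sum _ s4); congr (_ - _).
  by apply: eq_bigr => i _; rewrite (distrZ _ (s3 i)).
rewrite -mulrA; apply: uB; first exact: s5.
  by rewrite mulr_ge0// sqr_ge0.
by move=> s x sk xM; apply: NP => //; exact: ltW.
Qed.

Lemma distr_param1 G y : U y -> smooth [set z | U (lsubmx z)] G ->
  cdifferentiable (g G) y /\
  forall i, partial i (g G) y = g (partial (lshift m i) G) y.
Proof.
move=> Uy sG; have [d [C [d0 H]]] := distr_param_quadratic Uy sG.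
have [|dr Er] := @differentiable_quadratic R a (re_fun (g G)) y
    (fun i => complex.Re (g (partial (lshift m i) G) y)) C d d0.
  move=> h /H; apply: le_trans; apply: le_trans (Re_cmod _).
  rewrite /re_fun !ReD !ReN Re_sum; under [X in _ <= `|_ - X|]eq_bigr do rewrite ReZ.
  by [].
have [|di Ei] := @differentiable_quadratic R a (im_fun (g G)) y
    (fun i => complex.Im (g (partial (lshift m i) G) y)) C d d0.
  move=> h /H; apply: le_trans; apply: le_trans (Im_cmod _).
  rewrite /im_fun !ImD !ImN Im_sum; under [X in _ <= `|_ - X|]eq_bigr do rewrite ImZ.
  by [].
by split=> // i; apply: complex_ext; [exact: Er|exact: Ei].
Qed.

(** The first-order remainder in the parameter is quadratically small in every
    seminorm of C^oo, hence so is its image under u. *)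
Lemma distr_param_partials G s y : U y -> smooth [set z | U (lsubmx z)] G ->
  partials s (g G) y = g (partials (map (@lshift a m) s) G) y.
Proof.
move=> + sG; elim: s y => //= i s IH y Uy.
have [_ <-] := distr_param1 Uy (smooth_partials (map (@lshift a m) s) sG).
exact: (cpartials_local [:: i] oU IH Uy).
Qed.

Lemma distr_param_smooth G : smooth [set z | U (lsubmx z)] G -> smooth U (g G).
Proof.
move=> sG s y Uy.
have [[d1 d2] _] := distr_param1 Uy (smooth_partials (map (@lshift a m) s) sG).
split.
  apply: (@differentiable_local _ _ U _ _ oU _ y Uy d1) => x Ux.
  by rewrite (distr_param_partials _ Ux sG).
apply: (@differentiable_local _ _ U _ _ oU _ y Uy d2) => x Ux.
by rewrite (distr_param_partials _ Ux sG).
Qed.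

End distributions.

(** * Nets of smooth functions *)

Section nets.
Context {R : realType}.

Lemma seminorm_bound m (U : set 'rV[R]_m) p : open U -> continuous_seminorm U p ->
  exists K k (N : nat), [/\ compact K, K `<=` U &
    forall f, smooth U f -> 0 <= p f <= N%:R * Cinf_norm K k f].
Proof.
move=> oU [pD pZ [K [k [B [cK KU pB]]]]]; have [N BN] := real_nat_bound B.
exists K, k, N; split=> // f sf; apply/andP; split; last first.
  by rewrite (le_trans (pB _ sf))// ler_wpM2r// Cinf_norm_ge0.
have s0 := smooth_cst (0 : R[i]) oU.
have p0 : p (fun=> 0) = 0.
  by have := pZ 0 _ s0; rewrite cmod0 !mul0r.
have := pD _ _ sf (smoothZ (-1) oU sf); rewrite (pZ _ _ sf) cmodN.
have -> : (fun x => f x + -1 * f x) = fun=> 0.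
  by apply/funext => x; rewrite mulN1r subrr.
by rewrite p0 (_ : cmod 1 = 1) ?mul1r -?mulr2n ?pmulrn_lge0//; exact: Normc.normc1.
Qed.

Lemma const_norm (e : R) : `|const_mx e : 'rV[R]_1| = `|e|.
Proof.
apply/eqP; rewrite eq_le; apply/andP; split.
  by apply: row_norm_le => // i; rewrite mxE.
by have := ler_coord_norm (const_mx e : 'rV[R]_1) 0; rewrite mxE.
Qed.

Definition unit_rows : set 'rV[R]_1 := [set y | 0 < y 0 0 < 1].

Lemma open_unit_rows : open unit_rows.
Proof.
rewrite (_ : unit_rows = (fun y : 'rV[R]_1 => y 0 0) @^-1` [set x | 0 < x] `&`
  (fun y : 'rV[R]_1 => y 0 0) @^-1` [set x | x < 1]); last first.
  by apply/seteqP; split=> y /andP.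
apply: openI; apply: open_comp.
- by move=> y _; exact: coord_continuous.
- exact: open_gt.
- by move=> y _; exact: coord_continuous.
- exact: open_lt.
Qed.

(** The derivatives of the curve in C^oo are the partial derivatives of F in its
    first coordinate: by remainder_bound the difference quotients converge to
    them uniformly on compact sets, together with all derivatives in x. *)
Lemma smooth_net_joint m (F : 'rV[R]_(1 + m) -> R[i]) :
  smooth [set z | unit_rows (lsubmx z)] F ->
  smooth_net setT (fun e x => F (row_mx (const_mx e) x)).
Proof.
move=> sF; have oU := open_unit_rows.
pose G k := partials (nseq k (lshift m (0 : 'I_1))) F.
have sG k : smooth [set z | unit_rows (lsubmx z)] (G k) by exact: smooth_partials.
have Ue (e : R) : 0 < e < 1 -> unit_rows (const_mx e) by rewrite /unit_rows /= mxE.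
exists (fun k e x => G k (row_mx (const_mx e) x)); split=> //.
  by move=> k e /Ue e01; exact: smooth_row_r e01 (sG k).
move=> k e p e01 /(seminorm_bound openT)[K [j [N [cK _ pN]]]].
have [M M0 KM] := compact_cboxP cK.
have /andP[e0 e1] := e01.
pose d := Num.min (e / 2) ((1 - e) / 2).
have d0 : 0 < d by rewrite lt_min !divr_gt0 ?subr_gt0.
have dU : cbox (const_mx e) d `<=` unit_rows.
  move=> y yd; rewrite /unit_rows /=.
  have := le_trans (ler_coord_norm (y - const_mx e) 0) yd; rewrite !mxE le_min => /andP[].
  by rewrite !ler_norml => /andP[h1 h2] /andP[h3 h4]; apply/andP; split; lra.
have [N' N'P] := remainder_bound M j oU (ltW d0) dU (sG k).
have bound (h : R) : 0 < `|h| < d -> 0 <= p (fun x => (h^-1)%:C *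
    (G k (row_mx (const_mx (e + h)) x) - G k (row_mx (const_mx e) x))
     - G k.+1 (row_mx (const_mx e) x)) <= N%:R * N'%:R * `|h|.
  move=> /andP[h0 hd].
  have eh01 : 0 < e + h < 1.
    have : unit_rows (const_mx (e + h)).
      by apply: dU; rewrite /cbox /= -raddfB /= addrC addKr const_norm ltW.
    by rewrite /unit_rows /= mxE.
  have -> : (fun x => (h^-1)%:C *
      (G k (row_mx (const_mx (e + h)) x) - G k (row_mx (const_mx e) x))
       - G k.+1 (row_mx (const_mx e) x)) =
      (fun x => (h^-1)%:C * remainder (G k) (const_mx e) (const_mx h) x).
    apply/funext => x; rewrite /remainder big_ord1 mxE [RHS]mulrBr [in RHS]mulrA.
    rewrite (_ : (h^-1)%:C * h%:C = 1) ?mul1r; last first.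
      by rewrite -rmorphM /= mulVf// -normr_gt0.
    by congr (_ * (G k (row_mx _ x) - _) - _); rewrite raddfD.
  have sr : smooth setT (remainder (G k) (const_mx e) (const_mx h)).
    rewrite /remainder; apply: (smoothB openT).
      apply: (smoothB openT); apply: smooth_row_r (sG k); last exact: Ue.
      by rewrite -raddfD; exact: Ue.
    apply: (smooth_sum _ openT) => i; apply: (smoothZ _ openT).
    exact: (smooth_row_r (Ue _ e01) (smooth_partials [:: lshift m i] (sG k))).
  have /andP[-> pW] := pN _ (smoothZ ((h^-1)%:C) openT sr).
  rewrite (le_trans pW)// -mulrA ler_wpM2l//.
  apply: Cinf_norm_le => [|s x sj /KM]; first by rewrite mulr_ge0.
  rewrite /cbox /= subr0 => xM.
  rewrite (partialsZ s _ openT sr)// cmodM cmod_real normfV.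
  rewrite ler_pdivrMl// mulrC -mulrA -expr2 -(const_norm h).
  by apply: N'P => //; rewrite const_norm ltW.
apply/cvgr0Pnorm_lt => eps eps0.
have c0 : 0 < Num.min d (eps / (N%:R * N'%:R + 1)).
  by rewrite lt_min d0 divr_gt0// ltr_wpDl.
near=> h.
have h0 : 0 < `|h| by rewrite normr_gt0; near: h; exact: nbhs_dnbhs_neq.
have : `|h| < Num.min d (eps / (N%:R * N'%:R + 1)).
  by near: h; exact: dnbhs0_lt.
rewrite lt_min => /andP[hd he].
have := bound h; rewrite h0 hd => /(_ isT)/andP[p0 ph].
rewrite ger0_norm// (le_lt_trans ph)//.
rewrite (@le_lt_trans _ _ ((N%:R * N'%:R + 1) * `|h|))//.
  by rewrite ler_wpM2r// lerDl.
by rewrite mulrC -ltr_pdivlMr// ltr_wpDl.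
Unshelve. all: by end_near. Qed.

Lemma smooth_net_const m (U : set 'rV[R]_m) f : open U -> smooth U f ->
  smooth_net U (fun _ : R => f).
Proof.
move=> oU sf; exists (fun k _ x => if k is 0%N then f x else 0); split=> //.
  by move=> [|k] e _; [exact: sf|exact: smooth_cst].
move=> k e p _ /(seminorm_bound oU)[K [j [N [cK KU pN]]]].
rewrite (_ : (fun h => _) = fun=> 0); first exact: cvg_cst.
apply/funext => h; rewrite (_ : (fun x => _) = fun=> 0).
  have /andP[p0] := pN _ (smooth_cst (0 : R[i]) oU).
  have -> : Cinf_norm K j (fun=> (0 : R[i])) = 0.
    apply/le_anti; rewrite Cinf_norm_ge0 andbT; apply: Cinf_norm_le => // s x _ _.
    by rewrite partials_cst0 cmod0.
  by rewrite mulr0 => p1; apply/le_anti; rewrite p0 p1.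
by apply/funext => x; case: k; rewrite ?subrr mulr0 subrr.
Qed.

Lemma smooth_netB m (U : set 'rV[R]_m) (f1 f2 : R -> 'rV[R]_m -> R[i]) : open U ->
  smooth_net U f1 -> smooth_net U f2 -> smooth_net U (fun e x => f1 e x - f2 e x).
Proof.
move=> oU [g1 [<- s1 c1]] [g2 [<- s2 c2]].
exists (fun k e x => g1 k e x - g2 k e x); split=> //.
  by move=> k e e01; apply: (smoothB oU); [exact: s1|exact: s2].
move=> k e p e01 pp; have [K [j [N [cK KU pN]]]] := seminorm_bound oU pp.
have [pD pZ _] := pp.
have := cvgD (c1 k e p e01 pp) (c2 k e p e01 pp); rewrite addr0 => lim.
have /andP[e0 e1] := e01.
have me0 : 0 < Num.min e (1 - e) by rewrite lt_min e0 subr_gt0.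
apply: (squeeze_cvgr _ (cvg_cst (0 : R))); last exact: lim.
near=> h.
have eh01 : 0 < e + h < 1.
  have : `|h| < Num.min e (1 - e) by near: h; exact: dnbhs0_lt.
  by rewrite lt_min => /andP[]; rewrite !ltr_norml => /andP[h1 h2] /andP[h3 h4]; lra.
pose W (g : nat -> R -> 'rV[R]_m -> R[i]) (x : 'rV[R]_m) : R[i] := (h^-1)%:C * (g k (e + h) x - g k e x) - g k.+1 e x.
have sW (g : nat -> R -> 'rV[R]_m -> R[i]) :
    (forall k e, 0 < e < 1 -> smooth U (g k e)) -> smooth U (W g).
  by move=> sg; apply: (smoothB oU (smoothZ _ oU (smoothB oU _ _))); apply: sg.
rewrite (_ : (fun x => _) = (fun x => W g1 x + -1 * W g2 x)); last first.
  by apply/funext => x; rewrite /W; ring.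
have sW2 := smoothZ (-1) oU (sW _ s2).
have /andP[-> _] := pN _ (smoothD oU (sW _ s1) sW2).
rewrite /= (le_trans (pD _ _ (sW _ s1) sW2))// (pZ _ _ (sW _ s2)) cmodN.
by rewrite (_ : cmod 1 = 1) ?mul1r//; exact: Normc.normc1.
Unshelve. all: by end_near. Qed.

Lemma smooth_net_eq m (U : set 'rV[R]_m) (f g : R -> 'rV[R]_m -> R[i]) :
  (forall e x, f e x = g e x) -> smooth_net U f -> smooth_net U g.
Proof. by move=> fg; rewrite (_ : f = g)//; apply/funext => e; apply/funext. Qed.

Lemma seminormW m (V : set 'rV[R]_m) p : continuous_seminorm V p -> continuous_seminorm setT p.
Proof.
have sV f : smooth setT f -> smooth V f by exact: smoothW.
move=> [pD pZ [K [k [B [cK KV pB]]]]]; split.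
- by move=> f g /sV sf /sV sg; exact: pD.
- by move=> a f /sV; exact: pZ.
- by exists K, k, B; split=> // f /sV; exact: pB.
Qed.

Lemma smooth_netW m (V : set 'rV[R]_m) f : smooth_net setT f -> smooth_net V f.
Proof.
move=> [g [g0 sg cg]]; exists g; split=> // [k e e01|k e p e01 /seminormW].
  by apply: smoothW (sg k e e01).
exact: cg.
Qed.

Lemma moderateW m (V : set 'rV[R]_m) f : moderate setT f -> moderate V f.
Proof. by move=> [sf mf]; split=> [|p /seminormW]; [exact: smooth_netW|exact: mf]. Qed.

Lemma negligibleW m (V : set 'rV[R]_m) f : negligible_net setT f -> negligible_net V f.
Proof. by move=> [sf mf]; split=> [|p /seminormW]; [exact: smooth_netW|exact: mf]. Qed.

Lemma near_unit : \forall e \near (0 : R)^'+, 0 < e < 1.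
Proof.
near=> e; apply/andP; split; first by [].
by near: e; exact: nbhs_right_lt.
Unshelve. all: by end_near. Qed.

Lemma smooth_net_smooth m (U : set 'rV[R]_m) f e : smooth_net U f -> 0 < e < 1 -> smooth U (f e).
Proof. by move=> [g [<- sg _]]; exact: sg. Qed.

Lemma negligibleB m (U : set 'rV[R]_m) f g : open U ->
  negligible_net U f -> negligible_net U g -> negligible_net U (fun e x => f e x - g e x).
Proof.
move=> oU [sf nf] [sg ng]; split; first exact: smooth_netB.
move=> p pp N; have [pD pZ _] := pp.
have [B fB] := nf p pp N; have [C gC] := ng p pp N; exists (B + C).
near=> e; have e01 : 0 < e < 1 by near: e; exact: near_unit.
have s1 := smooth_net_smooth sf e01; have s2 := smooth_net_smooth sg e01.
rewrite (_ : (fun x => _) = (fun x => f e x + -1 * g e x)); last first.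
  by apply/funext => x; rewrite mulN1r.
rewrite (le_trans (pD _ _ s1 (smoothZ _ oU s2)))// (pZ _ _ s2) cmodN.
rewrite (_ : cmod 1 = 1) ?mul1r; last exact: Normc.normc1.
rewrite mulrDl; apply: lerD.
  by near: e; exact: fB.
by near: e; exact: gC.
Unshelve. all: by end_near. Qed.

Lemma moderate_estimate m f : smooth_net setT f ->
  (forall (s : seq 'I_m) (M : R), exists N : nat, forall e x, 0 < e < 1 -> `|x| <= M ->
     cmod (partials s (f e) x) <= N%:R * e^-1 ^+ N) ->
  moderate setT f.
Proof.
move=> sf mf; split=> // p /(seminorm_bound openT)[K [k [N [cK _ pN]]]].
have [M M0 KM] := compact_cboxP cK.
have [s L L' LL H e x e01 xM|s|L LP] := @seq_bound_ex m k (fun s L => forall e x, 0 < e < 1 ->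
    `|x| <= M -> cmod (partials s (f e) x) <= L%:R * e^-1 ^+ L).
- have /andP[e0 e1] := e01.
  rewrite (le_trans (H _ _ e01 xM))// ler_pM ?exprn_ge0 ?invr_ge0 ?(ltW e0) ?ler_nat//.
  by rewrite ler_weXn2l// invf_ge1// ltW.
- by have [L LP] := mf s M; exists L.
exists (- L%:Z), (N%:R * L%:R); near=> e.
have e01 : 0 < e < 1 by near: e; exact: near_unit.
have /andP[e0 e1] := e01.
have /andP[_ pe] := pN _ (smooth_net_smooth sf e01).
rewrite (le_trans pe)// -mulrA ler_wpM2l//.
rewrite -exprnN; apply: Cinf_norm_le => [|s x sk /KM].
  by rewrite mulr_ge0// invr_ge0 exprn_ge0// ltW.
by rewrite /cbox /= subr0 -exprVn; exact: LP.
Unshelve. all: by end_near. Qed.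

Lemma negligible_estimate m (U : set 'rV[R]_m) f : open U -> smooth_net U f ->
  (forall K (s : seq 'I_m) (N : nat), compact K -> K `<=` U -> exists C : nat,
     forall e x, 0 < e < 1 -> K x -> cmod (partials s (f e) x) <= C%:R * e ^+ N) ->
  negligible_net U f.
Proof.
move=> oU sf nf; split=> // p /(seminorm_bound oU)[K [k [N [cK KU pN]]]] Z.
pose n := if Z is Posz n then n else 0%N.
have [s L L' LL H e x e01 Kx|s|L LP] := @seq_bound_ex m k (fun s L => forall e x, 0 < e < 1 ->
    K x -> cmod (partials s (f e) x) <= L%:R * e ^+ n).
- have /andP[e0 e1] := e01.
  by rewrite (le_trans (H _ _ e01 Kx))// ler_wpM2r ?exprn_ge0 ?(ltW e0) ?ler_nat.
- exact: nf.
exists (N%:R * L%:R); near=> e.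
have e01 : 0 < e < 1 by near: e; exact: near_unit.
have /andP[e0 e1] := e01.
have /andP[_ pe] := pN _ (smooth_net_smooth sf e01).
rewrite (le_trans pe)// -mulrA ler_wpM2l//.
have nZ : e ^+ n <= e ^ Z.
  rewrite /n; case: (Z) => l //; rewrite expr0 NegzE -exprnN invf_ge1.
    by rewrite exprn_ile1 ?ltW.
  by rewrite exprn_gt0.
apply: (@le_trans _ _ (L%:R * e ^+ n)); last by rewrite ler_wpM2l.
apply: Cinf_norm_le => [|s x sk Kx]; last exact: LP.
by rewrite mulr_ge0// exprn_ge0// ltW.
Unshelve. all: by end_near. Qed.

(** A difference quotient of step k differs from the derivative by at most k times
    a moderate second derivative, and costs a factor 1 / k on the values.  Taking
    for k a power of e makes both errors O(e^N); the margin between r and d0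
    leaves room for the step. *)
Lemma interpolate1 m (f : R -> 'rV[R]_m -> R) i c (d0 : R) :
  (forall e, 0 < e < 1 -> rsmooth setT (f e)) ->
  (forall r : R, exists N : nat, forall e x, 0 < e < 1 -> `|x - c| <= r ->
     `|rpartial i (rpartial i (f e)) x| <= N%:R * e^-1 ^+ N) ->
  (forall (r : R) (N : nat), r < d0 -> exists C : nat, forall e x, 0 < e < 1 ->
     `|x - c| <= r -> `|f e x| <= C%:R * e ^+ N) ->
  forall (r : R) (N : nat), r < d0 -> exists C : nat, forall e x, 0 < e < 1 ->
     `|x - c| <= r -> `|rpartial i (f e) x| <= C%:R * e ^+ N.
Proof.
move=> sf mf nf r N rd.
pose l := Num.min 1 ((d0 - r) / 2).
have l0 : 0 < l by rewrite lt_min ltr01 divr_gt0// subr_gt0.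
have l1 : l <= 1 by rewrite ge_min lexx.
have rl : r + l < d0.
  have : l <= (d0 - r) / 2 by rewrite ge_min lexx orbT.
  by move=> ?; lra.
have [N0 mfN] := mf (r + l); have [C nfC] := nf (r + l) (N + N + N0)%N rl.
have [C' CC'] := real_nat_bound (2 * C%:R / l + l * N0%:R).
exists C' => e x e01 xr; have /andP[e0 e1] := e01.
(* the factor e^N0 compensates the growth of the second derivative *)
pose k := l * e ^+ (N + N0); have kE : k = l * e ^+ (N + N0) by [].
have k0 : 0 < k by rewrite mulr_gt0// exprn_gt0.
have kl : k <= l by rewrite kE ler_piMr ?(ltW l0)// exprn_ile1 ?ltW.
have k0' := ltW k0; clearbody k.
have stepP (q : R) : 0 <= q <= 1 -> `|x + (q * k) *: delta_mx 0 i - c| <= r + l.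
  move=> /andP[q0 q1]; rewrite addrAC (le_trans (ler_normD _ _))// lerD//.
  rewrite normrZ ger0_norm ?mulr_ge0//.
  apply: (@le_trans _ _ (q * k * 1)); first by rewrite ler_wpM2l ?norm_delta// mulr_ge0.
  by rewrite mulr1 (le_trans _ kl)// ler_piMl.
have [t t01 E1] := @increment_partial _ _ (f e) x i k
  (fun=> fun=> sf e e01 [::] _ I).
have [t' t01' E2] := @increment_partial _ _ (rpartial i (f e)) x i (t * k)
  (fun=> fun=> sf e e01 [:: i] _ I).
have b1 : `|f e (x + k *: delta_mx 0 i)| <= C%:R * e ^+ (N + N + N0).
  apply: nfC => //; have := stepP 1; rewrite mul1r; apply; by rewrite ler01 lexx.
have b2 : `|f e x| <= C%:R * e ^+ (N + N + N0).
  by apply: nfC => //; rewrite (le_trans xr)// lerDl ltW.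
have /andP[t0 t1] := t01; have /andP[t'0 t'1] := t01'.
have tk0 : 0 <= t * k by rewrite mulr_ge0// ltW.
have b3 : `|t * k * rpartial i (rpartial i (f e)) (x + (t' * (t * k)) *: delta_mx 0 i)|
    <= k * (N0%:R * e^-1 ^+ N0).
  rewrite normrM ger0_norm// ler_pM//.
    by rewrite ler_piMl// ltW.
  apply: mfN => //; rewrite mulrA; apply: stepP.
  by rewrite mulr_ge0//= mulr_ile1.
have -> : rpartial i (f e) x =
    (f e (x + k *: delta_mx 0 i) - f e x) / k -
    t * k * rpartial i (rpartial i (f e)) (x + (t' * (t * k)) *: delta_mx 0 i).
  rewrite E1 -E2 mulrC mulKf ?gt_eqF//.
  by rewrite opprB addrC subrK.
rewrite (le_trans (ler_normB _ _))//.
apply: (@le_trans _ _ ((2 * C%:R / l + l * N0%:R) * e ^+ N)); last first.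
  by rewrite ler_wpM2r// exprn_ge0// ltW.
rewrite [leRHS]mulrDl lerD//; last first.
  rewrite (le_trans b3)// le_eqVlt; apply/orP; left; apply/eqP.
  rewrite kE exprD exprVn; field; by rewrite expf_neq0// gt_eqF.
rewrite normrM normfV (gtr0_norm k0) ler_pdivrMr//.
rewrite (le_trans (ler_normB _ _))// (le_trans (lerD b1 b2))//.
rewrite le_eqVlt; apply/orP; left; apply/eqP.
by rewrite kE !exprD; field; rewrite gt_eqF.
Qed.

Lemma interpolate m (f : R -> 'rV[R]_m -> R) c (d0 : R) :
  (forall e, 0 < e < 1 -> rsmooth setT (f e)) ->
  (forall s (r : R), exists N : nat, forall e x, 0 < e < 1 -> `|x - c| <= r ->
     `|rpartials s (f e) x| <= N%:R * e^-1 ^+ N) ->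
  (forall (r : R) (N : nat), r < d0 -> exists C : nat, forall e x, 0 < e < 1 ->
     `|x - c| <= r -> `|f e x| <= C%:R * e ^+ N) ->
  forall s (r : R) (N : nat), r < d0 -> exists C : nat, forall e x, 0 < e < 1 ->
     `|x - c| <= r -> `|rpartials s (f e) x| <= C%:R * e ^+ N.
Proof.
move=> sf mf nf; elim=> [|i s IH]; first exact: nf.
apply: (interpolate1 (f := fun e => rpartials s (f e))) IH.
  by move=> e e01; apply: rsmooth_partials; exact: sf.
exact: (mf [:: i, i & s]).
Qed.

Lemma interpolate_complex m (f : R -> 'rV[R]_m -> R[i]) c (d0 : R) :
  (forall e, 0 < e < 1 -> smooth setT (f e)) ->
  (forall s (M : R), exists N : nat, forall e x, 0 < e < 1 -> `|x| <= M ->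
     cmod (partials s (f e) x) <= N%:R * e^-1 ^+ N) ->
  (forall (r : R) (N : nat), r < d0 -> exists C : nat, forall e x, 0 < e < 1 ->
     `|x - c| <= r -> cmod (f e x) <= C%:R * e ^+ N) ->
  forall s (r : R) (N : nat), r < d0 -> exists C : nat, forall e x, 0 < e < 1 ->
     `|x - c| <= r -> cmod (partials s (f e) x) <= C%:R * e ^+ N.
Proof.
move=> sf mf nf s r N rd.
have mf' t (M : R) : exists L : nat, forall e x, 0 < e < 1 -> `|x - c| <= M ->
     cmod (partials t (f e) x) <= L%:R * e^-1 ^+ L.
  have [L LP] := mf t (M + `|c|); exists L => e x e01 xM; apply: LP => //.
  by rewrite -[x](subrK c) (le_trans (ler_normD _ _))// lerD2r.
have [||C1 C1P] := @interpolate _ (fun e => re_fun (f e)) c d0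
    (fun e e01 => ((smoothP _ _).1 (sf e e01)).1) _ _ s r N rd.
- move=> t M; have [L LP] := mf' t M; exists L => e x e01 xM.
  rewrite -re_fun_partials (le_trans (Re_cmod _))//; exact: LP.
- move=> q L qd; have [C CP] := nf q L qd; exists C => e x e01 xM.
  by rewrite (le_trans (Re_cmod _))//; exact: CP.
have [||C2 C2P] := @interpolate _ (fun e => im_fun (f e)) c d0
    (fun e e01 => ((smoothP _ _).1 (sf e e01)).2) _ _ s r N rd.
- move=> t M; have [L LP] := mf' t M; exists L => e x e01 xM.
  rewrite -im_fun_partials (le_trans (Im_cmod _))//; exact: LP.
- move=> q L qd; have [C CP] := nf q L qd; exists C => e x e01 xM.
  by rewrite (le_trans (Im_cmod _))//; exact: CP.
exists (C1 + C2)%N => e x e01 xr; rewrite (le_trans (cmod_le_ReIm _))//.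
rewrite Re_partials Im_partials natrD mulrDl.
by apply: lerD; [exact: C1P|exact: C2P].
Qed.

End nets.

(** * Lebesgue measure on R^m and triangular affine maps *)

Section measure.
Context {R : realType}.
Local Notation mT := (measurableTypeR R).

Lemma measurable_tuple_row_open m (V : set 'rV[R]_m) : open V ->
  measurable ((@tuple_row R m : m.-tuple mT -> _) @^-1` V).
Proof.
move=> oV.
pose c (q : m.-tuple rat) : 'rV[R]_m := \row_i ratr (tnth q i).
pose r (k : nat) : R := k.+1%:R^-1.
have r0 k : 0 < r k by rewrite invr_gt0.
pose B (z : m.-tuple rat * nat) : set 'rV[R]_m := ball (c z.1) (r z.2).
pose F z : set (m.-tuple mT) :=
  if pselect (B z `<=` V) then (@tuple_row R m) @^-1` B z else set0.
rewrite (_ : _ @^-1` V = \bigcup_z F z).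
  apply: countable_bigcupT_measurable; first exact: countableP.
  move=> z; rewrite /F; case: pselect => [BV|_] /=; last exact: measurable0.
  rewrite (_ : _ @^-1` _ = \bigcap_(i in [set: 'I_m])
      ((fun t : m.-tuple mT => tnth t i) @^-1` ball (c z.1 0 i) (r z.2))).
    apply: fin_bigcap_measurable; first exact: finite_finset.
    move=> i _; rewrite -[X in measurable X]setTI.
    apply: (@measurable_tnth _ mT m i) => //.
    by rewrite ball_itv; exact: measurable_itv.
  apply/seteqP; split=> t.
    by move=> [_ H] i _; have := H 0 i; rewrite [tuple_row t 0 i]mxE.
  move=> H; split; first exact: r0.
  by move=> j i; rewrite ord1 [tuple_row t 0 i]mxE; exact: H.
apply/seteqP; split=> t; last first.
  by move=> [z _]; rewrite /F; case: pselect => // BV; exact: BV.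
move=> Vt; have /nbhs_ballP[d d0 dV] := open_nbhs_nbhs (conj oV Vt).
have {}d0 : 0 < d by [].
have [k kd] : exists k, r k < d / 2.
  exists (Num.truncn (d / 2)^-1); rewrite /r invf_plt ?posrE ?divr_gt0//.
  exact: real_truncnS_gt (num_real _).
have qex i : exists q : rat, ball (ratr q : R) (r k) (tnth t i).
  have h : tnth t i - r k < tnth t i + r k.
    by rewrite ltrBlDr -addrA ltrDl addr_gt0.
  have [q qP] := rat_in_itvoo h; exists q; move: qP.
  rewrite in_itv /= -ball_normE /= ltr_distlC => /andP[h1 h2].
  by apply/andP; split; lra.
have [q qP] := choice qex.
have Bt : B ([tuple q i | i < m], k) (tuple_row t).
  by split=> // j i; rewrite ord1 !mxE tnth_mktuple; exact: qP.
exists ([tuple q i | i < m], k) => //; rewrite /F; case: pselect => // nBV.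
exfalso; apply: nBV => y By; apply: dV.
apply: (@le_ball _ _ _ (r k + r k)).
  by rewrite (splitr d) lerD// ltW.
by apply: ball_triangle By; exact: ball_sym.
Qed.

Lemma measurable_continuous_row m (f : 'rV[R]_m -> R) : continuous f ->
  measurable_fun setT (fun t : m.-tuple mT => f (tuple_row t)).
Proof.
move=> cf; apply: (measurability _ (RGenOpens.measurableE R)) => _ [_ [a [b ->] <-]].
rewrite setTI -[X in measurable X]/((@tuple_row R m) @^-1` (f @^-1` `]a, b[%classic)).
apply: measurable_tuple_row_open; apply: open_comp => [x _|]; first exact: cf.
exact: itv_open.
Qed.

Local Open Scope ereal_scope.

Lemma affine_preimage_itv (a b u v : R) : (0 < `|a|)%R ->
  lebesgue_measure ((fun x => a * x + b)%R @^-1` `]u, v]%classic : set R) =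
  (`|a|^-1)%:E * lebesgue_measure (`]u, v]%classic : set R).
Proof.
rewrite normr_gt0 neq_lt => /orP[a0|a0].
  rewrite (_ : _ @^-1` _ = `[(v - b) / a, (u - b) / a[%classic)%R; last first.
    apply/seteqP; split=> x /=; rewrite !in_itv /=.
      by rewrite ler_ndivrMr// ltr_ndivlMr// => /andP[h1 h2]; apply/andP; split; lra.
    by rewrite ler_ndivrMr// ltr_ndivlMr// => /andP[h1 h2]; apply/andP; split; lra.
  rewrite !lebesgue_measure_itv /= !lte_fin ltr_nM2r ?invr_lt0// ltrD2r.
  case: ifPn => uv; last by rewrite mule0.
  by rewrite ltr0_norm// -!EFinB -EFinM; congr EFin; field; rewrite lt_eqF.
rewrite (_ : _ @^-1` _ = `](u - b) / a, (v - b) / a]%classic)%R; last first.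
  apply/seteqP; split=> x /=; rewrite !in_itv /=.
    by rewrite ler_pdivlMr// ltr_pdivrMr// => /andP[h1 h2]; apply/andP; split; lra.
  by rewrite ler_pdivlMr// ltr_pdivrMr// => /andP[h1 h2]; apply/andP; split; lra.
rewrite !lebesgue_measure_itv /= !lte_fin ltr_pM2r ?invr_gt0// ltrD2r.
case: ifPn => uv; last by rewrite mule0.
by rewrite gtr0_norm// -!EFinB -EFinM; congr EFin; field; rewrite gt_eqF.
Qed.

Lemma measurable_affine1 (a b : R) : measurable_fun setT (fun x : mT => (a * x + b)%R : mT).
Proof.
apply: (@continuous_measurable_fun R (fun x => a * x + b)%R) => x.
apply: continuousD; last exact: cst_continuous.
exact: mulrl_continuous.
Qed.

Lemma lebesgue_affine (a b : R) (S : set mT) : (0 < `|a|)%R -> measurable S ->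
  lebesgue_measure ((fun x : mT => (a * x + b)%R : mT) @^-1` S) =
  (`|a|^-1)%:E * lebesgue_measure S.
Proof.
move=> a0 mS; have na : (0 <= `|a|)%R by [].
pose k : {nonneg R} := NngNum na.
pose nu : {measure set mT -> \bar R} := mscale k
  (measure_function_pushforward__canonical__measure_function_Measure
     (lebesgue_measure : {measure set mT -> \bar R}) (measurable_affine1 a b)).
have E : lebesgue_measure S = nu S.
  apply: lebesgue_measure_unique => // _ [[u v] /= _ <-].
  rewrite /nu /mscale /= /pushforward affine_preimage_itv// muleA -EFinM mulfV ?gt_eqF//.
  by rewrite mul1e.
by rewrite E /nu /mscale /= muleA -EFinM mulVf ?gt_eqF// mul1e.
Qed.

Lemma ge0_integral_affine1 (a b : R) (g : mT -> \bar R) : (0 < `|a|)%R ->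
  measurable_fun setT g -> (forall x, 0 <= g x) ->
  \int[lebesgue_measure]_x g (a * x + b)%R = (`|a|^-1)%:E * \int[lebesgue_measure]_x g x.
Proof.
move=> a0 mg g0; have na : (0 <= `|a|^-1)%R by rewrite invr_ge0.
rewrite -[LHS](@ge0_integral_pushforward _ _ _ _ _ _ (measurable_affine1 a b)
  lebesgue_measure setT g)//.
rewrite -(ge0_integral_mscale lebesgue_measure measurableT (NngNum na))//.
apply: eq_measure_integral; first exact: measurable_affine1.
by move=> mf A mA _; exact: (lebesgue_affine b a0 mA).
Qed.

(** Translations and dilations of the group have this form, and an iterated product
    measure is transformed by integrating out one coordinate at a time. *)
Definition triangular_map m (M : 'I_m -> 'I_m -> R) (b : 'I_m -> R) (t : m.-tuple mT) :
    m.-tuple mT :=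
  [tuple (\sum_j M i j * tnth t j + b i)%R | i < m].

Lemma measurable_triangular m M b : measurable_fun setT (@triangular_map m M b).
Proof.
apply/measurable_fun_tnthP => i.
rewrite (_ : _ \o _ = fun t : m.-tuple mT => (\sum_j M i j * tnth t j + b i)%R); last first.
  by apply/funext => t; rewrite /= tnth_mktuple.
apply: measurable_funD => //; apply: measurable_sum => j.
by apply: measurable_funM => //; exact: (@measurable_tnth _ mT m j).
Qed.

(** Once the first coordinate is fixed, it acts on the others by a translation. *)
Lemma triangular_map_cons m (M : 'I_m.+1 -> 'I_m.+1 -> R) b x t :
  (forall i j : 'I_m.+1, (i < j)%N -> M i j = 0%R) ->
  triangular_map M b (tcons (x, t)) = tcons ((M ord0 ord0 * x + b ord0)%R,
    triangular_map (fun i j => M (lift ord0 i) (lift ord0 j))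
        (fun i => M (lift ord0 i) ord0 * x + b (lift ord0 i))%R t).
Proof.
move=> M0; apply: eq_from_tnth => i; rewrite tnth_mktuple big_ord_recl.
have E1 (y : mT) (s : m.-tuple mT) j : tnth (tcons (y, s)) (lift ord0 j) = tnth s j.
  by rewrite !(tnth_nth y).
rewrite [tnth (tcons (x, t)) ord0](_ : _ = x)//; under eq_bigr do rewrite E1.
case: (unliftP ord0 i) => [j ->|->].
  by rewrite E1 tnth_mktuple -addrA addrCA.
by rewrite big1 ?addr0// => j _; rewrite M0 ?mul0r.
Qed.

Lemma lebesgue_triangular m (M : 'I_m -> 'I_m -> R) b (c : R) (S : set (m.-tuple mT)) :
  (0 < c)%R -> (forall i, `|M i i| = c)%R ->
  (forall i j : 'I_m, (i < j)%N -> M i j = 0%R) -> measurable S ->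
  lebesgue_tuple R m (triangular_map M b @^-1` S) = (c^-1 ^+ m)%:E * lebesgue_tuple R m S.
Proof.
move=> c0; elim: m M b S => [|m IH] M b S Mc M0 mS.
  rewrite mul1e; congr (lebesgue_tuple R 0 _); apply/seteqP; split=> t /=;
    by rewrite (_ : triangular_map M b t = t)//; apply: eq_from_tnth => -[].
rewrite -[LHS]/((lebesgue_measure \x lebesgue_tuple R m)
  ((@tcons _ mT m) @^-1` (triangular_map M b @^-1` S))).
rewrite -[X in _ = _ * X]/((lebesgue_measure \x lebesgue_tuple R m)
  ((@tcons _ mT m) @^-1` S)).
rewrite /product_measure1.
set S' := (@tcons _ mT m) @^-1` S.
have mS' : measurable S'.
  by rewrite -[X in measurable X]setTI; exact: measurable_tcons.
pose g (y : mT) := lebesgue_tuple R m (xsection S' y).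
have E (x : mT) : lebesgue_tuple R m (xsection ((@tcons _ mT m) @^-1` (triangular_map M b @^-1` S)) x) =
    (c^-1 ^+ m)%:E * g (M ord0 ord0 * x + b ord0)%R.
  rewrite /g -(IH (fun i j => M (lift ord0 i) (lift ord0 j))
        (fun i => M (lift ord0 i) ord0 * x + b (lift ord0 i))%R)//; last first.
  - exact: measurable_xsection.
  - by move=> i j ij; apply: M0; rewrite /= /bump /= !add1n.
  congr (lebesgue_tuple R m _); apply/seteqP; split=> t; rewrite /xsection /=.
    by rewrite !inE /S' /= triangular_map_cons.
  by rewrite !inE /S' /= triangular_map_cons.
have mg : measurable_fun setT g by exact: measurable_fun_xsection.
under eq_integral do rewrite /= E.
have c1 : (0 <= (c^-1 ^+ m)%:E :> \bar R) by rewrite lee_fin exprn_ge0// invr_ge0 ltW.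
rewrite ge0_integralZl//; last first.
  by apply: (measurableT_comp mg); exact: measurable_affine1.
rewrite (@ge0_integral_affine1 _ _ g) ?Mc// muleA -EFinM; congr (_%:E * _).
by rewrite exprSr.
Qed.

Lemma ge0_integral_triangular m (M : 'I_m -> 'I_m -> R) b (c : R) (g : m.-tuple mT -> \bar R) :
  (0 < c)%R -> (forall i, `|M i i| = c)%R ->
  (forall i j : 'I_m, (i < j)%N -> M i j = 0%R) ->
  measurable_fun setT g -> (forall x, 0 <= g x) ->
  \int[lebesgue_tuple R m]_t g (triangular_map M b t) =
    (c^-1 ^+ m)%:E * \int[lebesgue_tuple R m]_t g t.
Proof.
move=> c0 Mc M0 mg g0.
have na : (0 <= c^-1 ^+ m)%R by rewrite exprn_ge0// invr_ge0 ltW.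
rewrite -[LHS](@ge0_integral_pushforward _ _ _ _ _ _ (@measurable_triangular m M b)
  (lebesgue_tuple R m) setT g)//.
rewrite -(ge0_integral_mscale _ measurableT (NngNum na))//.
apply: eq_measure_integral; first exact: measurable_triangular.
by move=> mf A mA _; exact: (lebesgue_triangular b c0 Mc M0 mA).
Qed.

Lemma Rintegral_triangular m (M : 'I_m -> 'I_m -> R) b (c : R) (f : m.-tuple mT -> R) :
  (0 < c)%R -> (forall i, `|M i i| = c)%R ->
  (forall i j : 'I_m, (i < j)%N -> M i j = 0%R) ->
  (lebesgue_tuple R m).-integrable setT (EFin \o f) ->
  (\int[lebesgue_tuple R m]_t f (triangular_map M b t) =
    c^-1 ^+ m * \int[lebesgue_tuple R m]_t f t)%R.
Proof.
move=> c0 Mc M0 intf; have mf := measurable_int _ intf.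
rewrite /Rintegral integralE [X in _ = (_ * fine X)%R]integralE.
have -> : \int[lebesgue_tuple R m]_x ((fun t => (f (triangular_map M b t))%:E)^\+ x) =
    (c^-1 ^+ m)%:E * \int[lebesgue_tuple R m]_x ((EFin \o f)^\+ x).
  rewrite -(@ge0_integral_triangular m M b c)//; last exact: measurable_funepos.
  by apply: eq_integral => t _; rewrite !funeposE.
have -> : \int[lebesgue_tuple R m]_x ((fun t => (f (triangular_map M b t))%:E)^\- x) =
    (c^-1 ^+ m)%:E * \int[lebesgue_tuple R m]_x ((EFin \o f)^\- x).
  rewrite -(@ge0_integral_triangular m M b c)//; last exact: measurable_funeneg.
  by apply: eq_integral => t _; rewrite !funenegE.
have := integrable_pos_fin_num measurableT intf.
have := integrable_neg_fin_num measurableT intf.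
rewrite /=.
set P := \int[_]_x _; set Q := \int[_]_x _.
move=> fP fQ.
by rewrite -(fineK fP) -(fineK fQ) -!EFinM -!EFinB /= mulrBr.
Qed.

(** An integrable weight: domination by a multiple of it is the criterion of
    integrability used for all integrals below. *)
Definition oneDsqrV_prod m (t : m.-tuple mT) : R :=
  (\prod_i (oneDsqr (tnth t i))^-1)%R.

Lemma measurable_oneDsqrV_prod m : measurable_fun setT (@oneDsqrV_prod m).
Proof.
apply: measurable_prod => i _.
apply: (measurableT_comp (continuous_measurable_fun (@continuous_oneDsqrV R))).
exact: (@measurable_tnth _ mT m i).
Qed.

Lemma oneDsqrV_prod_ge0 m t : (0 <= @oneDsqrV_prod m t)%R.
Proof. by apply: prodr_ge0 => i _; rewrite invr_ge0 (le_trans _ (oneDsqr_ge1 _)). Qed.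

Lemma integral_oneDsqrV_lty : \int[lebesgue_measure]_x ((oneDsqr x)^-1)%:E < +oo :> \bar R.
Proof.
rewrite (@ge0_symfun_integralT R (fun x => (oneDsqr x)^-1)%R).
- rewrite (_ : [set x | _] = `[0%R, +oo[%classic); last first.
    by apply/seteqP; split=> x /=; rewrite in_itv /= andbT.
  by rewrite integral0y_oneDsqr -EFinM ltry.
- by move=> x; rewrite invr_ge0 (le_trans _ (oneDsqr_ge1 _)).
- exact: continuous_oneDsqrV.
- by move=> x; rewrite /= /oneDsqr sqrrN.
Qed.

Lemma integrable_oneDsqrV_prod m :
  (lebesgue_tuple R m).-integrable setT (EFin \o @oneDsqrV_prod m).
Proof.
have mW k : measurable_fun setT (EFin \o @oneDsqrV_prod k).
  by apply/measurable_EFinP; exact: measurable_oneDsqrV_prod.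
apply/integrableP; split; first exact: mW.
under eq_integral do rewrite /= ger0_norm ?oneDsqrV_prod_ge0//.
elim: m => [|m IH].
  rewrite integral_dirac//; last exact: mW.
  by rewrite diracT mul1e ltry.
rewrite -[X in X < _]/(\int[pushforward (lebesgue_measure \x lebesgue_tuple R m)
  (@tcons _ mT m)]_x (EFin \o @oneDsqrV_prod m.+1) x).
rewrite (ge0_integral_pushforward (@measurable_tcons _ mT m))//; last 2 first.
- exact: mW.
- by move=> t _; rewrite lee_fin oneDsqrV_prod_ge0.
rewrite preimage_setT fubini_tonelli1//; last 2 first.
- exact: (measurableT_comp (mW m.+1) (@measurable_tcons _ mT m)).
- by move=> z; rewrite lee_fin oneDsqrV_prod_ge0.
have E (x : mT) : fubini_F (lebesgue_tuple R m)
    ((EFin \o @oneDsqrV_prod m.+1) \o @tcons _ mT m) x =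
    (\int[lebesgue_tuple R m]_t (oneDsqrV_prod t)%:E) * ((oneDsqr x)^-1)%:E.
  rewrite muleC -ge0_integralZl//; last 2 first.
  - exact: mW.
  - by move=> t _; rewrite lee_fin oneDsqrV_prod_ge0.
  apply: eq_integral => t _; rewrite /= -EFinM /oneDsqrV_prod big_ord_recl.
  congr (_ * _)%:E; apply: eq_bigr => j _; congr (_^-1)%R; congr oneDsqr.
  by rewrite !(tnth_nth x).
under eq_integral do rewrite E.
rewrite ge0_integralZl//; last 2 first.
- by apply/measurable_EFinP; apply: (continuous_measurable_fun (@continuous_oneDsqrV R)).
- by apply: integral_ge0 => t _; rewrite lee_fin oneDsqrV_prod_ge0.
apply: lte_mul_pinfty => //; last exact: integral_oneDsqrV_lty.
- by apply: integral_ge0 => t _; rewrite lee_fin oneDsqrV_prod_ge0.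
- rewrite ge0_fin_numE//.
  by apply: integral_ge0 => t _; rewrite lee_fin oneDsqrV_prod_ge0.
Qed.

End measure.

(** * Integration of rapidly decreasing functions on R^m *)

Section integral_tuple.
Context {R : realType} {m : nat}.
Local Notation mT := (measurableTypeR R).
Local Notation mu := (lebesgue_tuple R m).
Implicit Types f g : m.-tuple mT -> R.

Definition dominated f := measurable_fun setT f /\
  exists2 C : R, 0 <= C & forall t, `|f t| <= C * oneDsqrV_prod t.

Lemma dominated_integrable f : dominated f -> mu.-integrable setT (EFin \o f).
Proof.
move=> [mf [C C0 fC]].
have iW := integrableZl measurableT C (@integrable_oneDsqrV_prod R m).
apply: (le_integrable measurableT _ _ iW); first exact/measurable_EFinP.
move=> t _; rewrite /= lee_fin (le_trans (fC t))// normrM ger0_norm//.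
by rewrite ler_wpM2l// ler_norm.
Qed.

Lemma dominatedD f g : dominated f -> dominated g -> dominated (fun t => f t + g t).
Proof.
move=> [mf [C C0 fC]] [mg [D D0 gD]]; split; first exact: measurable_funD.
exists (C + D); first exact: addr_ge0.
by move=> t; rewrite (le_trans (ler_normD _ _))// mulrDl lerD.
Qed.

Lemma dominatedZ (c : R) f : dominated f -> dominated (fun t => c * f t).
Proof.
move=> [mf [C C0 fC]]; split; first by apply: measurable_funM => //.
exists (`|c| * C); first by rewrite mulr_ge0.
by move=> t; rewrite normrM -mulrA ler_wpM2l.
Qed.

Lemma dominatedB f g : dominated f -> dominated g -> dominated (fun t => f t - g t).
Proof.
move=> df /(dominatedZ (-1)) dg; have := dominatedD df dg.
by under eq_fun do rewrite mulN1r.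
Qed.

Lemma dominated_sum (I : Type) (r : seq I) (F : I -> m.-tuple mT -> R) :
  (forall i, dominated (F i)) -> dominated (fun t => \sum_(i <- r) F i t).
Proof.
move=> dF; elim: r => [|i r IH].
  rewrite (_ : (fun t => _) = fun=> 0); last by apply/funext => t; rewrite big_nil.
  split; first exact: measurable_cst.
  by exists 0 => // t; rewrite normr0 mul0r.
have := dominatedD (dF i) IH; congr dominated.
by apply/funext => t; rewrite big_cons.
Qed.

Definition Itup f : R := \int[mu]_t f t.

Lemma ItupD f g : dominated f -> dominated g -> Itup (fun t => f t + g t) = Itup f + Itup g.
Proof. by move=> df dg; apply: RintegralD => //; exact: dominated_integrable. Qed.

Lemma ItupZ c f : dominated f -> Itup (fun t => c * f t) = c * Itup f.
Proof. by move=> df; apply: RintegralZl => //; exact: dominated_integrable. Qed.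

Lemma ItupB f g : dominated f -> dominated g -> Itup (fun t => f t - g t) = Itup f - Itup g.
Proof. by move=> df dg; apply: RintegralB => //; exact: dominated_integrable. Qed.

Lemma Itup_sum (I : Type) (r : seq I) (F : I -> m.-tuple mT -> R) :
  (forall i, dominated (F i)) ->
  Itup (fun t => \sum_(i <- r) F i t) = \sum_(i <- r) Itup (F i).
Proof.
move=> dF; elim: r => [|i r IH].
  rewrite big_nil /Itup (_ : (fun t => _) = fun=> 0).
    by rewrite Rintegral_cst// mul0r.
  by apply/funext => t; rewrite big_nil.
rewrite big_cons -IH -ItupD//; last exact: dominated_sum.
by congr Itup; apply/funext => t; rewrite big_cons.
Qed.

Lemma Itup_le f g : dominated f -> dominated g -> (forall t, `|f t| <= g t) ->
  `|Itup f| <= Itup g.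
Proof.
move=> df dg fg.
apply: (le_trans (le_normr_Rintegral measurableT (dominated_integrable df))).
apply: le_Rintegral => //; last exact: dominated_integrable.
have := integrable_norm (dominated_integrable df); congr (integrable _ _ _).
Qed.

(** Decay in the norm thus implies domination by the weight. *)
Lemma oneDsqrV_prod_ge (t : m.-tuple mT) (r : R) : 0 <= r ->
  (forall i, `|tnth t i| <= r) -> 1 <= (1 + r) ^+ (2 * m) * oneDsqrV_prod t.
Proof.
move=> r0 tr; rewrite exprM [X in X * _](_ : _ = \prod_(i < m) (1 + r) ^+ 2); last first.
  by rewrite prodr_const card_ord.
rewrite /oneDsqrV_prod -big_split /=.
elim/big_ind : _ => // [x y x1 y1|i _]; first by rewrite mulr_ege1.
rewrite ler_pdivlMr ?mul1r.
  rewrite /oneDsqr -real_normK ?num_real//.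
  have := tr i; have := normr_ge0 (tnth t i); set a := `|_|; nra.
by rewrite (lt_le_trans _ (oneDsqr_ge1 _)).
Qed.

Lemma dominated_box f (M : R) : measurable_fun setT f -> 0 <= M ->
  (exists2 C : R, 0 <= C & forall t, `|f t| <= C) ->
  (forall t i, M < `|tnth t i| -> f t = 0) -> dominated f.
Proof.
move=> mf M0 [C C0 fC] f0; split=> //.
exists (C * (1 + M) ^+ (2 * m)); first by rewrite mulr_ge0// exprn_ge0// addr_ge0.
move=> t; have [/forallP tM|] := boolP [forall i, `|tnth t i| <= M].
  rewrite (le_trans (fC t))// -mulrA ler_peMr//.
  exact: oneDsqrV_prod_ge.
rewrite negb_forall; case/fintype.existsP => i; rewrite -ltNge => /f0 ->.
by rewrite normr0 mulr_ge0 ?oneDsqrV_prod_ge0// mulr_ge0// exprn_ge0// addr_ge0.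
Qed.

End integral_tuple.

Section riemann.
Context {R : realType} {m : nat}.
Local Notation mT := (measurableTypeR R).
Variables (M : R) (N : nat).
Hypotheses (M0 : 0 < M) (N0 : (0 < N)%N).

Definition knot (k : nat) : R := - M + k%:R * (2 * M / N%:R).

Definition cell (a : {ffun 'I_m -> 'I_N}) : set (m.-tuple mT) :=
  [set t | forall i, knot (a i) <= tnth t i < knot (a i).+1].

Lemma mesh_gt0 : 0 < 2 * M / N%:R.
Proof. by rewrite divr_gt0// ?mulr_gt0// ltr0n. Qed.

Lemma knotS k : knot k.+1 = knot k + 2 * M / N%:R.
Proof. by rewrite /knot -natr1; ring. Qed.

Lemma knotN : knot N = M.
Proof. by rewrite /knot; field; rewrite pnatr_eq0 -lt0n N0. Qed.

Lemma knot_le j k : (j <= k)%N -> knot j <= knot k.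
Proof. by move=> jk; rewrite lerD2l ler_wpM2r ?(ltW mesh_gt0)// ler_nat. Qed.

Lemma measurable_cell a : measurable (cell a).
Proof.
rewrite (_ : cell a = \bigcap_(i in [set: 'I_m])
    ((fun t : m.-tuple mT => tnth t i) @^-1` `[knot (a i), knot (a i).+1[%classic)).
  apply: fin_bigcap_measurable; first exact: finite_finset.
  move=> i _; rewrite -[X in measurable X]setTI.
  apply: (@measurable_tnth _ mT m i) => //; exact: measurable_itv.
by apply/seteqP; split=> t H i; have := H i; rewrite /= in_itv //=; apply.
Qed.

Lemma cell_unique a b t : cell a t -> cell b t -> a = b.
Proof.
move=> at_ bt; apply/ffunP => i; apply/val_inj => /=.
have /andP[a1 a2] := at_ i; have /andP[b1 b2] := bt i.
by apply/eqP; rewrite eqn_leq; apply/andP; split; rewrite leqNgt; apply/negP => /knot_le h;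
   [have := lt_le_trans b2 h|have := lt_le_trans a2 h]; move=> h'; lra.
Qed.

Lemma cell_exists (t : m.-tuple mT) : (forall i, - M <= tnth t i < M) ->
  exists a, cell a t.
Proof.
move=> tM; pose k i := Num.truncn ((tnth t i + M) / (2 * M / N%:R)).
have pos i : 0 <= (tnth t i + M) / (2 * M / N%:R).
  rewrite divr_ge0 ?(ltW mesh_gt0)//; have /andP[? _] := tM i; lra.
have kP i : knot (k i) <= tnth t i < knot (k i).+1.
  have /andP[] := truncn_itv (pos i); rewrite -/(k i).
  rewrite ler_pdivlMr ?mesh_gt0// ltr_pdivrMr ?mesh_gt0// /knot => h1 h2.
  by apply/andP; split; lra.
have kN i : (k i < N)%N.
  rewrite ltnNge; apply/negP => /knot_le; rewrite knotN => h.
  have /andP[h1 _] := kP i; have /andP[_ h2] := tM i; lra.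
by exists [ffun i => Ordinal (kN i)] => i; rewrite ffunE; exact: kP.
Qed.

Definition node (a : {ffun 'I_m -> 'I_N}) : 'rV[R]_m := \row_i knot (a i).

Lemma cell_bound a t i : cell a t -> - M <= tnth t i < M.
Proof.
move=> at_; have /andP[a1 a2] := at_ i; apply/andP; split.
  by apply: le_trans a1; rewrite /knot lerDl mulr_ge0// ltW// mesh_gt0.
apply: (lt_le_trans a2); rewrite -[leRHS]knotN; apply: knot_le; exact: ltn_ord.
Qed.

Lemma cell_node a t : cell a t -> `|tuple_row t - node a| <= 2 * M / N%:R.
Proof.
move=> at_; apply: row_norm_le => [|i]; first exact/ltW/mesh_gt0.
rewrite !mxE; have := at_ i; rewrite knotS => /andP[a1 a2].
by rewrite ler_norml; apply/andP; split; have := mesh_gt0; lra.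
Qed.

Lemma dominated_cell a : dominated (\1_(cell a) : m.-tuple mT -> R).
Proof.
apply: (@dominated_box _ _ _ M); last 2 first.
- by exists 1 => // t; rewrite indicE; case: (_ \in _); rewrite ?normr1 ?normr0.
- move=> t i Mt; rewrite indicE; case: (boolP (t \in _)) => [|//].
  rewrite inE => ct; have := cell_bound i ct; rewrite ltr_normr in Mt.
  by case/orP: Mt => ? /andP[? ?]; exfalso; lra.
- exact: measurable_indic (measurable_cell a).
- exact: ltW.
Qed.

Definition half_open_box : set (m.-tuple mT) := [set t | forall i, - M <= tnth t i < M].

Lemma dominated_half_open_box : dominated (\1_half_open_box : m.-tuple mT -> R).
Proof.
apply: (@dominated_box _ _ _ M); last 2 first.
- by exists 1 => // t; rewrite indicE; case: (_ \in _); rewrite ?normr1 ?normr0.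
- move=> t i Mt; rewrite indicE; case: (boolP (t \in _)) => [|//].
  rewrite inE => /(_ i); rewrite ltr_normr in Mt.
  by case/orP: Mt => ? /andP[? ?]; exfalso; lra.
- apply: measurable_indic; rewrite (_ : half_open_box = \bigcap_(i in [set: 'I_m])
    ((fun t : m.-tuple mT => tnth t i) @^-1` `[- M, M[%classic)).
    apply: fin_bigcap_measurable; first exact: finite_finset.
    move=> i _; rewrite -[X in measurable X]setTI.
    apply: (@measurable_tnth _ mT m i) => //; exact: measurable_itv.
  by apply/seteqP; split=> t H i; have := H i; rewrite /= in_itv //=; apply.
- exact: ltW.
Qed.

(** The volume of a cell enters as the integral of its indicator and never has to be
    computed: the error is compared with the integral of the constant
    L (2 M / N) over the whole box. *)
Lemma riemann_sum (h : 'rV[R]_m -> R) (L : R) : 0 <= L ->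
  (forall x y, `|h x - h y| <= L * `|x - y|) ->
  (forall x, M <= `|x| -> h x = 0) -> dominated (fun t : m.-tuple mT => h (tuple_row t)) ->
  `|Itup (fun t : m.-tuple mT => h (tuple_row t))
    - \sum_a Itup (\1_(cell a) : m.-tuple mT -> R) * h (node a)|
  <= L * (2 * M / N%:R) * Itup (\1_half_open_box : m.-tuple mT -> R).
Proof.
move=> L0 hL h0 dh.
have dc a : dominated (fun t : m.-tuple mT => h (node a) * \1_(cell a) t).
  exact/dominatedZ/dominated_cell.
have -> : \sum_a Itup (\1_(cell a) : m.-tuple mT -> R) * h (node a) =
    Itup (fun t => \sum_a h (node a) * \1_(cell a) t).
  rewrite Itup_sum//; apply: eq_bigr => a _.
  rewrite (ItupZ _ (dominated_cell a)); exact: mulrC.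
have ds := dominated_sum (index_enum {ffun 'I_m -> 'I_N}) dc.
rewrite -(ItupB dh ds) -(ItupZ _ dominated_half_open_box).
apply: Itup_le; first exact: dominatedB.
  exact/dominatedZ/dominated_half_open_box.
move=> t; rewrite [X in _ <= _ * X]indicE.
case: (boolP (t \in half_open_box)) => [|tB].
  rewrite inE => /cell_exists[a at_]; rewrite mulr1 (bigD1 a)//= big1 ?addr0.
    rewrite indicE mem_set// mulr1 (le_trans (hL _ _))// ler_wpM2l//.
    exact: cell_node.
  move=> b ba; rewrite indicE memNset ?mulr0// => bt.
  by move/eqP: ba; apply; exact: cell_unique bt at_.
rewrite big1 ?subr0.
  rewrite h0 ?normr0 ?mulr0//.
  rewrite leNgt; apply/negP => tM; move/negP: tB; apply; rewrite inE => i.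
  have := le_lt_trans (ler_coord_norm (tuple_row t) i) tM.
  by rewrite mxE ltr_norml => /andP[/ltW -> ->].
move=> a _; rewrite indicE memNset ?mulr0// => at_.
by move/negP: tB; apply; rewrite inE => i; exact: cell_bound at_.
Qed.

End riemann.

(** * Integrals of complex functions and test functions as distributions *)

Lemma partialsZc (R : realType) m (U : set 'rV[R]_m) s (c : R[i]) f : open U ->
  smooth U f -> forall x, U x ->
  partials s (fun y => c * f y) x = c * partials s f x.
Proof.
move=> oU /smoothP[rf jf] x Ux; have zU (a : R) h : rsmooth U h -> rsmooth U (fun y => a * h y).
  by move=> sh; exact: smM_r oU (rsmooth_cst a oU) sh.
apply: complex_ext; rewrite ?ReM ?ImM !Re_partials !Im_partials.
  rewrite -(rpartialsZ s (complex.Re c) oU rf Ux) -mulNr.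
  rewrite -(rpartialsZ s (- complex.Im c) oU jf Ux).
  rewrite -(rpartialsD s oU (zU _ _ rf) (zU _ _ jf) Ux); congr (rpartials s _ x).
  by apply/funext => y; rewrite ReM mulNr.
rewrite -(rpartialsZ s (complex.Re c) oU jf Ux) -(rpartialsZ s (complex.Im c) oU rf Ux).
rewrite -(rpartialsD s oU (zU _ _ jf) (zU _ _ rf) Ux); congr (rpartials s _ x).
by apply/funext => y; rewrite ImM.
Qed.

Section complex_integral.
Context {R : realType} {m : nat}.
Local Notation mT := (measurableTypeR R).
Implicit Types f g : 'rV[R]_m -> R[i].

Definition dom (f : 'rV[R]_m -> R) := dominated (fun t : m.-tuple mT => f (tuple_row t)).

Definition J (f : 'rV[R]_m -> R) : R := Itup (fun t : m.-tuple mT => f (tuple_row t)).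

Definition cdom f := dom (re_fun f) /\ dom (im_fun f).

Lemma Re_integral f : complex.Re (integralRm f) = J (re_fun f).
Proof. by []. Qed.

Lemma Im_integral f : complex.Im (integralRm f) = J (im_fun f).
Proof. by []. Qed.

Lemma dom_eq (f g : 'rV[R]_m -> R) : (forall x, f x = g x) -> dom f -> dom g.
Proof. by move=> fg; rewrite (_ : f = g)//; exact/funext. Qed.

Lemma J_eq (f g : 'rV[R]_m -> R) : (forall x, f x = g x) -> J f = J g.
Proof. by move=> fg; rewrite (_ : f = g)//; exact/funext. Qed.

Lemma integralRm_eq f g : (forall x, f x = g x) -> integralRm f = integralRm g.
Proof. by move=> fg; rewrite (_ : f = g)//; exact/funext. Qed.

Lemma cdomZ c f : cdom f -> cdom (fun x => c * f x).
Proof.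
move=> [rf jf]; split.
  apply: dom_eq (dominatedB (dominatedZ (complex.Re c) rf) (dominatedZ (complex.Im c) jf)) => x.
  by rewrite /re_fun ReM.
apply: dom_eq (dominatedD (dominatedZ (complex.Re c) jf) (dominatedZ (complex.Im c) rf)) => x.
by rewrite /im_fun ImM.
Qed.

Lemma JD (f g : 'rV[R]_m -> R) : dom f -> dom g -> J (fun x => f x + g x) = J f + J g.
Proof. exact: ItupD. Qed.

Lemma JB (f g : 'rV[R]_m -> R) : dom f -> dom g -> J (fun x => f x - g x) = J f - J g.
Proof. exact: ItupB. Qed.

Lemma JZ c (f : 'rV[R]_m -> R) : dom f -> J (fun x => c * f x) = c * J f.
Proof. exact: ItupZ. Qed.

Lemma domZ c (f : 'rV[R]_m -> R) : dom f -> dom (fun x => c * f x).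
Proof. exact: dominatedZ. Qed.

Lemma integralRmD f g : cdom f -> cdom g ->
  integralRm (fun x => f x + g x) = integralRm f + integralRm g.
Proof.
move=> [rf jf] [rg jg]; apply: complex_ext; rewrite ?ReD ?ImD ?Re_integral ?Im_integral.
  by rewrite -(JD rf rg); apply: J_eq => x; rewrite /re_fun ReD.
by rewrite -(JD jf jg); apply: J_eq => x; rewrite /im_fun ImD.
Qed.

Lemma integralRmZ c f : cdom f -> integralRm (fun x => c * f x) = c * integralRm f.
Proof.
move=> [rf jf]; apply: complex_ext; rewrite ?ReM ?ImM ?Re_integral ?Im_integral.
  rewrite -(JZ (complex.Re c) rf) -(JZ (complex.Im c) jf).
  rewrite -(JB (domZ (complex.Re c) rf) (domZ (complex.Im c) jf)).
  by apply: J_eq => x; rewrite /re_fun ReM.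
rewrite -(JZ (complex.Re c) jf) -(JZ (complex.Im c) rf).
rewrite -(JD (domZ (complex.Re c) jf) (domZ (complex.Im c) rf)).
by apply: J_eq => x; rewrite /im_fun ImM.
Qed.

Lemma integralRm_le f (g : 'rV[R]_m -> R) : cdom f -> dom g ->
  (forall x, cmod (f x) <= g x) -> cmod (integralRm f) <= 2 * J g.
Proof.
move=> [rf jf] dg fg; rewrite (le_trans (cmod_le_ReIm _))// mulrDl mul1r lerD//.
  by apply: Itup_le => // t; rewrite (le_trans (Re_cmod _)).
by apply: Itup_le => // t; rewrite (le_trans (Im_cmod _)).
Qed.

Lemma J_ge0 (g : 'rV[R]_m -> R) : (forall x, 0 <= g x) -> 0 <= J g.
Proof. by move=> g0; apply: Rintegral_ge0. Qed.

Lemma dom_compact (f : 'rV[R]_m -> R) (M : R) : continuous f -> 0 <= M ->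
  (forall x, M < `|x| -> f x = 0) -> dom f.
Proof.
move=> cf M0 f0; apply: (@dominated_box _ _ _ M) => //.
- exact: measurable_continuous_row.
- have [x _|C C0 fC] := compact_bounded_fun (@compact_cbox R m 0 M) (f := f).
    exact: cf.
  exists C => // t; have [tM|tM] := leP `|tuple_row t| M.
    by apply: fC; rewrite /cbox /= subr0.
  by rewrite f0// normr0.
- move=> t i Mt; apply: f0; apply: (lt_le_trans Mt).
  by have := ler_coord_norm (tuple_row t) i; rewrite mxE.
Qed.

Lemma smooth_continuous f : smooth setT f -> continuous (re_fun f) /\ continuous (im_fun f).
Proof.
move=> /smoothP[rf jf]; split=> x; apply: differentiable_continuous.
  exact: rf [::] x I.
exact: jf [::] x I.
Qed.

Lemma cdom_compact f (M : R) : smooth setT f -> 0 <= M ->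
  (forall x, M < `|x| -> f x = 0) -> cdom f.
Proof.
move=> /smooth_continuous[cr ci] M0 f0; split; apply: (dom_compact _ M0) => // x /f0.
  by rewrite /re_fun => ->.
by rewrite /im_fun => ->.
Qed.

Lemma fsupp0 f x : ~ fsupp f x -> f x = 0.
Proof.
move=> nf; apply/eqP/negPn/negP => fx; apply: nf; exact: subset_closure.
Qed.

Lemma test_support f : test_function f -> exists2 M : R, 0 < M &
  forall x, M <= `|x| -> f x = 0.
Proof.
move=> [_ /compact_cboxP[M M0 fM]]; exists (M + 1); first by rewrite ltr_wpDl.
move=> x Mx; apply: fsupp0 => /fM; rewrite /cbox /= subr0 => xM.
by have := le_trans Mx xM; rewrite gerDl ler10.
Qed.

(** Outside V the product vanishes near every point, since the support of phi is
    closed. *)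
Lemma smooth_mul_test (V : set 'rV[R]_m) f phi : open V -> smooth V f ->
  test_function phi -> fsupp phi `<=` V -> smooth setT (fun x => f x * phi x).
Proof.
move=> oV sf [sphi cphi] pV s x _; have [Vx|nVx] := pselect (V x).
  exact: (smoothM oV sf (smoothW (@subsetT _ V) sphi)).
have oW : open (~` fsupp phi) by apply: closed_openC; exact: closed_closure.
have Wx : (~` fsupp phi) x by move=> /pV.
apply: (smooth_local oW _ (smooth_cst 0 oW)) Wx => y Wy.
by rewrite (fsupp0 Wy) mulr0.
Qed.

Lemma cdom_mul_test (V : set 'rV[R]_m) f phi : open V -> smooth V f ->
  test_function phi -> fsupp phi `<=` V -> cdom (fun x => f x * phi x).
Proof.
move=> oV sf tphi pV; have [M M0 pM] := test_support tphi.
apply: (cdom_compact (smooth_mul_test oV sf tphi pV) (ltW M0)) => x xM.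
by rewrite pM ?mulr0// ltW.
Qed.

Lemma integral_test_bound (V : set 'rV[R]_m) phi : open V ->
  test_function phi -> fsupp phi `<=` V ->
  exists2 B : R, 0 <= B & forall f, smooth V f ->
    cmod (integralRm (fun x => f x * phi x)) <= B * Cinf_norm (fsupp phi) 0 f.
Proof.
move=> oV tphi pV; have [M M0 pM] := test_support tphi.
have [sphi cphi] := tphi.
pose g x := `|re_fun phi x| + `|im_fun phi x|.
have [cr ci] := smooth_continuous sphi.
have dg : dom g.
  apply: (@dom_compact _ M _ (ltW M0)).
    by move=> x; apply: smooth_continuous_cmod sphi I.
  by move=> x /ltW/pM px; rewrite /g /re_fun /im_fun px normr0 addr0.
exists (2 * J g); first by rewrite mulr_ge0// J_ge0// => x; rewrite addr_ge0.
move=> f sf; set C := Cinf_norm _ _ _.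
have -> : 2 * J g * C = 2 * J (fun x => C * g x).
  by rewrite (JZ _ dg); ring.
apply: integralRm_le; first exact: (cdom_mul_test oV sf tphi pV).
  exact: dominatedZ.
move=> x; rewrite cmodM; have [Kx|/fsupp0 ->] := pselect (fsupp phi x); last first.
  by rewrite cmod0 mulr0 mulr_ge0 ?Cinf_norm_ge0// addr_ge0.
rewrite ler_pM ?cmod_ge0//; last exact: cmod_le_ReIm.
exact: (Cinf_norm_ge (s := [::]) sf cphi pV).
Qed.

Lemma integral_test_linear (V : set 'rV[R]_m) phi a f g : open V ->
  test_function phi -> fsupp phi `<=` V -> smooth V f -> smooth V g ->
  integralRm (fun x => (a * f x + g x) * phi x) =
  a * integralRm (fun x => f x * phi x) + integralRm (fun x => g x * phi x).
Proof.
move=> oV tphi pV sf sg.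
have df := cdom_mul_test oV sf tphi pV; have dg := cdom_mul_test oV sg tphi pV.
rewrite -(integralRmZ _ df) -(integralRmD (cdomZ _ df) dg).
by apply: integralRm_eq => x; rewrite mulrDl mulrA.
Qed.

Lemma test_distribution phi : test_function phi ->
  compact_distribution (fun f => integralRm (fun x => f x * phi x)).
Proof.
move=> tphi; split=> [a f g sf sg|].
  exact: (integral_test_linear a openT tphi (@subsetT _ _)).
have [B B0 HB] := integral_test_bound openT tphi (@subsetT _ _).
by exists (fsupp phi), 0%N, B; split=> //; exact: tphi.2.
Qed.

Lemma test_seminorm (V : set 'rV[R]_m) phi : open V ->
  test_function phi -> fsupp phi `<=` V ->
  continuous_seminorm V (fun f => cmod (integralRm (fun x => f x * phi x))).
Proof.
move=> oV tphi pV; split.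
- move=> f g sf sg; rewrite (le_trans _ (cmodD _ _))//.
  rewrite -[X in _ <= cmod (X + _)]mul1r -(integral_test_linear 1 oV tphi pV sf sg).
  by rewrite le_eqVlt; apply/orP; left; apply/eqP; congr cmod; apply: integralRm_eq => x; rewrite mul1r.
- move=> a f sf; rewrite -cmodM -(integralRmZ _ (cdom_mul_test oV sf tphi pV)).
  by congr cmod; apply: integralRm_eq => x; rewrite mulrA.
- have [B B0 HB] := integral_test_bound oV tphi pV.
  by exists (fsupp phi), 0%N, B; split=> //; exact: tphi.2.
Qed.

Lemma riemann_complex (f : 'rV[R]_m -> R[i]) (M L : R) (N : nat) :
  0 < M -> (0 < N)%N -> 0 <= L -> cdom f ->
  (forall x y, `|re_fun f x - re_fun f y| <= L * `|x - y|) ->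
  (forall x y, `|im_fun f x - im_fun f y| <= L * `|x - y|) ->
  (forall x, M <= `|x| -> f x = 0) ->
  cmod (integralRm f - \sum_(a : {ffun 'I_m -> 'I_N})
     (Itup (\1_(cell M a) : m.-tuple mT -> R))%:C * f (node M a))
  <= 2 * (L * (2 * M / N%:R) * Itup (\1_(half_open_box M) : m.-tuple mT -> R)).
Proof.
move=> M0 N0 L0 [rf jf] Lr Li f0; rewrite (le_trans (cmod_le_ReIm _))// mulrDl mul1r.
apply: lerD.
  rewrite ReD ReN Re_sum; under [X in _ - X]eq_bigr do rewrite ReZ.
  by apply: (riemann_sum M0 N0 L0 Lr) => // x /f0; rewrite /re_fun => ->.
rewrite ImD ImN Im_sum; under [X in _ - X]eq_bigr do rewrite ImZ.
by apply: (riemann_sum M0 N0 L0 Li) => // x /f0; rewrite /im_fun => ->.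
Qed.

End complex_integral.

Section exchange.
Context {R : realType} {k m : nat}.
Local Notation mT := (measurableTypeR R).

Lemma lipschitz_global n (f : 'rV[R]_n -> R) (C : R) : rsmooth setT f ->
  (forall x i, `|rpartial i f x| <= C) ->
  forall x y, `|f x - f y| <= n%:R * C * `|x - y|.
Proof.
move=> sf fC x y; rewrite -{1}[x](subrK y) [x - y + y]addrC.
apply: lipschitz_partials => [t _|t i _]; first exact: sf [::] _ I.
exact: fC.
Qed.

(** The derivatives of F in the first variable are bounded on a cylinder, and vanish
    outside it when |r| <= M'. *)
Lemma lipschitz_slices (F : 'rV[R]_(k + m) -> R) (M M' : R) : rsmooth setT F ->
  (forall z, M <= `|lsubmx z| -> F z = 0) ->
  exists2 L : R, 0 <= L & forall r x y, `|r| <= M' ->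
    `|F (row_mx x r) - F (row_mx y r)| <= L * `|x - y|.
Proof.
move=> sF F0.
have [N NP] : exists N : nat, forall s, (size s <= 1)%N -> forall z,
    cylinder 0 M M' z -> `|rpartials s F z| <= N%:R.
  apply: (@seq_bound_ex _ 1 (fun s N => forall z, cylinder 0 M M' z ->
    `|rpartials s F z| <= N%:R)) => [s N N' NN sN z Kz|s].
    by rewrite (le_trans (sN _ Kz))// ler_nat.
  have [|C C0 CP] := @compact_bounded_fun R _ _ (rpartials s F) (@compact_cylinder _ _ _ 0 M M').
    by move=> z Kz; apply: differentiable_continuous; exact: sF.
  have [N CN] := real_nat_bound C.
  by exists N => z Kz; rewrite (le_trans (CP _ Kz)).
exists (k%:R * N%:R) => // r x y rM.
have Ur : [set: 'rV[R]_k] = setT by [].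
apply: (@lipschitz_global _ (fun x => F (row_mx x r))) => [s z _|z i].
  have sc j : rsmooth setT (fun x : 'rV[R]_k => row_mx x r 0 j).
    case: (fintype.splitP j) => j' ij.
      apply: (rsmooth_eq openT _ (rsmooth_coord j' openT)) => t _.
      by rewrite (_ : j = lshift m j') ?row_mxEl//; exact/val_inj.
    apply: (rsmooth_eq openT _ (rsmooth_cst (r 0 j') openT)) => t _.
    by rewrite (_ : j = rshift k j') ?row_mxEr//; exact/val_inj.
  exact: (rsmooth_comp openT sF sc).
rewrite rpartial_slice_l; have [zM|zM] := leP `|z| M.
  by apply: (NP [:: lshift m i]) => //; split; rewrite ?row_mxKl ?row_mxKr ?subr0.
rewrite (_ : rpartial _ F _ = 0) ?normr0//.
pose V := [set z : 'rV[R]_(k + m) | [set x : 'rV[R]_k | M < `|x|] (lsubmx z)].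
have oV : open V.
  apply: open_lsubmx; rewrite -[X in open X]/((fun x : 'rV[R]_k => `|x|) @^-1` [set t | M < t]).
  apply: open_comp; last exact: open_gt.
  by move=> ? _; exact: norm_continuous.
have -> : rpartial (lshift m i) F (row_mx z r) =
    rpartial (lshift m i) (fun=> 0) (row_mx z r).
  apply: (partial_local _ oV); last by rewrite /V /= row_mxKl.
  by move=> y' /ltW; exact: F0.
by rewrite /rpartial derive_cst.
Qed.

(** Parameters of a distribution are placed in the first block of coordinates; here
    the parameter is the second one. *)
Definition swap (z : 'rV[R]_(m + k)) : 'rV[R]_(k + m) := row_mx (rsubmx z) (lsubmx z).

Lemma rsmooth_lsub n1 n2 (j : 'I_n1) :
  rsmooth setT (fun z : 'rV[R]_(n1 + n2) => lsubmx z 0 j).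
Proof.
apply: (rsmooth_eq openT _ (rsmooth_coord (lshift n2 j) openT)) => z _.
by rewrite mxE.
Qed.

Lemma rsmooth_rsub n1 n2 (j : 'I_n2) :
  rsmooth setT (fun z : 'rV[R]_(n1 + n2) => rsubmx z 0 j).
Proof.
apply: (rsmooth_eq openT _ (rsmooth_coord (rshift n1 j) openT)) => z _.
by rewrite mxE.
Qed.

Lemma rsmooth_row_mx n n1 n2 (U : set 'rV[R]_n) (f : 'rV[R]_n -> 'rV[R]_n1)
    (g : 'rV[R]_n -> 'rV[R]_n2) : open U ->
  (forall j, rsmooth U (fun z => f z 0 j)) -> (forall j, rsmooth U (fun z => g z 0 j)) ->
  forall j, rsmooth U (fun z => row_mx (f z) (g z) 0 j).
Proof.
move=> oU sf sg j; case: (fintype.splitP j) => j' ij.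
  apply: (rsmooth_eq oU _ (sf j')) => t _.
  by rewrite (_ : j = lshift n2 j') ?row_mxEl//; exact/val_inj.
apply: (rsmooth_eq oU _ (sg j')) => t _.
by rewrite (_ : j = rshift n1 j') ?row_mxEr//; exact/val_inj.
Qed.

Lemma smooth_swap (G : 'rV[R]_(k + m) -> R[i]) : smooth setT G -> smooth setT (fun z => G (swap z)).
Proof.
move=> sG; apply: (smooth_comp openT sG).
apply: (rsmooth_row_mx openT) => j; [exact: rsmooth_rsub|exact: rsmooth_lsub].
Qed.

Lemma smoothT_pre (n1 n2 : nat) (G : 'rV[R]_(n1 + n2) -> R[i]) : smooth setT G ->
  smooth [set z : 'rV[R]_(n1 + n2) | [set: 'rV[R]_n1] (lsubmx z)] G.
Proof. exact: smoothW. Qed.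

Lemma integral_param_partials (G : 'rV[R]_(k + m) -> R[i]) phi s r :
  smooth setT G -> test_function phi ->
  partials s (fun r => integralRm (fun p => G (row_mx p r) * phi p)) r =
  integralRm (fun p => partials s (fun r => G (row_mx p r)) r * phi p).
Proof.
move=> sG tphi; have cv := test_distribution tphi.
have E q p : G (row_mx p q) = G (swap (row_mx q p)) by rewrite /swap row_mxKl row_mxKr.
have := distr_param_partials cv openT s (I : [set: 'rV[R]_m] r) (smoothT_pre (smooth_swap sG)).
rewrite (_ : (fun y => integralRm _) = (fun r => integralRm (fun p => G (row_mx p r) * phi p))); last first.
  by apply/funext => q; apply: integralRm_eq => p; rewrite E.
move=> ->; apply: integralRm_eq => p; congr (_ * _).
transitivity (partials s (fun q => (fun z => G (swap z)) (row_mx q p)) r).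
  have H (F : 'rV[R]_(m + k) -> R) y : rpartials s (fun y => F (row_mx y p)) y =
      rpartials (map (@lshift m k) s) F (row_mx y p).
    elim: s y => //= i s IH y; rewrite -rpartial_slice_l.
    by congr (rpartial i _ y); apply/funext.
  apply: complex_ext; rewrite ?Re_partials ?Im_partials; apply/esym.
    exact: (H (re_fun (fun z => G (swap z)))).
  exact: (H (im_fun (fun z => G (swap z)))).
by congr (partials s _ r); apply/funext => q; rewrite E.
Qed.

Lemma integral_param_smooth (G : 'rV[R]_(k + m) -> R[i]) phi :
  smooth setT G -> test_function phi ->
  smooth setT (fun r => integralRm (fun p => G (row_mx p r) * phi p)).
Proof.
move=> sG tphi; have cv := test_distribution tphi.
have := distr_param_smooth cv openT (smoothT_pre (smooth_swap sG)).
congr smooth; apply/funext => q; apply: integralRm_eq => p.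
by rewrite /swap row_mxKl row_mxKr.
Qed.

(** A compactly supported distribution commutes with the integration of a
    parameter: both sides are limits of the same Riemann sums. *)
Lemma distr_integral u (G : 'rV[R]_(k + m) -> R[i]) (phi : 'rV[R]_k -> R[i]) :
  compact_distribution u -> smooth setT G -> test_function phi ->
  integralRm (fun p => u (fun r => G (row_mx p r)) * phi p) =
  u (fun r => integralRm (fun p => G (row_mx p r) * phi p)).
Proof.
move=> cu sG tphi; have [M M0 pM] := test_support tphi.
have sphi := tphi.1.
have [M' [l [B [M'0 uB]]]] := distr_bound cu.
have sGp p : smooth setT (fun r => G (row_mx p r)).
  exact: (smooth_row_r (I : setT p) (smoothT_pre sG)).
(* the derivatives in r of the integrands, whose Lipschitz constants in p must be uniform in r *)
pose F s z := partials (map (@rshift k m) s) G z * phi (lsubmx z).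
have sF s : smooth setT (F s).
  apply: (smoothM openT); first exact: smooth_partials.
  apply: (smooth_comp openT sphi); exact: rsmooth_lsub.
have F0 s z : M <= `|lsubmx z| -> F s z = 0 by move=> /pM; rewrite /F => ->; rewrite mulr0.
pose P (f : 'rV[R]_k -> R[i]) (L : R) := forall x y,
  `|re_fun f x - re_fun f y| <= L * `|x - y| /\ `|im_fun f x - im_fun f y| <= L * `|x - y|.
have [L1 L1P] : exists L1 : nat, forall s, (size s <= l)%N -> forall r, `|r| <= M' ->
    P (fun p => F s (row_mx p r)) L1%:R.
  apply: (@seq_bound_ex _ l (fun s N => forall r, `|r| <= M' ->
    P (fun p => F s (row_mx p r)) N%:R)) => [s N N' NN H r rM x y|s].
    have [h1 h2] := H r rM x y; split.
      by rewrite (le_trans h1)// ler_wpM2r// ler_nat.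
    by rewrite (le_trans h2)// ler_wpM2r// ler_nat.
  have [rF jF] := (smoothP _ _).1 (sF s).
  have [|A A0 AP] := @lipschitz_slices (re_fun (F s)) M M' rF.
    by move=> z /F0; rewrite /re_fun => ->.
  have [|D D0 DP] := @lipschitz_slices (im_fun (F s)) M M' jF.
    by move=> z /F0; rewrite /im_fun => ->.
  have [N AN] := real_nat_bound (A + D); exists N => r rM x y.
  have h1 : A <= N%:R by rewrite (le_trans _ AN)// lerDl.
  have h2 : D <= N%:R by rewrite (le_trans _ AN)// lerDr.
  split.
    by rewrite (le_trans (AP r x y rM))// ler_wpM2r.
  by rewrite (le_trans (DP r x y rM))// ler_wpM2r.
pose h p := u (fun r => G (row_mx p r)) * phi p.
have sh : smooth setT h.
  apply: (smoothM openT) sphi.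
  exact: (distr_param_smooth cu openT (smoothT_pre sG)).
have h0 p : M <= `|p| -> h p = 0 by move=> /pM; rewrite /h => ->; rewrite mulr0.
have [L2 [L20 L2P]] : exists L2 : R, 0 <= L2 /\ P h L2.
  have s1 : smooth setT (fun z : 'rV[R]_(k + m) => h (lsubmx z)).
    by apply: (smooth_comp openT sh); exact: rsmooth_lsub.
  have [rF jF] := (smoothP _ _).1 s1.
  have [|A A0 AP] := @lipschitz_slices _ M 0 rF.
    by move=> z /h0; rewrite /re_fun => ->.
  have [|D D0 DP] := @lipschitz_slices _ M 0 jF.
    by move=> z /h0; rewrite /im_fun => ->.
  exists (A + D); split; first exact: addr_ge0.
  move=> x y; have := AP 0 x y; have := DP 0 x y.
  rewrite /re_fun /im_fun !row_mxKl normr0 lexx => /(_ isT) h2 /(_ isT) h1; split.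
    by rewrite (le_trans h1)// ler_wpM2r// lerDl.
  by rewrite (le_trans h2)// ler_wpM2r// lerDr.
pose I0 r := integralRm (fun p => G (row_mx p r) * phi p).
have sI : smooth setT I0 by exact: integral_param_smooth.
rewrite -/I0 -[X in X = _]/(integralRm h).
pose E := Itup (\1_(half_open_box M) : k.-tuple mT -> R).
have E0 : 0 <= E by apply: Rintegral_ge0 => t _; rewrite indicE.
pose cst1 := 2 * (L2 * (2 * M) * E) + B%:R * (2 * (L1%:R * (2 * M) * E)).
have key (N : nat) : (0 < N)%N -> cmod (integralRm h - u I0) <= cst1 / N%:R.
  move=> N0; have NR0 : N%:R != 0 :> R by rewrite pnatr_eq0 -lt0n.
  pose w (a : {ffun 'I_k -> 'I_N}) : R := Itup (\1_(cell M a) : k.-tuple mT -> R).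
  pose S r := \sum_a (w a)%:C * (phi (node M a) * G (row_mx (node M a) r)).
  have sSa (a : {ffun 'I_k -> 'I_N}) : smooth setT
      (fun r => (w a)%:C * (phi (node M a) * G (row_mx (node M a) r))).
    exact: (smoothZ _ openT (smoothZ _ openT (sGp _))).
  have sS : smooth setT S by exact: (smooth_sum _ openT sSa).
  have uS : u S = \sum_a (w a)%:C * h (node M a).
    rewrite /S (distr_sum cu _ sSa); apply: eq_bigr => a _.
    rewrite (distrZ cu _ (smoothZ _ openT (sGp _))) (distrZ cu _ (sGp _)).
    by rewrite /h [u _ * _]mulrC.
  have b1 : cmod (integralRm h - u S) <= 2 * (L2 * (2 * M / N%:R) * E).
    rewrite uS; apply: (riemann_complex M0 N0 L20) => //.
    - by apply: (cdom_compact sh (ltW M0)) => x /ltW; exact: h0.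
    - by move=> x y; exact: (L2P x y).1.
    - by move=> x y; exact: (L2P x y).2.
  have b2 : cmod (u I0 - u S) <= B%:R * (2 * (L1%:R * (2 * M / N%:R) * E)).
    rewrite -(distrB cu sI sS); apply: uB; first exact: (smoothB openT sI sS).
      by rewrite !mulr_ge0 ?(ltW M0)// invr_ge0.
    move=> s r sl rM; rewrite (partialsB s openT sI sS)//.
    rewrite (integral_param_partials s r sG tphi) (partials_sum s _ openT sSa)//.
    have sl0 p : F s (row_mx p r) = partials s (fun r => G (row_mx p r)) r * phi p.
      by rewrite /F row_mxKl partials_slice_r.
    rewrite (_ : integralRm _ = integralRm (fun p => F s (row_mx p r))); last first.
      by apply: integralRm_eq => p; rewrite sl0.
    rewrite (_ : \sum_a _ = \sum_a (w a)%:C * F s (row_mx (node M a) r)); last first.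
      apply: eq_bigr => a _; rewrite sl0.
      rewrite (partialsZ s (w a) openT (smoothZ _ openT (sGp _)))//; congr (_ * _).
      by rewrite (partialsZc s _ openT (sGp _))// mulrC.
    have sFr : smooth setT (fun p => F s (row_mx p r)).
      apply: (smooth_comp openT (sF s)).
      apply: (rsmooth_row_mx openT) => j; first exact: rsmooth_coord openT.
      exact: rsmooth_cst openT.
    have F0r p : M <= `|p| -> F s (row_mx p r) = 0.
      by move=> pM'; apply: F0; rewrite row_mxKl.
    apply: (riemann_complex M0 N0) => //.
    - by apply: (cdom_compact sFr (ltW M0)) => x /ltW; exact: F0r.
    - by move=> x y; exact: (L1P s sl r rM x y).1.
    - by move=> x y; exact: (L1P s sl r rM x y).2.
  rewrite (_ : _ - _ = (integralRm h - u S) - (u I0 - u S)); last by ring.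
  rewrite (le_trans (cmodB _ _))// (le_trans (lerD b1 b2))//.
  by rewrite le_eqVlt; apply/orP; left; apply/eqP; rewrite /cst1; field.
have c0 : 0 <= cst1.
  by rewrite addr_ge0// !mulr_ge0 ?(ltW M0)//.
apply/eqP; rewrite -subr_eq0; apply/eqP/Normc.eq0_normc/eqP.
rewrite -[Normc.normc _]/(cmod _) eq_le cmod_ge0 andbT.
apply/ler_addgt0Pr => e e0; rewrite add0r.
have [N Ne] := real_nat_bound (cst1 / e).
rewrite (le_trans (key N.+1 isT))// ler_pdivrMr ?ltr0n// mulrC -ler_pdivrMr//.
by rewrite (le_trans Ne)// ler_nat.
Qed.

End exchange.

(** * The Heisenberg group *)

Section group_law.
Context {R : realType} {n : nat}.
Local Notation m := (n + n + 1)%N.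
Local Notation H := 'rV[R]_m.
Implicit Types p q r : H.

(** Together with the central vector et, omega describes the group law by a single
    formula, hmulE. *)
Definition omega p q : R := dotp (hx p) (hxi q) - dotp (hx q) (hxi p).

Definition et : H := row_mx 0 1%:M.

Lemma dotpDl (x y z : 'rV[R]_n) : dotp (x + y) z = dotp x z + dotp y z.
Proof. by rewrite /dotp -big_split; apply: eq_bigr => i _; rewrite mxE mulrDl. Qed.

Lemma dotpDr (x y z : 'rV[R]_n) : dotp x (y + z) = dotp x y + dotp x z.
Proof. by rewrite /dotp -big_split; apply: eq_bigr => i _; rewrite mxE mulrDr. Qed.

Lemma dotpZl a (x y : 'rV[R]_n) : dotp (a *: x) y = a * dotp x y.
Proof. by rewrite /dotp mulr_sumr; apply: eq_bigr => i _; rewrite mxE mulrA. Qed.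

Lemma dotpZr a (x y : 'rV[R]_n) : dotp x (a *: y) = a * dotp x y.
Proof. by rewrite /dotp mulr_sumr; apply: eq_bigr => i _; rewrite mxE mulrCA. Qed.

Lemma omega_linear p : linear (omega p).
Proof.
move=> a x y; rewrite /omega /hx /hxi !linearP /= dotpDr dotpDl dotpZr dotpZl.
by rewrite -[_ *: _]/(_ * _); ring.
Qed.

Lemma omegaC p q : omega p q = - omega q p.
Proof. by rewrite /omega opprB. Qed.

Lemma omega_et p : omega p et = 0.
Proof.
rewrite /omega /et /hx /hxi row_mxKl linear0 linear0.
by rewrite -(scale0r (0 : 'rV[R]_n)) dotpZr dotpZl !mul0r subrr.
Qed.

Lemma hmulE p q : hmul p q = p + q + (2^-1 * omega p q) *: et.
Proof.
rewrite /hmul /et scale_row_mx scaler0.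
rewrite -[in RHS](hsubmxK p) -[in RHS](hsubmxK q) !add_row_mx addr0.
congr row_mx.
  by rewrite -[lsubmx p in RHS]hsubmxK -[lsubmx q in RHS]hsubmxK add_row_mx.
apply/rowP => i; rewrite !mxE !ord1 eqxx mulr1n mulr1 /ht /omega.
by rewrite !hsubmxK !mxE.
Qed.

Lemma omega0 p : omega p 0 = 0.
Proof. by have := omega_linear p (-1) 0 0; rewrite scaler0 addr0 scaleN1r addNr. Qed.

Lemma omegaD p q r : omega p (q + r) = omega p q + omega p r.
Proof. by have := omega_linear p 1 q r; rewrite !scale1r. Qed.

Lemma omegaZ p a q : omega p (a *: q) = a * omega p q.
Proof. by have := omega_linear p a q 0; rewrite addr0 omega0 addr0. Qed.

Lemma omegaN p q : omega p (- q) = - omega p q.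
Proof. by rewrite -scaleN1r omegaZ mulN1r. Qed.

Lemma omegapp p : omega p p = 0.
Proof. by rewrite /omega subrr. Qed.

Lemma hquoE p r : hmul p (hinv r) = p - r - (2^-1 * omega p r) *: et.
Proof. by rewrite hmulE /hinv omegaN mulrN scaleNr. Qed.

Lemma omegaNl p q : omega (- p) q = - omega p q.
Proof. by rewrite omegaC omegaN opprK omegaC. Qed.

Lemma omega_quo p r c s : omega (p - r - c *: et) s = omega p s - omega r s.
Proof.
rewrite omegaC !omegaD !omegaN omegaZ omega_et mulr0 subr0 (omegaC s p) (omegaC s r).
by rewrite opprD !opprK.
Qed.

Lemma hquoK p r : hmul (hmul p (hinv r)) r = p.
Proof.
rewrite [hmul (hmul _ _) _]hmulE hquoE omega_quo omegapp subr0.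
by rewrite addrAC subrK subrK.
Qed.

Lemma hinv_quoK p r : hmul (hinv (hmul p (hinv r))) p = r.
Proof.
rewrite [hmul (hinv _) _]hmulE hquoE /hinv omegaNl omega_quo.
rewrite omegapp sub0r opprK (omegaC r p) mulrN scaleNr.
by apply/rowP => i; rewrite !mxE; ring.
Qed.

Lemma norm_et : `|et| <= 1.
Proof.
apply: row_norm_le => // j; rewrite mxE; case: (fintype.splitP j) => k _; rewrite mxE ?normr0//.
by rewrite !ord1 eqxx normr1.
Qed.

Lemma dotp_le (x y : 'rV[R]_n) : `|dotp x y| <= n%:R * (`|x| * `|y|).
Proof.
rewrite /dotp (le_trans (sum_coord_le x (C := `|y|) _))// => [i|].
  exact: ler_coord_norm.
by rewrite le_eqVlt; apply/orP; left; apply/eqP; ring.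
Qed.

Lemma hx_le p : `|hx p| <= `|p|.
Proof.
rewrite -{2}(hsubmxK p) -(hsubmxK (lsubmx p)) !row_mx_norm !le_max.
by rewrite /hx lexx.
Qed.

Lemma hxi_le p : `|hxi p| <= `|p|.
Proof.
rewrite -{2}(hsubmxK p) -(hsubmxK (lsubmx p)) !row_mx_norm !le_max.
by rewrite /hxi lexx orbT.
Qed.

Lemma omega_le p q : `|2^-1 * omega p q| <= n%:R * (`|p| * `|q|).
Proof.
have b1 : `|dotp (hx p) (hxi q)| <= n%:R * (`|p| * `|q|).
  by rewrite (le_trans (dotp_le _ _))// ler_wpM2l// ler_pM ?hx_le ?hxi_le.
have b2 : `|dotp (hx q) (hxi p)| <= n%:R * (`|p| * `|q|).
  rewrite (le_trans (dotp_le _ _))// ler_wpM2l// mulrC ler_pM ?hx_le ?hxi_le//.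
rewrite normrM ger0_norm// mulrC ler_pdivrMr//.
by rewrite (le_trans (ler_normB _ _))// mulr_natr mulr2n lerD.
Qed.

(** Left multiplication by a small element moves points slightly, uniformly on
    compact sets. *)
Lemma hmul_near q r : `|hmul q r - r| <= (1 + n%:R * `|r|) * `|q|.
Proof.
rewrite hmulE addrAC addrK (le_trans (ler_normD _ _))// mulrDl mul1r lerD2l.
rewrite normrZ (@le_trans _ _ (`|2^-1 * omega q r| * 1))//.
  by rewrite ler_wpM2l// norm_et.
by rewrite mulr1 (le_trans (omega_le _ _))// -mulrA [`|r| * _]mulrC.
Qed.

Lemma hmul_norm p q : `|hmul p q| <= `|q| + (1 + n%:R * `|q|) * `|p|.
Proof. by rewrite -[hmul p q](subrK q) (le_trans (ler_normD _ _))// addrC lerD2l hmul_near. Qed.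

Lemma hinv_norm p : `|hinv p| = `|p|.
Proof. exact: normrN. Qed.

Lemma hmul0p p : hmul 0 p = p.
Proof. by rewrite hmulE omegaC omega0 oppr0 mulr0 scale0r addr0 add0r. Qed.

(** The map is triangular because v points along the last coordinate, on which the
    linear form with coefficients a does not depend. *)
Lemma J_shear_along (v : H) (c : R) (a : 'I_m -> R) (b : H) (f : H -> R) : c != 0 ->
  (forall j, v 0 j != 0 -> j = rshift (n + n) ord0) ->
  a (rshift (n + n) ord0) = 0 -> dom f ->
  J (fun x => f (c *: x + (\sum_k x 0 k * a k) *: v + b)) = `|c|^-1 ^+ m * J f.
Proof.
move=> c0 etl a0 df.
(* the matrix of the linear part; its only nonzero off-diagonal entries lie in the last row *)
pose M (j k : 'I_m) : R := c * (j == k)%:R + a k * v 0 j.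
have := @Rintegral_triangular R m M (fun j => b 0 j) `|c| (fun t => f (tuple_row t)).
rewrite normr_gt0 c0 => /(_ isT); rewrite /J /Itup => <-.
- apply: eq_Rintegral => t _; congr f; apply/rowP => j; rewrite !mxE tnth_mktuple; congr (_ + _).
  rewrite /M; under [RHS]eq_bigr do rewrite mulrDl.
  rewrite big_split /=; congr (_ + _).
    rewrite (bigD1 j)//= big1 ?addr0 ?eqxx ?mulr1// => k /negbTE kj.
    by rewrite eq_sym kj mulr0 mul0r.
  rewrite mulr_suml; apply: eq_bigr => k _; rewrite !mxE; ring.
- move=> j; rewrite /M eqxx mulr1; have [->|/etl ->] := eqVneq (v 0 j) 0.
    by rewrite mulr0 addr0.
  by rewrite a0 mul0r addr0.
- move=> j k jk; rewrite /M (_ : j == k = false) ?mulr0 ?add0r; last first.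
    by apply/eqP => jk'; move: jk; rewrite jk' ltnn.
  have [->|/etl jl] := eqVneq (v 0 j) 0; first by rewrite mulr0.
  have kn : (k <= n + n)%N.
    by move: (ltn_ord k); move: (nat_of_ord k) => k'; rewrite addn1 ltnS.
  by move: jk; rewrite jl /= addn0 ltnNge kn.
- exact: dominated_integrable.
Qed.

Lemma et_neq0 (j : 'I_m) : et 0 j != 0 -> j = rshift (n + n) ord0.
Proof.
rewrite mxE; case: (fintype.splitP j) => k jk; rewrite mxE ?eqxx// => _.
by apply/val_inj; rewrite /= jk ord1.
Qed.

Lemma J_shear (c : R) (a : 'I_m -> R) (b : H) (f : H -> R) : c != 0 ->
  a (rshift (n + n) ord0) = 0 -> dom f ->
  J (fun x => f (c *: x + (\sum_k x 0 k * a k) *: et + b)) = `|c|^-1 ^+ m * J f.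
Proof. by move=> c0 a0 df; apply: J_shear_along => //; exact: et_neq0. Qed.

Lemma omega_sum p x : omega p x = \sum_k x 0 k * omega p (delta_mx 0 k).
Proof.
pose glM := GRing.isLinear.Build _ _ _ _ _ (omega_linear p).
pose gL : {linear H -> R} := HB.pack (omega p) glM.
exact: (linear_sum_coord gL x).
Qed.

Lemma et_delta : et = delta_mx 0 (rshift (n + n) ord0).
Proof.
apply/rowP => j; rewrite !mxE; case: (fintype.splitP j) => k jk; rewrite mxE /=.
  rewrite (_ : j == _ = false)//; apply/eqP => /(congr1 val) /=; rewrite jk addn0 => E.
  by have := ltn_ord k; rewrite E ltnn.
have -> : j = rshift (n + n) ord0 by apply/val_inj; rewrite /= jk ord1.
by rewrite !ord1 !eqxx.
Qed.

Lemma J_quo_r p (f : H -> R) : dom f -> J (fun r => f (hmul p (hinv r))) = J f.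
Proof.
move=> df.
rewrite -[RHS]mul1r -(expr1n _ m) -[1 in RHS]invr1 -(normr1 R) -normrN.
rewrite -(@J_shear (-1) (fun k => - (2^-1 * omega p (delta_mx 0 k))) p) ?oppr_eq0 ?oner_eq0//.
  apply: J_eq => r; congr f; rewrite hquoE omega_sum mulr_sumr.
  rewrite (_ : \sum_k _ = \sum_k r 0 k * (2^-1 * omega p (delta_mx 0 k))); last first.
    by apply: eq_bigr => k _; ring.
  under [in RHS]eq_bigr do rewrite mulrN; rewrite sumrN !scaleNr scale1r.
  by rewrite -[RHS]addrC addrA.
by rewrite -et_delta omega_et mulr0 oppr0.
Qed.

Lemma J_quo_l r (f : H -> R) : dom f -> J (fun p => f (hmul p (hinv r))) = J f.
Proof.
move=> df.
rewrite -[RHS]mul1r -(expr1n _ m) -[1 in RHS]invr1 -(normr1 R).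
rewrite -(@J_shear 1 (fun k => 2^-1 * omega r (delta_mx 0 k)) (- r)) ?oner_eq0//.
  apply: J_eq => p; congr f; rewrite hquoE omegaC omega_sum mulrN scaleNr opprK mulr_sumr scale1r.
  rewrite (_ : \sum_k _ = \sum_k p 0 k * (2^-1 * omega r (delta_mx 0 k))); last first.
    by apply: eq_bigr => k _; ring.
  by rewrite addrAC.
by rewrite -et_delta omega_et mulr0.
Qed.

Lemma J_dilation (e : R) (f : H -> R) : 0 < e -> dom f ->
  dom (fun q => f (e^-1 *: q)) ->
  J (fun q => e ^- (2 * n + 1) * f (e^-1 *: q)) = J f.
Proof.
move=> e0 df d1; have mE : (2 * n + 1 = m)%N by rewrite mul2n -addnn.
have E := @J_shear e^-1 (fun=> 0) 0 f; rewrite invr_eq0 gt_eqF// in E.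
have {}E := E isT erefl df.
rewrite (JZ _ d1).
rewrite (_ : J (fun q => f (e^-1 *: q)) = e ^+ m * J f).
  by rewrite mE mulrA mulVf ?mul1r// expf_neq0// gt_eqF.
rewrite -[e in RHS](gtr0_norm e0) -[`|e|]invrK -normfV -E; apply: J_eq => q; congr f.
by rewrite big1 ?scale0r ?addr0// => k _; rewrite mulr0.
Qed.

End group_law.

Section smooth_group_law.
Context {R : realType} {n N : nat}.
Local Notation H := 'rV[R]_(n + n + 1).
Variables (U : set 'rV[R]_N) (bd : set ('rV[R]_N -> R)).
Hypotheses (oU : open U) (gbd : growth U bd).
Hypothesis bdM : forall f g, bd f -> bd g -> bd (fun x => f x * g x).
Hypothesis bdc : forall c, bd (fun=> c).
Variables f g : 'rV[R]_N -> H.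
Hypothesis sf : forall j, sm U bd (fun z => f z 0 j).
Hypothesis sg : forall j, sm U bd (fun z => g z 0 j).

Lemma sm_scale c h : sm U bd h -> sm U bd (fun z => c * h z).
Proof. by move=> sh; apply: (smM oU gbd bdM) sh; exact: sm_cst. Qed.

Lemma sm_hmul j : sm U bd (fun z => hmul (f z) (g z) 0 j).
Proof.
have so : sm U bd (fun z => omega (f z) (g z)).
  apply: (sm_eq oU gbd (f := fun z =>
      (\sum_i f z 0 (lshift 1 (lshift n i)) * g z 0 (lshift 1 (rshift n i)))
      + -1 * (\sum_i g z 0 (lshift 1 (lshift n i)) * f z 0 (lshift 1 (rshift n i))))).
    move=> z _; rewrite mulN1r /omega /dotp /hx /hxi; congr (_ - _).
      by apply: eq_bigr => i _; rewrite !mxE.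
    by apply: eq_bigr => i _; rewrite !mxE.
  apply: (smD oU gbd); last apply: sm_scale.
    by apply: (sm_sum oU gbd) => i; exact: (smM oU gbd bdM).
  by apply: (sm_sum oU gbd) => i; exact: (smM oU gbd bdM).
apply: (sm_eq oU gbd (f := fun z => f z 0 j + g z 0 j + (2^-1 * et 0 j) * omega (f z) (g z))).
  by move=> z _; rewrite hmulE !mxE; ring.
by apply: (smD oU gbd); [exact: (smD oU gbd)|exact: sm_scale].
Qed.

End smooth_group_law.

(** * Schwartz functions *)

Section schwartz.
Context {R : realType}.

Lemma expr1D_le (t : R) N : 0 <= t -> (1 + t) ^+ N <= 2 ^+ N * (1 + t ^+ N).
Proof.
move=> t0; have [t1|t1] := leP t 1.
  apply: (@le_trans _ _ (2 ^+ N * 1)).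
    rewrite mulr1 lerXn2r ?nnegrE ?addr_ge0//; lra.
  by rewrite ler_wpM2l ?exprn_ge0// lerDl exprn_ge0.
apply: (@le_trans _ _ (2 ^+ N * t ^+ N)).
  rewrite -exprMn lerXn2r ?nnegrE ?addr_ge0 ?mulr_ge0//; lra.
by rewrite ler_wpM2l ?exprn_ge0// lerDr.
Qed.

Lemma norm_row_coord m (x : 'rV[R]_m) : x != 0 -> exists i, `|x| = `|x 0 i|.
Proof.
move=> x0; have [|[j i] /= E] := @mx_norm_neq0 _ _ _ x.
  by rewrite -[mx_norm x]/`|x| normr_eq0.
by exists i; rewrite -[LHS]/(mx_norm x) E ord1.
Qed.

Lemma schwartz_rapid m (f : 'rV[R]_m -> R[i]) s N : schwartz f ->
  exists2 C : R, 0 <= C & forall x, cmod (partials s f x) * (1 + `|x|) ^+ N <= C.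
Proof.
move=> [_ Hf].
pose a (i : 'I_m) (j : 'I_m) := if j == i then N else 0%N.
have monE i (x : 'rV[R]_m) : monomial (a i) x = x 0 i ^+ N.
  rewrite /monomial (bigD1 i)//= /a eqxx big1 ?mulr1// => j /negbTE ->.
  by rewrite expr0.
have [B0 B0P] := Hf (fun=> 0%N) s.
have {}B0P x : cmod (partials s f x) <= B0.
  have := B0P x; rewrite (_ : monomial _ x = 1) ?mul1r//.
  by rewrite /monomial big1.
have [B BP] := choice (fun i => Hf (a i) s).
have {}BP i x : cmod (partials s f x) * `|x 0 i| ^+ N <= B i.
  by have := BP i x; rewrite monE cmodM cmod_real normrX mulrC.
have B00 : 0 <= B0 by apply: le_trans (B0P 0); exact: cmod_ge0.
have Bi0 i : 0 <= B i by apply: le_trans (BP i 0); rewrite mulr_ge0 ?cmod_ge0// exprn_ge0.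
exists (2 ^+ N * (B0 + (B0 + \sum_i B i))).
  by rewrite mulr_ge0 ?exprn_ge0// !addr_ge0// sumr_ge0.
move=> x; apply: (@le_trans _ _ (cmod (partials s f x) * (2 ^+ N * (1 + `|x| ^+ N)))).
  by rewrite ler_wpM2l ?cmod_ge0// expr1D_le.
rewrite mulrCA ler_wpM2l ?exprn_ge0// mulrDr mulr1 lerD//.
have [->|x0] := eqVneq x 0.
  rewrite normr0 (@le_trans _ _ (cmod (partials s f 0) * 1))//.
    by rewrite ler_wpM2l ?cmod_ge0// expr0n; case: (N == 0%N).
  by rewrite mulr1 (le_trans (B0P 0))// lerDl sumr_ge0.
have [i ->] := norm_row_coord x0.
rewrite (le_trans (BP i x))// (bigD1 i)//= addrCA lerDl addr_ge0// sumr_ge0//.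
Qed.

Lemma monomial_le m (a : 'I_m -> nat) (x : 'rV[R]_m) :
  `|monomial a x| <= (1 + `|x|) ^+ (\sum_i a i).
Proof.
rewrite /monomial normr_prod -prodrXr.
apply: ler_prod => i _; rewrite normrX exprn_ge0//=.
rewrite lerXn2r ?nnegrE ?addr_ge0//.
by rewrite (le_trans (ler_coord_norm x i))// lerDr.
Qed.

Lemma rapid_schwartz m (f : 'rV[R]_m -> R[i]) : smooth setT f ->
  (forall s N, exists2 C : R, 0 <= C &
    forall x, cmod (partials s f x) * (1 + `|x|) ^+ N <= C) -> schwartz f.
Proof.
move=> sf Hf; split=> // a s; have [C C0 CP] := Hf s (\sum_i a i)%N.
exists C => x; rewrite cmodM cmod_real mulrC (le_trans _ (CP x))//.
by rewrite ler_wpM2l ?cmod_ge0// monomial_le.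
Qed.

End schwartz.

(** * The regularizing kernel as a function of the parameter and both points *)

Section kernel.
Context {R : realType} {n : nat}.
Local Notation m := (n + n + 1)%N.
Local Notation H := 'rV[R]_m.
Local Notation W := 'rV[R]_((1 + m) + m).
Variables (rho : H -> R[i]) (b : bool).
Hypothesis rho_schwartz : schwartz rho.

(** The value b = true gives the regularization of a distribution, b = false its
    transpose, acting on test functions. *)
Definition quo (y z : H) : H := if b then hmul y (hinv z) else hmul z (hinv y).

(** A point of W is a triple (e, y, z): the parameter, the point at which the
    regularization is evaluated, and the variable of the distribution. *)
Definition eco (w : W) : R := lsubmx (lsubmx w) 0 0.
Definition yco (w : W) : H := rsubmx (lsubmx w).
Definition zco (w : W) : H := rsubmx w.

Definition kern (w : W) : R[i] := mollify rho (eco w) (quo (yco w) (zco w)).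

Definition Ukern : set W := [set w | [set v | unit_rows (lsubmx v)] (lsubmx w)].

Lemma open_Ukern : open Ukern.
Proof. exact: open_lsubmx (open_lsubmx open_unit_rows). Qed.

Definition wt (w : W) : R := (eco w)^-1.

Variable S : R -> set W.
Hypothesis S_bounded : forall M w, S M w -> `|w| <= M.

Lemma wt_ge1 M w : Ukern w -> S M w -> 1 <= wt w.
Proof. by move=> /andP[e0 e1] _; rewrite /wt invf_ge1// ltW. Qed.

Local Notation M := (wmoderate Ukern S wt).
Local Notation N := (wrapid Ukern S wt).

Let gM : growth Ukern M := wmoderate_growth wt_ge1.
Let gN : growth Ukern N := wrapid_growth wt_ge1.
Let MM : forall f g, M f -> M g -> M (fun x => f x * g x) := @wmoderateM _ _ _ Ukern S wt.
Let NM : forall f g, N f -> M g -> N (fun x => f x * g x) := wrapidM wt_ge1.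

Lemma rsmooth_M h : rsmooth setT h -> sm Ukern M h.
Proof.
move=> sh s; split=> [x _|]; first exact: sh.
apply: wmoderate_bounded => r.
have [x _|C C0 CP] := compact_bounded_fun (@compact_cbox R _ 0 r) (f := rpartials s h).
  by apply: differentiable_continuous; exact: sh.
exists C => // x _ /S_bounded xr; apply: CP; by rewrite /cbox /= subr0.
Qed.

Lemma wt_M k (c : R) : sm Ukern M (fun w => c * wt w ^+ k).
Proof.
apply: (@sm_comp1 _ _ _ open_Ukern M M gM MM inverse_powers [set y | y != 0] eco
  inverse_powers_derive _ _ _ (fun y => c * y^-1 ^+ k)).
- move=> _ [d [l ->]] r; exists `|d|, l; split=> // w Uw Sw.
  have w0 : 0 <= (eco w)^-1 := le_trans ler01 (wt_ge1 Uw Sw).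
  by rewrite normrM normrX [`|(eco w)^-1|]ger0_norm.
- by move=> w /andP[e0 _]; rewrite /= gt_eqF.
- apply: rsmooth_M; apply: (rsmooth_eq openT _ (rsmooth_coord (lshift m (lshift m ord0)) openT)).
  by move=> w _; rewrite /eco !mxE.
- by exists c, k.
Qed.

Lemma quo_rsmooth j : rsmooth setT (fun w => quo (yco w) (zco w) 0 j).
Proof.
have sy k : rsmooth setT (fun w => yco w 0 k).
  apply: (rsmooth_eq openT _ (rsmooth_coord (lshift m (rshift 1 k)) openT)) => w _.
  by rewrite /yco !mxE.
have sz k : rsmooth setT (fun w => zco w 0 k) by exact: rsmooth_rsub.
have sopp (f : W -> H) : (forall k, rsmooth setT (fun w => f w 0 k)) ->
    forall k, sm setT setT (fun w => hinv (f w) 0 k).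
  move=> sf k; apply/rsmoothE.
  apply: (rsmooth_eq openT _ (smM_r openT (rsmooth_cst (-1) openT) (sf k))) => w _.
  by rewrite mulN1r mxE.
apply/rsmoothE; rewrite /quo; case: b.
  apply: (sm_hmul openT (growthT setT)) => // k; [exact/rsmoothE|exact: sopp].
apply: (sm_hmul openT (growthT setT)) => // k; [exact/rsmoothE|exact: sopp].
Qed.

Lemma arg_M j : sm Ukern M (fun w => ((eco w)^-1 *: quo (yco w) (zco w)) 0 j).
Proof.
apply: (sm_eq open_Ukern gM (f := fun w => (1 * wt w ^+ 1) * quo (yco w) (zco w) 0 j)).
  by move=> w _; rewrite mul1r mxE.
apply: (smM open_Ukern gM MM); first exact: wt_M.
exact/rsmooth_M/quo_rsmooth.
Qed.

(** The argument of g is polynomial in (1 / e, y, z), and g has bounded derivatives. *)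
Lemma kern_part_M (g : H -> R) : rsmooth setT g ->
  (forall s, exists2 C : R, 0 <= C & forall x, `|rpartials s g x| <= C) ->
  sm Ukern M (fun w => eco w ^- (2 * n + 1) * g ((eco w)^-1 *: quo (yco w) (zco w))).
Proof.
move=> sg bg.
apply: (sm_eq open_Ukern gM (f := fun w => (1 * wt w ^+ (2 * n + 1)) *
    g ((eco w)^-1 *: quo (yco w) (zco w)))).
  by move=> w _; rewrite mul1r /wt exprVn.
apply: (smM open_Ukern gM MM); first exact: wt_M.
apply: (sm_comp open_Ukern gM MM) arg_M => [s x|s]; first exact: sg.
by apply: wmoderate_bounded => r; have [C C0 CP] := bg s; exists C.
Qed.

(** Away from the diagonal the argument of g has norm at least c / e, where the decay
    of g beats every power of 1 / e. *)
Lemma kern_part_N (g : H -> R) : rsmooth setT g ->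
  (forall s L, exists2 C : R, 0 <= C & forall x, `|rpartials s g x| * (1 + `|x|) ^+ L <= C) ->
  (forall r, exists2 c : R, 0 < c & forall w, S r w -> c <= `|quo (yco w) (zco w)|) ->
  sm Ukern N (fun w => eco w ^- (2 * n + 1) * g ((eco w)^-1 *: quo (yco w) (zco w))).
Proof.
move=> sg bg sep.
apply: (sm_eq open_Ukern gN (f := fun w =>
    g ((eco w)^-1 *: quo (yco w) (zco w)) * (1 * wt w ^+ (2 * n + 1)))).
  by move=> w _; rewrite mul1r /wt exprVn mulrC.
apply: (smM open_Ukern gN NM); last exact: wt_M.
apply: (sm_comp open_Ukern gN NM) arg_M => [s x|s r L]; first exact: sg.
have [C C0 CP] := bg s L; have [c c0 cP] := sep r.
exists (C / c ^+ L); split; first by rewrite divr_ge0// exprn_ge0// ltW.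
move=> w Uw Sw; rewrite ler_pdivlMr ?exprn_gt0// -mulrA -exprMn.
apply: le_trans (CP ((eco w)^-1 *: quo (yco w) (zco w))).
have w0 : 0 <= (eco w)^-1 := le_trans ler01 (wt_ge1 Uw Sw).
rewrite ler_wpM2l// lerXn2r ?nnegrE ?addr_ge0 ?mulr_ge0 ?(ltW c0)//.
rewrite normrZ ger0_norm// (@le_trans _ _ (wt w * `|quo (yco w) (zco w)|))//.
  by rewrite ler_wpM2l// cP.
by rewrite lerDr.
Qed.

Lemma re_rho_rapid s L : exists2 C : R, 0 <= C &
  forall x, `|rpartials s (re_fun rho) x| * (1 + `|x|) ^+ L <= C.
Proof.
have [C C0 CP] := schwartz_rapid s L rho_schwartz; exists C => // x.
apply: le_trans (CP x); rewrite ler_wpM2r ?exprn_ge0 ?addr_ge0//.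
by rewrite -re_fun_partials; exact: Re_cmod.
Qed.

Lemma im_rho_rapid s L : exists2 C : R, 0 <= C &
  forall x, `|rpartials s (im_fun rho) x| * (1 + `|x|) ^+ L <= C.
Proof.
have [C C0 CP] := schwartz_rapid s L rho_schwartz; exists C => // x.
apply: le_trans (CP x); rewrite ler_wpM2r ?exprn_ge0 ?addr_ge0//.
by rewrite -im_fun_partials; exact: Im_cmod.
Qed.

Lemma re_kern : re_fun kern =
  fun w => eco w ^- (2 * n + 1) * re_fun rho ((eco w)^-1 *: quo (yco w) (zco w)).
Proof. by apply/funext => w; rewrite /re_fun /kern /mollify ReZ. Qed.

Lemma im_kern : im_fun kern =
  fun w => eco w ^- (2 * n + 1) * im_fun rho ((eco w)^-1 *: quo (yco w) (zco w)).
Proof. by apply/funext => w; rewrite /im_fun /kern /mollify ImZ. Qed.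

Lemma kern_M : sm Ukern M (re_fun kern) /\ sm Ukern M (im_fun kern).
Proof.
have [rr ri] := (smoothP _ _).1 rho_schwartz.1; split.
  rewrite re_kern; apply: kern_part_M rr _ => s.
  have [C C0 CP] := re_rho_rapid s 0; exists C => // x.
  by have := CP x; rewrite mulr1.
rewrite im_kern; apply: kern_part_M ri _ => s.
have [C C0 CP] := im_rho_rapid s 0; exists C => // x.
by have := CP x; rewrite mulr1.
Qed.

Lemma kern_N : (forall r, exists2 c : R, 0 < c & forall w, S r w -> c <= `|quo (yco w) (zco w)|) ->
  sm Ukern N (re_fun kern) /\ sm Ukern N (im_fun kern).
Proof.
move=> sep; have [rr ri] := (smoothP _ _).1 rho_schwartz.1; split.
  by rewrite re_kern; apply: kern_part_N rr re_rho_rapid sep.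
by rewrite im_kern; apply: kern_part_N ri im_rho_rapid sep.
Qed.

End kernel.

(** * Regularized distributions *)

Section regularization.
Context {R : realType} {n : nat}.
Local Notation m := (n + n + 1)%N.
Local Notation H := 'rV[R]_m.
Local Notation W := 'rV[R]_((1 + m) + m).
Variables (rho : H -> R[i]) (b : bool).
Hypothesis rho_schwartz : schwartz rho.
Variable u : (H -> R[i]) -> R[i].
Hypothesis cu : compact_distribution u.

Local Notation kernb := (kern rho b).
Local Notation U1 := [set v : 'rV[R]_(1 + m) | unit_rows (lsubmx v)].

Definition reg (e : R) (y : H) : R[i] := u (fun z => mollify rho e (quo b y z)).

Lemma kern_row e (y z : H) :
  kernb (row_mx (row_mx (const_mx e) y) z) = mollify rho e (quo b y z).
Proof. by rewrite /kern /eco /yco /zco !row_mxKl !row_mxKr mxE. Qed.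

Lemma kern_smooth : smooth (@Ukern R n) kernb.
Proof.
have H0 (r : R) w : [set w : W | `|w| <= r] w -> `|w| <= r by [].
have [kr ki] := kern_M b rho_schwartz H0.
by apply/smoothP; split; [exact: sm_rsmooth kr|exact: sm_rsmooth ki].
Qed.

Let g (v : 'rV[R]_(1 + m)) := u (fun z => kernb (row_mx v z)).

Let oU1 : open U1 := open_lsubmx open_unit_rows.

Lemma reg_row e y : reg e y = g (row_mx (const_mx e) y).
Proof. by rewrite /reg /g; congr u; apply/funext => z; rewrite kern_row. Qed.

Lemma reg_smooth_net : smooth_net setT reg.
Proof.
apply: (@smooth_net_eq _ _ _ (fun e y => g (row_mx (const_mx e) y))).
  by move=> e y; rewrite reg_row.
exact/smooth_net_joint/(distr_param_smooth cu oU1 kern_smooth).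
Qed.

Lemma U1_row (e : R) (y : H) : 0 < e < 1 -> U1 (row_mx (const_mx e) y).
Proof. by rewrite /= row_mxKl /unit_rows /= mxE. Qed.

Lemma reg_partials s e y : 0 < e < 1 -> partials s (reg e) y =
  u (fun z => partials (map (@lshift (1 + m) m) (map (@rshift 1 m) s)) kernb
                (row_mx (row_mx (const_mx e) y) z)).
Proof.
move=> e01; rewrite (_ : reg e = fun y => g (row_mx (const_mx e) y)); last first.
  by apply/funext => q; exact: reg_row.
by rewrite partials_slice_r (distr_param_partials cu oU1 _ (U1_row y e01) kern_smooth).
Qed.

Lemma reg_moderate s (M : R) : exists N : nat, forall e y, 0 < e < 1 -> `|y| <= M ->
  cmod (partials s (reg e) y) <= N%:R * e^-1 ^+ N.
Proof.
have [M' [k [B [M'0 uB]]]] := distr_bound cu.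
pose r := Num.max (Num.max 1 M) M'.
pose S (q : R) := [set w : W | `|w| <= q].
have HS (q : R) w : S q w -> `|w| <= q by [].
have [kr ki] := kern_M b rho_schwartz HS.
pose s' := map (@lshift (1 + m) m) (map (@rshift 1 m) s).
have [t N N' NN HN e y z e01 yM zM|t|N NP] := @seq_bound_ex m k (fun t N =>
    forall e y z, 0 < e < 1 -> `|y| <= M -> `|z| <= M' ->
    cmod (partials (map (@rshift (1 + m) m) t ++ s') kernb
      (row_mx (row_mx (const_mx e) y) z)) <= N%:R * e^-1 ^+ N).
- have /andP[e0 e1] := e01.
  rewrite (le_trans (HN _ _ _ e01 yM zM))// ler_pM ?exprn_ge0 ?invr_ge0 ?(ltW e0) ?ler_nat//.
  by rewrite ler_weXn2l// invf_ge1// ltW.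
- have [C [L [C0 CP]]] := (kr (map (@rshift (1 + m) m) t ++ s')).2 r.
  have [D [L' [D0 DP]]] := (ki (map (@rshift (1 + m) m) t ++ s')).2 r.
  have [N CN] := real_nat_bound (C + D).
  exists (maxn N (maxn L L')) => e y z e01 yM zM; have /andP[e0 e1] := e01.
  set w := row_mx _ z.
  have Uw : Ukern w by rewrite /Ukern /= row_mxKl; exact: U1_row.
  have Sw : S r w.
    rewrite /S /= !row_mx_norm const_norm (gtr0_norm e0) !ge_max /r.
    by rewrite !le_max (ltW e1) yM zM !orbT.
  have we : wt w = e^-1 by rewrite /wt /eco !row_mxKl mxE.
  have h1 := CP w Uw Sw; have h2 := DP w Uw Sw; rewrite we in h1 h2.
  rewrite (le_trans (cmod_le_ReIm _))// Re_partials Im_partials.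
  rewrite (le_trans (lerD h1 h2))//.
  have ei1 : 1 <= e^-1 by rewrite invf_ge1// ltW.
  have ge0 k' : 0 <= e^-1 ^+ k' by rewrite exprn_ge0// invr_ge0 ltW.
  apply: (@le_trans _ _ ((C + D) * e^-1 ^+ maxn N (maxn L L'))).
    rewrite mulrDl lerD// ler_wpM2l// ler_weXn2l//.
      by rewrite leq_max leq_maxl orbT.
    by rewrite leq_max leq_maxr orbT.
  rewrite ler_wpM2r// (le_trans CN)// ler_nat leq_maxl//.
exists (B * N + N)%N => e y e01 yM; have /andP[e0 e1] := e01.
rewrite (reg_partials _ _ e01).
have ei1 : 1 <= e^-1 by rewrite invf_ge1// ltW.
have ge0 k' : 0 <= e^-1 ^+ k' by rewrite exprn_ge0// invr_ge0 ltW.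
apply: (@le_trans _ _ (B%:R * (N%:R * e^-1 ^+ N))).
  apply: uB.
  - exact: (smooth_row_r (U1_row y e01) (smooth_partials s' kern_smooth)).
  - by rewrite mulr_ge0.
  - move=> t z tk zM'; rewrite (partials_slice_r (partials s' kernb)).
    by rewrite -cpartials_cat; exact: NP.
rewrite mulrA -natrM ler_pM// ?ler_nat ?leq_addr// ler_weXn2l// leq_addl//.
Qed.

Lemma reg_is_moderate : moderate setT reg.
Proof. by apply: moderate_estimate; [exact: reg_smooth_net|exact: reg_moderate]. Qed.

End regularization.

Section off_support.
Context {R : realType} {n : nat}.
Local Notation m := (n + n + 1)%N.
Local Notation H := 'rV[R]_m.
Local Notation W := 'rV[R]_((1 + m) + m).
Variable rho : H -> R[i].
Hypothesis rho_schwartz : schwartz rho.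
Variable u : (H -> R[i]) -> R[i].
Hypothesis cu : compact_distribution u.

Lemma mollify_smooth e : smooth setT (mollify rho e).
Proof.
apply: (smoothZ _ openT); apply: (smooth_comp openT rho_schwartz.1) => j.
apply: (rsmooth_eq openT _ (smM_r openT (rsmooth_cst e^-1 openT) (rsmooth_coord j openT))) => x _.
by rewrite mxE.
Qed.

Lemma rsmooth_opp_coord N (f : 'rV[R]_N -> H) :
  (forall k, rsmooth setT (fun w => f w 0 k)) ->
  forall k, rsmooth setT (fun w => hinv (f w) 0 k).
Proof.
move=> sf k.
apply: (rsmooth_eq openT _ (smM_r openT (rsmooth_cst (-1) openT) (sf k))) => w _.
by rewrite mulN1r mxE.
Qed.

Lemma rsmooth_hmul N (f g : 'rV[R]_N -> H) :
  (forall k, rsmooth setT (fun w => f w 0 k)) ->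
  (forall k, rsmooth setT (fun w => g w 0 k)) ->
  forall k, rsmooth setT (fun w => hmul (f w) (g w) 0 k).
Proof.
move=> sf sg k; apply/rsmoothE.
by apply: (sm_hmul openT (growthT setT)) => // j; exact/rsmoothE.
Qed.

Lemma mollify_quo_smooth e y : smooth setT (fun z => mollify rho e (hmul y (hinv z))).
Proof.
apply: (smooth_comp openT (mollify_smooth e)); apply: rsmooth_hmul => k.
  exact: rsmooth_cst openT.
by apply: rsmooth_opp_coord => j; exact: rsmooth_coord openT.
Qed.

(** A cutoff near x0 does not change the value of u, and leaves only the part of
    the kernel away from the diagonal. *)
Lemma reg_off_support (V : set H) x0 : open V -> V x0 ->
  (forall f, test_function f -> fsupp f `<=` V -> u f = 0) ->
  exists2 d : R, 0 < d & forall N : nat, exists C : nat, forall e y, 0 < e < 1 ->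
    `|y - x0| <= d -> cmod (hconvD (mollify rho e) u y) <= C%:R * e ^+ N.
Proof.
move=> oV Vx0 uV; have [D D0 DV] := (nbhs_normP _ _).1 (open_nbhs_nbhs (conj oV Vx0)).
have {}D0 : 0 < D by [].
pose d := D / 3; have d0 : 0 < d by rewrite divr_gt0.
have {}DV : cbox x0 (d + d) `<=` V.
  by move=> x xd; apply: DV; rewrite /ball_ /= distrC (le_lt_trans xd)// /d; lra.
have [psi [spsi psi1 psi0]] := plateau x0 d0.
exists (d / 2); first by rewrite divr_gt0.
have [M' [k [B [M'0 uB]]]] := distr_bound cu.
(* on S the points y and z stay at distance d / 2 of each other *)
pose S (q : R) := [set w : W | [/\ `|w| <= q, `|yco w - x0| <= d / 2 & d <= `|zco w - x0|]].
have HS (q : R) w : S q w -> `|w| <= q by case.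
have sep r : exists2 c : R, 0 < c & forall w, S r w -> c <= `|quo true (yco w) (zco w)|.
  have [r0|r0] := ltP r 0.
    exists 1 => // w [wr _ _]; exfalso.
    by have := le_lt_trans wr r0; rewrite normr_lt0.
  have c0 : 0 < 1 + n%:R * r by rewrite ltr_wpDr// mulr_ge0.
  exists (d / 2 / (1 + n%:R * r)); first by rewrite !divr_gt0.
  move=> w [wr yd zd]; rewrite ler_pdivrMr//.
  have zr : `|zco w| <= r.
    by rewrite (le_trans _ wr)// -{2}(hsubmxK w) row_mx_norm le_max lexx orbT.
  have h := hmul_near (hmul (yco w) (hinv (zco w))) (zco w).
  rewrite hquoK in h; rewrite [X in _ <= X]mulrC.
  apply: (@le_trans _ _ `|yco w - zco w|).
    have := ler_normD (yco w - x0) (zco w - yco w).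
    have := distrC (yco w) (zco w) => ->.
    rewrite (_ : yco w - x0 + _ = zco w - x0); last by rewrite addrC addrA subrK.
    by move=> ?; lra.
  by rewrite (le_trans h)// ler_wpM2r// lerD2l ler_wpM2l.
have [kr ki] := kern_N rho_schwartz HS sep.
have oU := @open_Ukern R n.
have wt1 := @wt_ge1 R n S.
pose r := Num.max (Num.max 1 (`|x0| + d / 2)) M'.
have sq : sm (@Ukern R n) (wmoderate (@Ukern R n) S (@wt R n)) (fun w => 1 - psi (zco w)).
  apply: (rsmooth_M HS).
  apply: (rsmooth_eq openT _ (smD_r openT (rsmooth_cst 1 openT) (smM_r openT (rsmooth_cst (-1) openT)
    (rsmooth_comp openT spsi (fun j => @rsmooth_rsub R _ _ j))))) => w _.
  by rewrite mulN1r.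
have gN := wrapid_growth wt1.
have kr' := smM oU gN (wrapidM wt1) kr sq.
have ki' := smM oU gN (wrapidM wt1) ki sq.
(* the part of the kernel that lies away from the diagonal when y is near x0 *)
pose K2 (w : W) : R[i] := kern rho true w * (1 - psi (zco w))%:C.
have K2r : re_fun K2 = fun w => re_fun (kern rho true) w * (1 - psi (zco w)).
  by apply/funext => w; rewrite /K2 /re_fun mulrC ReZ mulrC.
have K2i : im_fun K2 = fun w => im_fun (kern rho true) w * (1 - psi (zco w)).
  by apply/funext => w; rewrite /K2 /im_fun mulrC ImZ mulrC.
have sK2 : smooth (@Ukern R n) K2.
  apply/smoothP; split; [rewrite K2r; exact: sm_rsmooth kr'|rewrite K2i; exact: sm_rsmooth ki'].
move=> N.
have [t C C' CC HC e y z e01 yM zM|t|C CP] := @seq_bound_ex m k (fun t C =>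
    forall e y z, 0 < e < 1 -> `|y - x0| <= d / 2 -> `|z| <= M' ->
    cmod (partials t (fun z => K2 (row_mx (row_mx (const_mx e) y) z)) z) <= C%:R * e ^+ N).
- have /andP[e0 e1] := e01.
  by rewrite (le_trans (HC _ _ _ e01 yM zM))// ler_wpM2r ?exprn_ge0 ?(ltW e0) ?ler_nat.
- pose s := map (@rshift (1 + m) m) t.
  have [C1 [C10 C1P]] := (kr' s).2 r N; have [C2 [C20 C2P]] := (ki' s).2 r N.
  have [C CC] := real_nat_bound (C1 + C2); exists C => e y z e01 yd zM.
  have /andP[e0 e1] := e01; have eN0 : 0 < e ^+ N by rewrite exprn_gt0.
  have [zd|zd] := ltP `|z - x0| d.
    rewrite (_ : partials t _ z = 0) ?cmod0 ?mulr_ge0 ?(ltW eN0)//.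
    rewrite -[RHS](partials_cst0 t z).
    apply: (@cpartials_local _ _ [set z | `|z - x0| < d]) => //.
      rewrite (_ : [set z | _] = ball_ Num.norm x0 d).
        by rewrite ball_normE; exact: ball_open.
      by apply/seteqP; split=> q; rewrite /ball_ /= distrC.
    move=> q qd; rewrite /K2 /zco row_mxKr psi1; last exact: ltW.
    by rewrite subrr; exact: mulr0.
  rewrite partials_slice_r -/s; set w := row_mx _ z.
  have Uw : Ukern w by rewrite /Ukern /= row_mxKl; exact: U1_row.
  have yr : `|y| <= `|x0| + d / 2.
    by rewrite -[y](subrK x0) (le_trans (ler_normD _ _))// addrC lerD2l.
  have Sw : S r w.
    split; rewrite ?row_mx_norm ?const_norm ?(gtr0_norm e0) ?ge_max /yco /zco ?row_mxKl ?row_mxKr//.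
    by rewrite /r !le_max (ltW e1) yr zM !orbT.
  have we : wt w = e^-1 by rewrite /wt /eco !row_mxKl mxE.
  have h1 := C1P w Uw Sw; have h2 := C2P w Uw Sw.
  rewrite we exprVn ler_pdivrMr// in h1; rewrite we exprVn ler_pdivrMr// in h2.
  rewrite (le_trans (cmod_le_ReIm _))// Re_partials Im_partials.
  rewrite -[fun y => complex.Re _]/(re_fun K2) -[fun y => complex.Im _]/(im_fun K2) K2r K2i.
  by rewrite (le_trans (lerD h1 h2))// -mulrDl ler_wpM2r// ltW.
exists (B * C)%N => e y e01 yd; have /andP[e0 e1] := e01.
pose g z := mollify rho e (hmul y (hinv z)).
have sg : smooth setT g by exact: mollify_quo_smooth.
have schi : smooth setT (fun z => (psi z)%:C) by exact: smooth_real openT spsi.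
have schi1 : smooth setT (fun z => K2 (row_mx (row_mx (const_mx e) y) z)).
  exact: (smooth_row_r (U1_row y e01) sK2).
have sgchi := smoothM openT sg schi.
have tgchi : fsupp (fun z => g z * (psi z)%:C) `<=` cbox x0 (d + d).
  rewrite [X in _ `<=` X]((closure_id _).1 (@closed_cbox _ _ x0 (d + d))).
  apply: closure_subset => z /= gz; rewrite /cbox /= leNgt; apply/negP => zd.
  by move/eqP: gz; apply; rewrite psi0 ?(ltW zd)//; exact: mulr0.
have -> : hconvD (mollify rho e) u y = u (fun z => K2 (row_mx (row_mx (const_mx e) y) z)).
  rewrite /hconvD -/g (_ : g = fun z => g z * (psi z)%:C + K2 (row_mx (row_mx (const_mx e) y) z)); last first.
    apply/funext => z; rewrite /K2 kern_row /quo /zco row_mxKr -/(g z) -mulrDr.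
    by rewrite -rmorphD /= addrC subrK mulr1.
  rewrite (distrD cu sgchi schi1) [X in X + _]uV ?add0r//; last first.
    exact: subset_trans tgchi DV.
  split=> //; apply: subclosed_compact tgchi; last exact: compact_cbox.
  exact: closed_closure.
rewrite natrM -mulrA; apply: uB => //.
  by rewrite mulr_ge0// exprn_ge0// ltW.
by move=> s z sk zM; apply: CP.
Qed.

End off_support.

(** * Slowly growing functions and mollifiers with vanishing moments *)

Section slow_growth.
Context {R : realType} (N : nat).

(** The index set of the regions is a point: the bound holds on the whole space. *)
Definition slow : set ('rV[R]_N -> R) :=
  wmoderate setT (fun _ : unit => setT) (fun z => 1 + `|z|).

Lemma slow_growth : growth setT slow.
Proof. by apply: wmoderate_growth => _ z _ _; rewrite lerDl. Qed.

Lemma slowM f g : slow f -> slow g -> slow (fun z => f z * g z).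
Proof. exact: wmoderateM. Qed.

Lemma slow_cst c : slow (fun=> c).
Proof. exact: wmoderate_cst. Qed.

Lemma slow_coord i : slow (fun z => z 0 i).
Proof.
move=> _; exists 1, 1%N; split=> // z _ _.
by rewrite mul1r expr1 (le_trans (ler_coord_norm z i))// lerDr.
Qed.

Lemma sm_slow_coord i : sm setT slow (fun z => z 0 i).
Proof. exact: (sm_coord openT slow_growth (@slow_coord i) (@slow_cst 1)). Qed.

Lemma slow_nat f : slow f -> exists L : nat, forall z, `|f z| <= L%:R * (1 + `|z|) ^+ L.
Proof.
move=> /(_ tt)[C [L [C0 CP]]]; have [M CM] := real_nat_bound C.
exists (M + L)%N => z; rewrite (le_trans (CP z I I))// ler_pM ?exprn_ge0//.
  by rewrite (le_trans CM)// ler_nat leq_addr.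
by rewrite ler_weXn2l ?lerDl// leq_addl.
Qed.

Lemma slow_test k (f : 'rV[R]_k -> R) (Phi : 'rV[R]_N -> 'rV[R]_k) : rsmooth setT f ->
  (exists M : R, forall x, M <= `|x| -> f x = 0) ->
  (forall j, sm setT slow (fun z => Phi z 0 j)) -> sm setT slow (fun z => f (Phi z)).
Proof.
move=> sf [M f0] sPhi; apply: (sm_comp openT slow_growth slowM (bd2 := slow)) sPhi.
  by move=> s x; exact: sf.
move=> s; apply: wmoderate_bounded => _.
have [x _|C C0 CP] := compact_bounded_fun (@compact_cbox R _ 0 M) (f := rpartials s f).
  by apply: differentiable_continuous; exact: sf.
exists C => // z _ _; have [zM|Mz] := leP `|Phi z| M.
  by apply: CP; rewrite /cbox /= subr0.
rewrite (_ : rpartials s f (Phi z) = 0) ?normr0//.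
have oM : open [set x : 'rV[R]_k | M < `|x|].
  by apply: open_comp (@open_gt R M) => x _; exact: norm_continuous.
rewrite (@partials_local _ _ _ s f (fun=> 0) oM)//.
  elim: s {Mz CP} (Phi z) => //= i s IH x.
  by rewrite (_ : rpartials s _ = fun=> 0) ?/rpartial ?derive_cst//; apply/funext.
by move=> x Mx; exact/f0/ltW.
Qed.

End slow_growth.

Section expansion.
Context {R : realType} {m : nat}.
Local Notation H := 'rV[R]_m.
Implicit Types (g F : 'rV[R]_(m + m) -> R) (q p : H).

(** The k-th derivative of g in the direction (q, 0), written out as a polynomial in
    q so that the moment conditions can be applied to it. *)
Fixpoint dirder k g q (z : 'rV[R]_(m + m)) : R :=
  if k is k'.+1 then \sum_i q 0 i * dirder k' (rpartial (lshift m i) g) q z else g z.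

Lemma line_row (t : R) q p : row_mx (t *: q) p = row_mx 0 p + t *: row_mx q 0.
Proof. by rewrite scale_row_mx add_row_mx add0r scaler0 addr0. Qed.

Lemma dirder_derive k g q p (t : R) : rsmooth setT g ->
  is_derive t 1 (fun t => dirder k g q (row_mx (t *: q) p))
    (dirder k.+1 g q (row_mx (t *: q) p)).
Proof.
elim: k g => [|k IH] g sg /=.
  have := is_derive_line (v := row_mx q 0) (t := t) (rsmooth_diff sg I : differentiable g (row_mx 0 p + t *: row_mx q 0)).
  rewrite derive_partials; last exact: (rsmooth_diff sg I).
  rewrite -line_row big_split_ord /= [X in _ + X]big1 ?addr0; last first.
    by move=> i _; rewrite row_mxEr mxE mul0r.
  under eq_bigr do rewrite row_mxEl.
  by rewrite (_ : (fun t => g (row_mx 0 p + _)) = fun t => g (row_mx (t *: q) p))//;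
    apply/funext => x; rewrite line_row.
have D i := is_deriveZ (q 0 i) (IH (rpartial (lshift m i) g) (rsmooth_partial (lshift m i) sg)).
rewrite (_ : (fun t => _) = \sum_i (q 0 i \*: (fun t => dirder k (rpartial (lshift m i) g) q (row_mx (t *: q) p)))).
  exact: is_derive_sum D.
by apply/funext => x; rewrite fct_sumE.
Qed.

Lemma dirder_bound k g : sm setT (@slow R _) g -> exists L : nat, forall q z,
  `|dirder k g q z| <= L%:R * ((1 + `|q|) * (1 + `|z|)) ^+ L.
Proof.
elim: k g => [|k IH] g sg /=.
  have [L LP] := slow_nat (sg [::]).2; exists L => q z.
  rewrite (le_trans (LP z))// ler_wpM2l// lerXn2r ?nnegrE ?mulr_ge0 ?addr_ge0//.
  by rewrite ler_peMl ?addr_ge0// lerDl.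
have /choice[L LP] i := IH _ (sm_partial (lshift m i) sg).
exists (\sum_i L i).+1 => q z; set w := (1 + `|q|) * (1 + `|z|); have w1 : 1 <= w.
  by rewrite /w mulr_ege1 ?lerDl.
have w0 : 0 <= w := le_trans ler01 w1.
rewrite (le_trans (ler_norm_sum _ _ _))// -natr1 mulrDl natr_sum mulr_suml.
apply: (@le_trans _ _ (\sum_i (L i)%:R * w ^+ (\sum_i L i).+1)); last first.
  by rewrite lerDl mul1r exprn_ge0.
apply: ler_sum => i _; rewrite normrM exprS mulrCA.
rewrite ler_pM//; last 1 first.
  rewrite (le_trans (LP i q z))// ler_wpM2l// ler_weXn2l//.
  by rewrite (bigD1 i)//= leq_addr.
rewrite (le_trans (ler_coord_norm q i))// (@le_trans _ _ ((1 + `|q|) * 1))//.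
  by rewrite mulr1 lerDr.
by rewrite ler_wpM2l ?addr_ge0// lerDl.
Qed.

Lemma rsmooth_continuous (h : H -> R) : rsmooth setT h -> continuous h.
Proof. by move=> sh q; apply: differentiable_continuous; exact: (sh [::] q I). Qed.

Lemma dirder_rsmooth k g z : rsmooth setT (fun q => dirder k g q z).
Proof.
elim: k g => [|k IH] g /=; first exact: rsmooth_cst openT.
apply: (@rsmooth_sum _ _ _ _ _ (fun i q => q 0 i * dirder k (rpartial (lshift m i) g) q z) openT) => i.
exact: (smM_r openT (rsmooth_coord i openT) (IH _)).
Qed.

Variable r : H -> R.
Hypothesis r_cont : continuous r.
Hypothesis r_rapid : forall L, exists2 C : R, 0 <= C & forall x, `|r x| * (1 + `|x|) ^+ L <= C.

(** Rapid decrease absorbs any polynomial factor. *)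
Lemma dom_rapid h (C : R) (L : nat) : continuous h ->
  (forall q, `|h q| <= C * (1 + `|q|) ^+ L) -> dom (fun q => r q * h q).
Proof.
move=> ch hC; have C0 : 0 <= C.
  by have := le_trans (normr_ge0 _) (hC 0); rewrite normr0 addr0 expr1n mulr1.
have [D D0 DP] := r_rapid (L + 2 * m); split.
  apply: (@measurable_continuous_row _ _ (fun q => r q * h q)) => q.
  by apply: continuousM; [exact: r_cont|exact: ch].
exists (C * D) => [|t]; first exact: mulr_ge0.
set q := tuple_row t; set W := oneDsqrV_prod t.
have W1 : 1 <= (1 + `|q|) ^+ (2 * m) * W.
  apply: oneDsqrV_prod_ge => // i.
  by rewrite (_ : tnth t i = q 0 i) ?ler_coord_norm// mxE.
have W0 : 0 <= W := oneDsqrV_prod_ge0 t.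
rewrite normrM (@le_trans _ _ (`|r q| * (C * (1 + `|q|) ^+ L) * ((1 + `|q|) ^+ (2 * m) * W)))//.
  rewrite -[leLHS]mulr1 ler_pM ?mulr_ge0//.
  by rewrite ler_wpM2l.
rewrite [leLHS](_ : _ = C * (`|r q| * (1 + `|q|) ^+ (L + 2 * m)) * W); last first.
  by rewrite exprD -!mulrA mulrCA.
by rewrite ler_wpM2r// ler_wpM2l.
Qed.

Lemma weight_continuous L : continuous (fun q : H => (1 + `|q|) ^+ L).
Proof.
elim: L => [|L IH] q; first exact: (@cst_continuous H R 1 q).
have -> : (fun q : H => (1 + `|q|) ^+ L.+1) = (fun q => 1 + `|q|) \* (fun q => (1 + `|q|) ^+ L).
  by apply/funext => x; rewrite exprS.
apply: continuousM; last exact: IH.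
by apply: continuousD; [exact: cst_continuous|exact: norm_continuous].
Qed.

Lemma dom_slow F e p : sm setT (@slow R _) F -> 0 < e < 1 ->
  dom (fun q => r q * F (row_mx (e *: q) p)).
Proof.
move=> sF /andP[e0 e1]; have rF : rsmooth setT F := sm_rsmooth sF.
have [L LP] := slow_nat (sF [::]).2.
apply: (@dom_rapid _ (L%:R * (1 + `|p|) ^+ L) L) => [|q].
  apply: rsmooth_continuous; apply: (rsmooth_comp openT rF); apply: (rsmooth_row_mx openT) => j.
    apply: (rsmooth_eq openT _ (smM_r openT (rsmooth_cst e openT) (rsmooth_coord j openT))) => x _.
    by rewrite mxE.
  exact: (rsmooth_cst (p 0 j) openT).
rewrite (le_trans (LP _))// -mulrA ler_wpM2l// -exprMn lerXn2r ?nnegrE ?mulr_ge0 ?addr_ge0//.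
have eq : `|e *: q| <= `|q| by rewrite normrZ gtr0_norm// ler_piMl// ltW.
have := normr_ge0 q => q0; have := normr_ge0 p => p0.
rewrite row_mx_norm; case: (leP `|e *: q| `|p|) => _; nra.
Qed.

Hypothesis r_moments : forall a : 'I_m -> nat, (exists i, a i <> 0%N) ->
  J (fun q => monomial a q * r q) = 0.

Lemma prod_monomial (l : seq 'I_m) q :
  \prod_(i <- l) q 0 i = monomial (fun i => count_mem i l) q.
Proof.
rewrite /monomial; elim: l => [|i l IH].
  by rewrite big_nil big1.
rewrite big_cons IH (bigD1 i)//= [RHS](bigD1 i)//= eqxx add1n exprS -mulrA.
congr (_ * (_ * _)); apply: eq_bigr => j ji.
by rewrite eq_sym (negbTE ji) add0n.
Qed.

Lemma prod_rsmooth (l : seq 'I_m) : rsmooth setT (fun q : H => \prod_(i <- l) q 0 i).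
Proof. by apply: (@rsmooth_prod _ _ _ _ _ (fun i q => q 0 i) openT) => i; exact: rsmooth_coord openT. Qed.

Lemma prod_bound (l : seq 'I_m) q : `|\prod_(i <- l) q 0 i| <= (1 + `|q|) ^+ size l.
Proof.
elim: l => [|i l IH]; first by rewrite big_nil normr1.
rewrite big_cons normrM exprS ler_pM// (le_trans (ler_coord_norm q i))//.
by rewrite lerDr.
Qed.

Lemma dom_dirder k g (l : seq 'I_m) z : sm setT (@slow R _) g ->
  dom (fun q => r q * (\prod_(i <- l) q 0 i * dirder k g q z)).
Proof.
move=> sg; have [L LP] := dirder_bound k sg.
apply: (@dom_rapid _ (L%:R * (1 + `|z|) ^+ L) (size l + L)) => [|q].
  exact: (rsmooth_continuous (smM_r openT (prod_rsmooth l) (dirder_rsmooth k g z))).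
rewrite normrM exprD mulrCA ler_pM ?prod_bound//.
by rewrite (le_trans (LP q z))// exprMn [_ ^+ L * _ ^+ L]mulrC mulrA.
Qed.

(** The k-th term of the Taylor expansion is a combination of nonconstant monomials
    in q.  The factor indexed by l collects the coordinates produced by the
    induction. *)
Lemma dirder_moment k g (l : seq 'I_m) z : sm setT (@slow R _) g ->
  (l != [::]) || (0 < k)%N ->
  J (fun q => r q * (\prod_(i <- l) q 0 i * dirder k g q z)) = 0.
Proof.
elim: k g l => [|k IH] g l sg; rewrite ?orbF ?orbT => lk /=.
  transitivity (g z * J (fun q => monomial (fun i => count_mem i l) q * r q)); last first.
    rewrite r_moments ?mulr0//; case: l lk => // i l _; exists i.
    by rewrite /= eqxx.
  rewrite -JZ; last first.
    apply: dom_eq (@dom_rapid _ 1 (size l) (rsmooth_continuous (prod_rsmooth l)) _) => q.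
      by rewrite prod_monomial mulrC.
    by rewrite mul1r prod_bound.
  by apply: J_eq => q; rewrite prod_monomial; ring.
transitivity (\sum_i J (fun q => r q * (\prod_(j <- i :: l) q 0 j *
    dirder k (rpartial (lshift m i) g) q z))).
  rewrite /J -Itup_sum; last first.
    by move=> i; exact: (dom_dirder k (i :: l) z (sm_partial (lshift m i) sg)).
  congr Itup; apply/funext => t; rewrite mulrA mulr_sumr; apply: eq_bigr => i _.
  by rewrite big_cons; ring.
by rewrite big1// => i _; apply: IH => //; exact: sm_partial.
Qed.

(** Taylor expansion in e up to order N + 1: the moment conditions kill all terms but
    the first, and the remainder grows at most polynomially in q, which the decay
    of r absorbs. *)
Lemma moment_expansion F (M : R) (N : nat) : sm setT (@slow R _) F ->
  exists2 C : R, 0 <= C & forall e p, 0 < e < 1 -> `|p| <= M ->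
  `|J (fun q => r q * F (row_mx (e *: q) p)) - F (row_mx 0 p) * J r| <= C * e ^+ N.
Proof.
move=> sF; have rF : rsmooth setT F := sm_rsmooth sF.
have [L LP] := dirder_bound N.+1 sF.
have [M0|M0] := ltP M 0.
  by exists 0 => // e p _ /le_lt_trans/(_ M0); rewrite normr_lt0.
pose D : R := L%:R * (1 + M) ^+ L; have D0 : 0 <= D by rewrite mulr_ge0// exprn_ge0// addr_ge0.
pose h q : R := (1 + `|q : H|) ^+ (L + L).
have dh : dom (fun q => `|r q| * h q).
  have [dr [C C0 CP]] : dom (fun q => r q * h q).
    have hb q : `|(1 + `|q : H|) ^+ (L + L)| <= 1 * (1 + `|q|) ^+ (L + L) :> R.
      by rewrite mul1r ger0_norm// exprn_ge0// addr_ge0.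
    exact: (dom_rapid (@weight_continuous (L + L)) hb).
  split; last first.
    by exists C => // t; rewrite normrM normr_id -normrM.
  apply: (eq_measurable_fun (fun t => `|r (tuple_row t) * h (tuple_row t)|)).
    by move=> t _; rewrite normrM [X in _ * X = _]ger0_norm// exprn_ge0// addr_ge0.
  exact: measurableT_comp.
exists (D * J (fun q => `|r q| * h q)).
  by rewrite mulr_ge0// J_ge0// => q; rewrite mulr_ge0// exprn_ge0// addr_ge0.
move=> e p e01 pM; have /andP[e0 e1] := e01.
pose T k q := dirder k F q (row_mx 0 p).
have dT k : dom (fun q => r q * T k q).
  by apply: dom_eq (dom_dirder k [::] (row_mx 0 p) sF) => q; rewrite big_nil mul1r.
pose Sum q := \sum_(k < N.+1) (e ^+ k / k`!%:R) * (r q * T k q).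
have dSum : dom Sum by apply: dominated_sum => k; exact: (domZ _ (dT k)).
have JSum : J Sum = F (row_mx 0 p) * J r.
  rewrite /J Itup_sum; last by move=> k; exact: (domZ _ (dT k)).
  rewrite big_ord_recl big1 ?addr0 => [|k _].
    rewrite expr0 fact0 invr1 mulr1.
    have dr : dom r.
      by apply: dom_eq (@dom_rapid (fun=> 1) 1 0 _ _) => [q||q];
        rewrite ?mulr1 ?normr1//; exact: cst_continuous.
    rewrite -[Itup _]/(J (fun q => 1 * (r q * F (row_mx 0 p)))) -[Itup _]/(J r) -JZ//.
    by apply: J_eq => q; rewrite mul1r mulrC.
  rewrite -[Itup _]/(J (fun q => (e ^+ bump 0 k / (bump 0 k)`!%:R) * (r q * T (bump 0 k) q))) JZ//.
  rewrite (_ : J _ = 0) ?mulr0//.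
  have := @dirder_moment (bump 0 k) F [::] (row_mx 0 p) sF isT.
  by under eq_fun do rewrite big_nil mul1r.
have dF := dom_slow p sF e01.
rewrite -JSum -(JB dF dSum).
have dB : dom (fun q => r q * F (row_mx (e *: q) p) - Sum q) := dominatedB dF dSum.
have dg : dom (fun q => (D * e ^+ N) * (`|r q| * h q)) by exact: domZ.
rewrite mulrAC -JZ//; apply: Itup_le => // t; set q := tuple_row t.
rewrite (_ : _ - _ = r q * (F (row_mx (e *: q) p) - \sum_(k < N.+1) T k q * (e ^+ k / k`!%:R))); last first.
  rewrite mulrBr /Sum; congr (_ - _); rewrite mulr_sumr; apply: eq_bigr => k _; ring.
rewrite normrM mulrCA ler_wpM2l//.
have phiC (t' : R) : 0 <= t' <= e -> `|dirder N.+1 F q (row_mx (t' *: q) p)| <= D * h q.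
  move=> /andP[t0 te]; rewrite (le_trans (LP _ _))// /D /h -mulrA ler_wpM2l//.
  rewrite exprD mulrA -!exprMn lerXn2r ?nnegrE ?mulr_ge0 ?addr_ge0//.
  have tq : `|t' *: q| <= `|q|.
    by rewrite normrZ ger0_norm// ler_piMl// (le_trans te)// ltW.
  rewrite mulrC ler_wpM2r ?addr_ge0//.
  have := normr_ge0 q => q0; rewrite row_mx_norm; case: (leP `|t' *: q| `|p|) => _; nra.
have := taylor_bound (phi := fun k t => dirder k F q (row_mx (t *: q) p)) (ltW e0)
  (fun k t => dirder_derive k q p t rF) phiC.
rewrite /= scale0r => /le_trans; apply.
have hq0 : 0 <= h q by rewrite exprn_ge0// addr_ge0.
rewrite [leRHS]mulrAC; apply: ler_wpM2l; first exact: mulr_ge0.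
by rewrite exprS ler_piMl ?(ltW e1)// exprn_ge0// ltW.
Qed.

End expansion.

(** * Approximation of the identity on the Heisenberg group *)

Section group_integrals.
Context {R : realType} {n : nat}.
Local Notation m := (n + n + 1)%N.
Local Notation H := 'rV[R]_m.

Lemma rsmooth_scale N (c : R) (f : 'rV[R]_N -> H) :
  (forall k, rsmooth setT (fun w => f w 0 k)) ->
  forall k, rsmooth setT (fun w => (c *: f w) 0 k).
Proof.
move=> sf k; apply: (rsmooth_eq openT _ (smM_r openT (rsmooth_cst c openT) (sf k))) => w _.
by rewrite mxE.
Qed.

(** The integrand has bounded support, because Psi is proper. *)
Lemma cdom_proper (h f : H -> R[i]) (Psi : H -> H) : smooth setT h -> test_function f ->
  (forall j, rsmooth setT (fun q => Psi q 0 j)) ->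
  (forall M : R, 0 < M -> exists2 M' : R, 0 <= M' & forall q, `|Psi q| < M -> `|q| <= M') ->
  cdom (fun q => h q * f (Psi q)).
Proof.
move=> sh tf sPsi pPsi; have [M M0 f0] := test_support tf.
have [M' M'0 M'P] := pPsi _ M0.
apply: (cdom_compact (smoothM openT sh (smooth_comp openT tf.1 sPsi)) M'0) => q qM.
rewrite f0 ?mulr0// leNgt; apply/negP => /M'P.
by rewrite leNgt qM.
Qed.

Lemma integralRm_quo_r p (f : H -> R[i]) : cdom f ->
  integralRm (fun r => f (hmul p (hinv r))) = integralRm f.
Proof.
move=> [df dg]; apply: complex_ext; rewrite ?Re_integral ?Im_integral.
  exact: (J_quo_r p df).
exact: (J_quo_r p dg).
Qed.

Lemma integralRm_quo_l r (f : H -> R[i]) : cdom f ->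
  integralRm (fun p => f (hmul p (hinv r))) = integralRm f.
Proof.
move=> [df dg]; apply: complex_ext; rewrite ?Re_integral ?Im_integral.
  exact: (J_quo_l r df).
exact: (J_quo_l r dg).
Qed.

Lemma integralRm_dilation (e : R) (f g : H -> R[i]) : 0 < e -> cdom f -> cdom g ->
  (forall q, g q = (e ^- (2 * n + 1))%:C * f (e^-1 *: q)) -> integralRm g = integralRm f.
Proof.
move=> e0 [df1 df2] [dg1 dg2] gf.
have c0 : e ^+ (2 * n + 1) != 0 by rewrite expf_neq0// gt_eqF.
have Eg1 q : re_fun g q = e ^- (2 * n + 1) * re_fun f (e^-1 *: q).
  by rewrite /re_fun gf ReZ.
have Eg2 q : im_fun g q = e ^- (2 * n + 1) * im_fun f (e^-1 *: q).
  by rewrite /im_fun gf ImZ.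
apply: complex_ext; rewrite ?Re_integral ?Im_integral.
  rewrite -(J_dilation e0 df1); first exact: J_eq.
  apply: dom_eq (domZ (e ^+ (2 * n + 1)) dg1) => q.
  by rewrite Eg1 mulrA divff// mul1r.
rewrite -(J_dilation e0 df2); first exact: J_eq.
apply: dom_eq (domZ (e ^+ (2 * n + 1)) dg2) => q.
by rewrite Eg2 mulrA divff// mul1r.
Qed.

Lemma hquo_hinvK (q p : H) : hmul p (hinv (hmul (hinv q) p)) = q.
Proof.
rewrite hquoE hmulE /hinv !omegaD omegaN omegaZ omega_et omegapp mulr0 !addr0.
rewrite omegaNl (omegaC q p).
by apply/rowP => i; rewrite !mxE; ring.
Qed.

Lemma hmulK (q r : H) : hmul (hmul q r) (hinv r) = q.
Proof.
rewrite hquoE hmulE [omega (_ + _) r]omegaC !omegaD omegaZ omega_et omegapp (omegaC r q).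
by apply/rowP => i; rewrite !mxE; ring.
Qed.

(** Boundedness of a product and of one factor bounds the other factor. *)
Lemma proper_left c (p : H) (M : R) : 0 < c -> 0 < M ->
  exists2 M' : R, 0 <= M' & forall q, `|hmul (hinv (c *: q)) p| < M -> `|q| <= M'.
Proof.
move=> c0 M0; have K0 : 0 <= M + (1 + n%:R * M) * `|p|.
  by rewrite addr_ge0 ?mulr_ge0 ?addr_ge0 ?mulr_ge0 ?(ltW M0).
exists ((M + (1 + n%:R * M) * `|p|) / c) => [|q qM]; first by rewrite divr_ge0// ltW.
rewrite ler_pdivlMr// mulrC -[X in X * _](gtr0_norm c0) -normrZ.
rewrite -[c *: q](hquo_hinvK _ p) (le_trans (hmul_norm _ _))// hinv_norm.
by rewrite lerD ?(ltW qM)// ler_wpM2r// lerD2l ler_wpM2l// ltW.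
Qed.

Lemma proper_right c (r : H) (M : R) : 0 < c -> 0 < M ->
  exists2 M' : R, 0 <= M' & forall q, `|hmul (c *: q) r| < M -> `|q| <= M'.
Proof.
move=> c0 M0; exists ((`|r| + (1 + n%:R * `|r|) * M) / c) => [|q qM].
  by rewrite divr_ge0 ?(ltW c0)// addr_ge0 ?mulr_ge0 ?addr_ge0 ?mulr_ge0 ?(ltW M0).
rewrite ler_pdivlMr// mulrC -[X in X * _](gtr0_norm c0) -normrZ.
rewrite -[c *: q](hmulK _ r) (le_trans (hmul_norm _ _))// hinv_norm.
by rewrite lerD2l ler_wpM2l ?(ltW qM)// addr_ge0 ?mulr_ge0.
Qed.

End group_integrals.

Section approximation.
Context {R : realType} {n : nat}.
Local Notation m := (n + n + 1)%N.
Local Notation H := 'rV[R]_m.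
Variable rho : H -> R[i].
Hypothesis rho_schwartz : schwartz rho.
Variable f : H -> R[i].
Hypothesis tf : test_function f.

Let srho : smooth setT rho := rho_schwartz.1.

Lemma left_rsmooth c (p : H) j : rsmooth setT (fun q : H => hmul (hinv (c *: q)) p 0 j).
Proof.
apply: rsmooth_hmul => k; last exact: (rsmooth_cst _ openT).
by apply: rsmooth_opp_coord => l; apply: rsmooth_scale => i; exact: rsmooth_coord openT.
Qed.

Lemma right_rsmooth c (r : H) j : rsmooth setT (fun q : H => hmul (c *: q) r 0 j).
Proof.
apply: rsmooth_hmul => k; last exact: (rsmooth_cst _ openT).
by apply: rsmooth_scale => i; exact: rsmooth_coord openT.
Qed.

Lemma cdom_left (h : H -> R[i]) c p : 0 < c -> smooth setT h ->
  cdom (fun q => h q * f (hmul (hinv (c *: q)) p)).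
Proof.
move=> c0 sh; apply: (@cdom_proper _ _ _ _ (fun q => hmul (hinv (c *: q)) p)) => //.
  exact: left_rsmooth.
by move=> M M0; exact: proper_left.
Qed.

Lemma cdom_right (h : H -> R[i]) c r : 0 < c -> smooth setT h ->
  cdom (fun q => h q * f (hmul (c *: q) r)).
Proof.
move=> c0 sh; apply: (@cdom_proper _ _ _ _ (fun q => hmul (c *: q) r)) => //.
  exact: right_rsmooth.
by move=> M M0; exact: proper_right.
Qed.

(** Substitution of e q for q. *)
Lemma hconv_dilation e p : 0 < e ->
  hconv (mollify rho e) f p = integralRm (fun q => rho q * f (hmul (hinv (e *: q)) p)).
Proof.
move=> e0; have c1 := cdom_left p e0 srho.
have := cdom_left p ltr01 (mollify_smooth rho_schwartz e).
under eq_fun do rewrite scale1r; move=> c2.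
apply: (integralRm_dilation e0 c1 c2) => q.
by rewrite /mollify scalerA divff ?gt_eqF// scale1r mulrA.
Qed.

(** Substitution of p r^-1 for q. *)
Lemma hconv_pairing e p :
  hconv (mollify rho e) f p =
  hconvD (mollify rho e) (fun g => integralRm (fun r => g r * f r)) p.
Proof.
have := cdom_left p ltr01 (mollify_smooth rho_schwartz e).
under eq_fun do rewrite scale1r; move=> c2.
rewrite /hconv -(integralRm_quo_r p c2) /hconvD.
by apply: integralRm_eq => r; rewrite hinv_quoK.
Qed.

(** Substitution of q r for p, then of e q for q. *)
Lemma pairing_dilation e r : 0 < e ->
  integralRm (fun p => mollify rho e (hmul p (hinv r)) * f p) =
  integralRm (fun q => rho q * f (hmul (e *: q) r)).
Proof.
move=> e0; have c1 := cdom_right r e0 srho.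
have := cdom_right r ltr01 (mollify_smooth rho_schwartz e).
under eq_fun do rewrite scale1r; move=> c2.
transitivity (integralRm (fun q => mollify rho e q * f (hmul q r))).
  by rewrite -(integralRm_quo_l r c2); apply: integralRm_eq => p; rewrite hquoK.
apply: (integralRm_dilation e0 c1 c2) => q.
by rewrite /mollify scalerA divff ?gt_eqF// scale1r mulrA.
Qed.

Hypothesis rho_int : integralRm rho = 1.
Hypothesis rho_moments : forall a : 'I_m -> nat, (exists i, a i <> 0%N) ->
  integralRm (fun x => (monomial a x)%:C * rho x) = 0.

Let re_cont : continuous (re_fun rho) := (smooth_continuous srho).1.
Let im_cont : continuous (im_fun rho) := (smooth_continuous srho).2.
Let re_rapid := re_rho_rapid rho_schwartz [::].
Let im_rapid := im_rho_rapid rho_schwartz [::].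

Let J_re : J (re_fun rho) = 1.
Proof. by rewrite -Re_integral rho_int. Qed.

Let J_im : J (im_fun rho) = 0.
Proof. by rewrite -Im_integral rho_int. Qed.

Let re_moments (a : 'I_m -> nat) : (exists i, a i <> 0%N) ->
  J (fun q => monomial a q * re_fun rho q) = 0.
Proof.
move=> /rho_moments/(congr1 (@complex.Re R)); rewrite Re_integral => E; rewrite -[RHS]E.
by apply: J_eq => q; rewrite /re_fun ReZ.
Qed.

Let im_moments (a : 'I_m -> nat) : (exists i, a i <> 0%N) ->
  J (fun q => monomial a q * im_fun rho q) = 0.
Proof.
move=> /rho_moments/(congr1 (@complex.Im R)); rewrite Im_integral => E; rewrite -[RHS]E.
by apply: J_eq => q; rewrite /im_fun ImZ.
Qed.

(** The real and imaginary parts of rho both have vanishing moments, and their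
    integrals are 1 and 0; the four products are expanded separately. *)
Lemma moment_approximation (Phi : 'rV[R]_(m + m) -> H) (M : R) (N : nat) :
  (forall j, sm setT (@slow R _) (fun z => Phi z 0 j)) ->
  (forall p, Phi (row_mx 0 p) = p) ->
  exists C : nat, forall e p, 0 < e < 1 -> `|p| <= M ->
  cmod (integralRm (fun q => rho q * f (Phi (row_mx (e *: q) p))) - f p) <= C%:R * e ^+ N.
Proof.
move=> sPhi Phi0; have /smoothP[sr si] := tf.1.
have [M' M'0 f0] := test_support tf.
have sFr : sm setT (@slow R _) (fun z => re_fun f (Phi z)).
  by apply: (slow_test sr _ sPhi); exists M' => x /f0; rewrite /re_fun => ->.
have sFi : sm setT (@slow R _) (fun z => im_fun f (Phi z)).
  by apply: (slow_test si _ sPhi); exists M' => x /f0; rewrite /im_fun => ->.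
have [C1 C10 H1] := moment_expansion re_cont re_rapid re_moments M N sFr.
have [C2 C20 H2] := moment_expansion im_cont im_rapid im_moments M N sFi.
have [C3 C30 H3] := moment_expansion re_cont re_rapid re_moments M N sFi.
have [C4 C40 H4] := moment_expansion im_cont im_rapid im_moments M N sFr.
have [C CP] := real_nat_bound (C1 + C2 + (C3 + C4)); exists C => e p e01 pM.
have /andP[e0 e1] := e01.
have d1 := dom_slow re_cont re_rapid p sFr e01.
have d2 := dom_slow im_cont im_rapid p sFi e01.
have d3 := dom_slow re_cont re_rapid p sFi e01.
have d4 := dom_slow im_cont im_rapid p sFr e01.
have h1 := H1 _ _ e01 pM; have h2 := H2 _ _ e01 pM.
have h3 := H3 _ _ e01 pM; have h4 := H4 _ _ e01 pM.
rewrite Phi0 J_re mulr1 in h1; rewrite Phi0 J_re mulr1 in h3.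
rewrite J_im mulr0 subr0 in h2; rewrite J_im mulr0 subr0 in h4.
apply: (@le_trans _ _ ((C1 + C2 + (C3 + C4)) * e ^+ N)); last first.
  by rewrite ler_wpM2r// exprn_ge0// ltW.
rewrite (le_trans (cmod_le_ReIm _))// mulrDl lerD//.
  rewrite ReD ReN Re_integral mulrDl (le_trans _ (lerD h1 h2))//.
  rewrite (_ : J _ = J (fun q => re_fun rho q * re_fun f (Phi (row_mx (e *: q) p)))
    - J (fun q => im_fun rho q * im_fun f (Phi (row_mx (e *: q) p)))).
    by rewrite addrAC (le_trans (ler_normB _ _)).
  by rewrite -(JB d1 d2); apply: J_eq => q; rewrite /re_fun ReM.
rewrite ImD ImN Im_integral mulrDl (le_trans _ (lerD h3 h4))//.
rewrite (_ : J _ = J (fun q => re_fun rho q * im_fun f (Phi (row_mx (e *: q) p)))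
  + J (fun q => im_fun rho q * re_fun f (Phi (row_mx (e *: q) p)))).
  by rewrite addrAC; exact: ler_normD.
by rewrite -(JD d3 d4); apply: J_eq => q; rewrite /im_fun ImM.
Qed.

Lemma slow_lsub j : sm setT (@slow R (m + m)) (fun z => (lsubmx z : H) 0 j).
Proof.
by apply: (sm_eq openT (@slow_growth R _) _ (sm_slow_coord (lshift m j))) => z _; rewrite mxE.
Qed.

Lemma slow_rsub j : sm setT (@slow R (m + m)) (fun z => (rsubmx z : H) 0 j).
Proof.
by apply: (sm_eq openT (@slow_growth R _) _ (sm_slow_coord (rshift m j))) => z _; rewrite mxE.
Qed.

(** Here the inner function is f ((e q)^-1 p). *)
Lemma hconv_approximation (M : R) (N : nat) : exists C : nat, forall e p, 0 < e < 1 ->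
  `|p| <= M -> cmod (hconv (mollify rho e) f p - f p) <= C%:R * e ^+ N.
Proof.
have [j|p|C CP] := @moment_approximation (fun z => hmul (hinv (lsubmx z)) (rsubmx z)) M N.
- apply: (sm_hmul openT (@slow_growth R _) (@slowM R _) (@slow_cst R _)); last exact: slow_rsub.
  move=> k; apply: (sm_eq openT (@slow_growth R _) _
    (sm_scale openT (@slow_growth R _) (@slowM R _) (@slow_cst R _) (-1) (slow_lsub k))) => z _.
  by rewrite mulN1r [RHS]mxE.
- by rewrite row_mxKl row_mxKr /hinv oppr0 hmul0p.
exists C => e p e01 pM; have /andP[e0 e1] := e01; rewrite (hconv_dilation _ e0).
rewrite (_ : integralRm _ = integralRm (fun q => rho q *
  f (hmul (hinv (lsubmx (row_mx (e *: q) p))) (rsubmx (row_mx (e *: q) p))))); first exact: CP.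
by apply: integralRm_eq => q; rewrite row_mxKl row_mxKr.
Qed.

(** Here the inner function is f ((e q) r). *)
Lemma pairing_approximation (M : R) (N : nat) : exists C : nat, forall e r, 0 < e < 1 ->
  `|r| <= M ->
  cmod (integralRm (fun p => mollify rho e (hmul p (hinv r)) * f p) - f r) <= C%:R * e ^+ N.
Proof.
have [j|p|C CP] := @moment_approximation (fun z => hmul (lsubmx z) (rsubmx z)) M N.
- apply: (sm_hmul openT (@slow_growth R _) (@slowM R _) (@slow_cst R _)) => k.
    exact: slow_lsub.
  exact: slow_rsub.
- by rewrite row_mxKl row_mxKr hmul0p.
exists C => e r e01 rM; have /andP[e0 e1] := e01; rewrite (pairing_dilation _ e0).
rewrite (_ : integralRm _ = integralRm (fun q => rho q *
  f (hmul (lsubmx (row_mx (e *: q) r)) (rsubmx (row_mx (e *: q) r))))); first exact: CP.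
by apply: integralRm_eq => q; rewrite row_mxKl row_mxKr.
Qed.

End approximation.

(** * Integral kernels *)

Section kernels.
Context {R : realType} {n : nat}.
Local Notation m := (n + n + 1)%N.
Local Notation H := 'rV[R]_m.
Local Notation W := 'rV[R]_(m + m).
Variable rho : H -> R[i].
Hypothesis rho_schwartz : schwartz rho.

Definition hkernel e (z : W) : R[i] := mollify rho e (hmul (lsubmx z) (hinv (rsubmx z))).

Lemma hkernel_conv e : conv_kernel (mollify rho e) (hkernel e).
Proof.
split=> [f p tf|u p cu].
  rewrite (hconv_pairing rho_schwartz tf).
  by apply: integralRm_eq => r; rewrite /hkernel row_mxKl row_mxKr.
rewrite /hconvD; congr u; apply/funext => r.
by rewrite /hkernel row_mxKl row_mxKr.
Qed.

Variable pi : W -> H.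
Hypothesis pi_slow : forall j, sm setT (@slow R (m + m)) (fun z => pi z 0 j).
Hypothesis pi_continuous : continuous pi.
(** Rapid decrease in the quotient p r^-1 becomes rapid decrease in z = (p, r) once
    one of the two projections, called pi, is bounded. *)
Hypothesis pi_control : forall (r0 : R), 0 <= r0 -> exists2 C : R, 0 <= C & forall z, `|pi z| <= r0 ->
  1 + `|z| <= C * (1 + `|hmul (lsubmx z) (hinv (rsubmx z))|).

Let w (z : W) : R := 1 + `|z|.
Let S (r0 : R) : set W := [set z | `|pi z| <= r0].
Let M : set (W -> R) := wmoderate setT S w.
Let N : set (W -> R) := wrapid setT S w.

Let w1 (r0 : R) z : [set: W] z -> S r0 z -> 1 <= w z.
Proof. by move=> _ _; rewrite lerDl. Qed.

Let gM : growth setT M := wmoderate_growth w1.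
Let gN : growth setT N := wrapid_growth w1.

Lemma slow_M h : sm setT (@slow R _) h -> sm setT M h.
Proof.
move=> sh; apply: (sm_sub _ _ sh) => // g sg r0; have [C [L [C0 CP]]] := sg tt.
by exists C, L; split=> // z _ _; exact: CP.
Qed.

Lemma hkernel_N e (g : H -> R) : 0 < e < 1 -> rsmooth setT g ->
  (forall s L, exists2 C : R, 0 <= C & forall x, `|rpartials s g x| * (1 + `|x|) ^+ L <= C) ->
  sm setT N (fun z => e ^- (2 * n + 1) * g (e^-1 *: hmul (lsubmx z) (hinv (rsubmx z)))).
Proof.
move=> /andP[e0 e1] sg bg.
have MM := @wmoderateM R _ _ setT S w.
have Mc := @wmoderate_cst R _ _ setT S w.
have sPsi j : sm setT M (fun z => (e^-1 *: hmul (lsubmx z) (hinv (rsubmx z))) 0 j).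
  apply: (sm_eq openT gM _ (sm_scale openT gM MM Mc e^-1 (slow_M _))).
    by move=> z _; rewrite [RHS]mxE.
  apply: (sm_hmul openT (@slow_growth R _) (@slowM R _) (@slow_cst R _)) => k; first exact: slow_lsub.
  apply: (sm_eq openT (@slow_growth R _) _
    (sm_scale openT (@slow_growth R _) (@slowM R _) (@slow_cst R _) (-1) (slow_rsub k))) => z _.
  by rewrite mulN1r [RHS]mxE.
apply: (sm_eq openT gN (f := fun z => g (e^-1 *: hmul (lsubmx z) (hinv (rsubmx z))) * e ^- (2 * n + 1))).
  by move=> z _; rewrite mulrC.
apply: (smM openT gN (wrapidM w1)); last by apply: (sm_cst openT gM); exact: Mc.
apply: (sm_comp openT gN (wrapidM w1)) sPsi => [s x|s r0 L]; first exact: sg.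
have [C0|C0] := ltP r0 0.
  by exists 0; split=> // z _ /le_lt_trans/(_ C0); rewrite normr_lt0.
have [C1 C10 C1P] := pi_control C0; have [D D0 DP] := bg s L.
exists (C1 ^+ L * D); split=> [|z _ Sz]; first by rewrite mulr_ge0// exprn_ge0.
apply: (le_trans _ (ler_wpM2l (exprn_ge0 L C10)
  (DP (e^-1 *: hmul (lsubmx z) (hinv (rsubmx z)))))).
rewrite mulrCA ler_wpM2l// -exprMn.
rewrite lerXn2r ?nnegrE ?mulr_ge0 ?addr_ge0// (le_trans (C1P _ Sz))// ler_wpM2l// lerD2l.
by rewrite normrZ ler_peMl// gtr0_norm ?invr_gt0// invf_ge1// ltW.
Qed.

Lemma hkernel_schwartz e chi : 0 < e < 1 -> test_function chi ->
  schwartz (fun z => chi (pi z) * hkernel e z).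
Proof.
move=> e01 tchi; have /smoothP[scr sci] := tchi.1; have [r0 r00 chi0] := test_support tchi.
have cM (h : H -> R) : rsmooth setT h -> (forall x, r0 <= `|x| -> h x = 0) ->
    sm setT M (fun z => h (pi z)).
  by move=> sh h0; apply: slow_M; apply: (slow_test sh _ pi_slow); exists r0.
have cr := cM _ scr (fun x xr => congr1 (@complex.Re R) (chi0 x xr)).
have ci := cM _ sci (fun x xr => congr1 (@complex.Im R) (chi0 x xr)).
have /smoothP[srr sri] := rho_schwartz.1.
have kr := hkernel_N e01 srr (re_rho_rapid rho_schwartz).
have ki := hkernel_N e01 sri (im_rho_rapid rho_schwartz).
have pr := smM openT gN (wrapidM w1).
pose F z := chi (pi z) * hkernel e z.
have Fr : sm setT N (re_fun F).
  apply: (sm_eq openT gN _ (smD openT gN (pr _ _ kr cr)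
    (pr _ _ ki (sm_scale openT gM (@wmoderateM R _ _ setT S w) (@wmoderate_cst R _ _ setT S w) (-1) ci)))) => z _.
  by rewrite /F /re_fun ReM /hkernel /mollify ReZ ImZ; ring.
have Fi : sm setT N (im_fun F).
  apply: (sm_eq openT gN _ (smD openT gN (pr _ _ ki cr) (pr _ _ kr ci))) => z _.
  by rewrite /F /im_fun ImM /hkernel /mollify ReZ ImZ; ring.
have sF : smooth setT F by apply/smoothP; split; [exact: sm_rsmooth Fr|exact: sm_rsmooth Fi].
apply: rapid_schwartz => // s L.
have [C1 [C10 H1]] := (Fr s).2 r0 L; have [C2 [C20 H2]] := (Fi s).2 r0 L.
exists (C1 + C2) => [|z]; first exact: addr_ge0.
have [zr|zr] := leP `|pi z| r0.
  have h1 := H1 z I zr; have h2 := H2 z I zr.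
  apply: (@le_trans _ _ ((`|complex.Re (partials s F z)| + `|complex.Im (partials s F z)|) * w z ^+ L)).
    by rewrite ler_wpM2r ?exprn_ge0 ?addr_ge0// cmod_le_ReIm.
  by rewrite Re_partials Im_partials mulrDl lerD.
rewrite (_ : partials s _ z = 0) ?cmod0 ?mul0r ?addr_ge0//.
have oU : open [set z | r0 < `|pi z|].
  apply: (@open_comp _ _ pi [set x | r0 < `|x|]) => [x _|]; first exact: pi_continuous.
  by apply: open_comp (@open_gt R r0) => x _; exact: norm_continuous.
rewrite -[RHS](partials_cst0 s z); apply: (cpartials_local s oU) zr => y yr.
by rewrite chi0 ?mul0r// ltW.
Qed.

End kernels.

Section localization.
Context {R : realType} {n : nat}.
Local Notation m := (n + n + 1)%N.
Local Notation H := 'rV[R]_m.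

Lemma row_control (z : 'rV[R]_(m + m)) (a c r0 : R) : 0 <= c -> `|lsubmx z| <= a ->
  `|rsubmx z| <= a -> a <= r0 + (1 + n%:R * r0) * c -> 0 <= r0 ->
  1 + `|z| <= (2 + r0 + n%:R * r0) * (1 + c).
Proof.
move=> c0 la ra ac r00; have n0 : 0 <= n%:R * r0 by rewrite mulr_ge0.
have za : `|z| <= a by rewrite -[z]hsubmxK row_mx_norm ge_max la ra.
nra.
Qed.

Lemma hkernel_localized (rho : H -> R[i]) e : schwartz rho -> 0 < e < 1 ->
  localized_schwartz (hkernel rho e).
Proof.
move=> srho e01 chi tchi; split.
  apply: (@hkernel_schwartz _ _ _ srho (fun z => lsubmx z)) => //.
  - exact: slow_lsub.
  - by move=> z; apply: differentiable_continuous; exact: differentiable_lsubmx.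
  - move=> r0 r00; exists (2 + r0 + n%:R * r0) => [|z zr].
      by rewrite !addr_ge0// mulr_ge0.
    set c := `|hmul _ _|; have c0 : 0 <= c by exact: normr_ge0.
    apply: (@row_control _ (r0 + (1 + n%:R * r0) * c)) => //.
      by rewrite (le_trans zr)// lerDl mulr_ge0// addr_ge0// mulr_ge0.
    rewrite -{1}(hinv_quoK (lsubmx z) (rsubmx z)) (le_trans (hmul_norm _ _))// hinv_norm.
    by rewrite lerD// ler_wpM2r// lerD2l ler_wpM2l.
under eq_fun do rewrite mulrC.
apply: (@hkernel_schwartz _ _ _ srho (fun z => rsubmx z)) => //.
- exact: slow_rsub.
- by move=> z; apply: differentiable_continuous; exact: differentiable_rsubmx.
- move=> r0 r00; exists (2 + r0 + n%:R * r0) => [|z zr].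
    by rewrite !addr_ge0// mulr_ge0.
  set c := `|hmul _ _|; have c0 : 0 <= c by exact: normr_ge0.
  apply: (@row_control _ (r0 + (1 + n%:R * r0) * c)) => //; last first.
    by rewrite (le_trans zr)// lerDl mulr_ge0// addr_ge0// mulr_ge0.
  rewrite -{1}(hquoK (lsubmx z) (rsubmx z)) (le_trans (hmul_norm _ _))//.
  by rewrite lerD// ler_wpM2r// lerD2l ler_wpM2l.
Qed.

End localization.

(** * Embedding of the compactly supported distributions *)

Section distributions.
Context {R : realType} {m : nat}.
Local Notation H := 'rV[R]_m.
Implicit Types u v : (H -> R[i]) -> R[i].

Lemma cmod_eq0 (z : R[i]) : cmod z = 0 -> z = 0.
Proof. exact: Normc.eq0_normc. Qed.

Lemma distr_sub u v : compact_distribution u -> compact_distribution v ->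
  compact_distribution (fun f => u f - v f).
Proof.
move=> cu cv; split=> [a f g sf sg|].
  by rewrite cu.1// cv.1//; ring.
have [M1 [k1 [B1 [M10 u1]]]] := distr_bound cu.
have [M2 [k2 [B2 [M20 v2]]]] := distr_bound cv.
exists (cbox 0 (Num.max M1 M2)), (maxn k1 k2), (B1%:R + B2%:R); split=> [|f sf].
  exact: compact_cbox.
have h s x : (size s <= maxn k1 k2)%N -> cbox 0 (Num.max M1 M2) x ->
    cmod (partials s f x) <= Cinf_norm (cbox 0 (Num.max M1 M2)) (maxn k1 k2) f.
  by move=> sk Kx; apply: (@Cinf_norm_ge _ _ setT) => //; exact: compact_cbox.
have C0 : 0 <= Cinf_norm (cbox 0 (Num.max M1 M2)) (maxn k1 k2) f := Cinf_norm_ge0 _ _ _.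
rewrite (le_trans (cmodB _ _))// mulrDl lerD//.
  apply: u1 => // s x sk xM; apply: h; first by rewrite leq_max sk.
  by rewrite /cbox /= subr0 le_max xM.
apply: v2 => // s x sk xM; apply: h; first by rewrite leq_max sk orbT.
by rewrite /cbox /= subr0 le_max xM orbT.
Qed.

(** A cutoff equal to 1 near the compact set that controls u does not change the
    values of u. *)
Lemma distr_test_eq0 u : compact_distribution u -> (forall f, test_function f -> u f = 0) ->
  forall f, smooth setT f -> u f = 0.
Proof.
move=> cu u0 f sf; have [M [k [B [M0 uB]]]] := distr_bound cu.
have M1 : 0 < M + 1 by rewrite ltr_wpDl.
have [psi [spsi psi1 psi0]] := plateau (0 : H) M1.
have sp : smooth setT (fun x => (psi x)%:C) := smooth_real openT spsi.
have sfp := smoothM openT sf sp.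
have tfp : test_function (fun x => f x * (psi x)%:C).
  split=> //; apply: (@subclosed_compact _ _ (cbox 0 (M + 1 + (M + 1)))).
  - exact: closed_closure.
  - exact: compact_cbox.
  rewrite [X in _ `<=` X]((closure_id _).1 (@closed_cbox _ _ 0 (M + 1 + (M + 1)))).
  apply: closure_subset => z /= gz; rewrite /cbox /= leNgt; apply/negP => zd.
  by move/eqP: gz; apply; rewrite psi0 ?(ltW zd)//; exact: mulr0.
have sr := smoothB openT sf sfp.
suff E : u (fun x => f x - f x * (psi x)%:C) = 0.
  by have := distrB cu sf sfp; rewrite E (u0 _ tfp) subr0 => <-.
apply: cmod_eq0; apply/eqP; rewrite eq_le cmod_ge0 andbT -(mulr0 B%:R).
apply: uB => // s x _ xM; rewrite (_ : partials s _ x = 0) ?cmod0//.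
have oU : open [set x : H | `|x| < M + 1].
  by apply: open_comp (@open_lt R (M + 1)) => y _; exact: norm_continuous.
rewrite -[RHS](partials_cst0 s x); apply: (cpartials_local s oU) => [y yM|/=].
  by rewrite psi1 ?subr0 ?ltW//; apply/eqP; rewrite subr_eq0 eq_sym; apply/eqP; exact: mulr1.
by rewrite (le_lt_trans xM)// ltrDl.
Qed.

End distributions.

Section generalized_functions.
Context {R : realType} {m : nat}.
Local Notation H := 'rV[R]_m.
Implicit Types (f g : R -> H -> R[i]) (V : set H).

Lemma negligible0 V : open V -> negligible_net V (fun _ _ => 0).
Proof.
move=> oV; apply: (negligible_estimate oV) => [|K s N _ _].
  by apply: smooth_net_const => //; exact: smooth_cst.
exists 0%N => e x /andP[e0 _] _.
by rewrite partials_cst0 cmod0 mul0r.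
Qed.

Lemma negligibleD V f g : open V -> negligible_net V f -> negligible_net V g ->
  negligible_net V (fun e x => f e x + g e x).
Proof.
move=> oV nf ng; have := negligibleB oV nf (negligibleB oV (negligible0 oV) ng).
by congr negligible_net; apply/funext => e; apply/funext => x; rewrite sub0r opprK.
Qed.

Lemma gs_class_self V f : open V -> moderate V f -> gs_class V f f.
Proof.
move=> oV mf; split=> //; have := negligible0 oV; congr negligible_net.
by apply/funext => e; apply/funext => x; rewrite subrr.
Qed.

(** Negligible nets form a group, so that a class can be tested on one
    representative. *)
Lemma gs_restrict_eq0 V f : open V -> moderate setT f ->
  gs_restrict V (gs_class setT f) = gs_zero V <-> negligible_net V f.
Proof.
move=> oV mf; have ff := gs_class_self openT mf; split=> [E|nf].
  have : gs_restrict V (gs_class setT f) f by exists f => //; exact/gs_class_self/moderateW.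
  rewrite E => -[_]; congr negligible_net.
  by apply/funext => e; apply/funext => x; rewrite subr0.
apply/seteqP; split=> g.
  move=> [h [_ nh] [mg ng]]; split=> //.
  have := negligibleD oV ng (negligibleD oV (negligibleW V nh) nf); congr negligible_net.
  by apply/funext => e; apply/funext => x; ring.
move=> [mg ng]; exists f => //; split=> //; have := negligibleB oV ng nf; congr negligible_net.
by apply/funext => e; apply/funext => x; rewrite subr0.
Qed.

End generalized_functions.

Section embedding.
Context {R : realType} {n : nat}.
Local Notation m := (n + n + 1)%N.
Local Notation H := 'rV[R]_m.
Variable rho : H -> R[i].
Hypothesis rho_schwartz : schwartz rho.
Hypothesis rho_int : integralRm rho = 1.
Hypothesis rho_moments : forall a : 'I_m -> nat, (exists i, a i <> 0%N) ->
  integralRm (fun x => (monomial a x)%:C * rho x) = 0.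

Local Notation T u e := (hconvD (mollify rho e) u).
Local Notation pairing f := (fun g => integralRm (fun p => g p * f p)).

Lemma hconvD_moderate u : compact_distribution u -> moderate setT (fun e => T u e).
Proof. exact: (reg_is_moderate true rho_schwartz). Qed.

(** The difference is moderate, and interpolation propagates smallness to all
    derivatives. *)
Lemma reg_minus_rapid b f : test_function f ->
  (forall M N, exists C : nat, forall e p, 0 < e < 1 -> `|p| <= M ->
    cmod (reg rho b (pairing f) e p - f p) <= C%:R * e ^+ N) ->
  forall s (M : R) N, exists C : nat, forall e p, 0 < e < 1 -> `|p| <= M ->
    cmod (partials s (fun p => reg rho b (pairing f) e p - f p) p) <= C%:R * e ^+ N.
Proof.
move=> tf zero s M N; have cv := test_distribution tf.
have sn := reg_smooth_net b rho_schwartz cv.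
have sreg e : 0 < e < 1 -> smooth setT (reg rho b (pairing f) e).
  exact: smooth_net_smooth.
have [e e01|s' M'|r N' _||C CP] := @interpolate_complex _ _
  (fun e p => reg rho b (pairing f) e p - f p) 0 (M + 1) _ _ _ s M N; last first.
- by exists C => e p e01 pM; apply: CP => //; rewrite subr0.
- by rewrite ltrDl.
- have [C CP] := zero r N'; exists C => e p e01 pr; apply: CP => //.
  by rewrite subr0 in pr.
- have [L LP] := reg_moderate b rho_schwartz cv s' M'.
  have [C C0 CP] := smooth_bounded (smooth_partials s' tf.1) (@compact_cbox R _ 0 M') (@subsetT _ _).
  have [L' CL] := real_nat_bound C.
  exists (L + L')%N => e p e01 pM; have /andP[e0 e1] := e01.
  have ei1 : 1 <= e^-1 by rewrite invf_ge1// ltW.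
  rewrite (partialsB s' openT (sreg e e01) tf.1 I) (le_trans (cmodB _ _))// natrD mulrDl lerD//.
    rewrite (le_trans (LP _ _ e01 pM))// ler_wpM2l// ler_weXn2l// leq_addr//.
  rewrite -[leLHS]mulr1 ler_pM ?cmod_ge0//; last by rewrite exprn_ege1.
  by rewrite (le_trans (CP p _)) ?(le_trans CL)// /cbox /= subr0.
- exact: (smoothB openT (sreg e e01) tf.1).
Qed.

Lemma hconv_negligible f : test_function f ->
  negligible_net setT (fun e p => hconv (mollify rho e) f p - f p).
Proof.
move=> tf; have cv := test_distribution tf.
have E e p : hconv (mollify rho e) f p = reg rho true (pairing f) e p.
  exact: hconv_pairing.
rewrite (_ : (fun e p => _) = fun e p => reg rho true (pairing f) e p - f p); last first.
  by apply/funext => e; apply/funext => p; rewrite E.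
apply: (negligible_estimate openT).
  apply: (smooth_netB openT (reg_smooth_net true rho_schwartz cv)).
  exact: (smooth_net_const openT tf.1).
move=> K s N cK _; have [M M0 KM] := compact_cboxP cK.
have [M' N'|C CP] := @reg_minus_rapid true f tf _ s M N; last first.
  by exists C => e p e01 /KM; rewrite /cbox /= subr0; exact: CP.
have [C CP] := hconv_approximation rho_schwartz tf rho_int rho_moments M' N'.
by exists C => e p e01 pM; rewrite -E; exact: CP.
Qed.

Lemma hkernel_smooth e : smooth setT (hkernel rho e).
Proof.
apply: (smooth_comp openT (mollify_smooth rho_schwartz e)); apply: rsmooth_hmul => k.
  exact: rsmooth_lsub.
by apply: rsmooth_opp_coord => j; exact: rsmooth_rsub.
Qed.

(** The distribution commutes with the integration over p, which turns the pairing
    into u applied to a regularization of phi. *)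
Lemma hconvD_pairing u phi e : compact_distribution u -> test_function phi ->
  integralRm (fun p => T u e p * phi p) = u (reg rho false (pairing phi) e).
Proof.
move=> cu tphi; have := distr_integral cu (hkernel_smooth e) tphi.
rewrite (_ : integralRm _ = integralRm (fun p => T u e p * phi p)); last first.
  apply: integralRm_eq => p; congr (u _ * _); apply/funext => r.
  by rewrite /hkernel row_mxKl row_mxKr.
move=> ->; congr u; apply/funext => r; apply: integralRm_eq => p.
by rewrite /hkernel row_mxKl row_mxKr.
Qed.

(** The regularizations of phi converge to phi in C^oo, on which u is continuous. *)
Lemma hconvD_cvg u : compact_distribution u -> cvg_distribution (fun e => T u e) u.
Proof.
move=> cu phi tphi; have cv := test_distribution tphi.
have [M [k [B [M0 uB]]]] := distr_bound cu.
have zero M' N' := pairing_approximation rho_schwartz tphi rho_int rho_moments M' N'.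
have rapid := @reg_minus_rapid false phi tphi zero.
have [s C C' CC HC e p e01 pM|s|C CP] := @seq_bound_ex m k (fun s C => forall e p, 0 < e < 1 ->
    `|p| <= M -> cmod (partials s (fun p => reg rho false (pairing phi) e p - phi p) p) <= C%:R * e ^+ 1).
- have /andP[e0 e1] := e01.
  by rewrite (le_trans (HC _ _ e01 pM))// ler_wpM2r ?exprn_ge0 ?(ltW e0) ?ler_nat.
- exact: rapid.
have bound e : 0 < e < 1 ->
    cmod (integralRm (fun p => T u e p * phi p) - u phi) <= (B * C)%:R * e.
  move=> e01; have /andP[e0 e1] := e01.
  have sE : smooth setT (reg rho false (pairing phi) e).
    exact: smooth_net_smooth (reg_smooth_net false rho_schwartz cv) e01.
  rewrite (hconvD_pairing _ cu tphi) -(distrB cu sE tphi.1) natrM -mulrA.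
  apply: uB; first exact: (smoothB openT sE tphi.1).
    by rewrite mulr_ge0// ltW.
  by move=> s x sk xM; rewrite -[e]expr1; apply: CP.
apply: (@squeeze_cvgr _ _ _ _ (fun=> 0) (fun e => (B * C)%:R * e)).
- near=> e; rewrite cmod_ge0/= bound//.
  by near: e; exact: near_unit.
- exact: cvg_cst.
rewrite -[X in _ --> X](mulr0 (B * C)%:R); apply: cvgM; first exact: cvg_cst.
exact: cvg_at_right_filter.
Unshelve. all: by end_near. Qed.

(** The pairings with phi tend to u phi, and to 0 since pairing with phi is a
    continuous seminorm on V. *)
Lemma negligible_vanish u (V : set H) phi : compact_distribution u -> open V ->
  negligible_net V (fun e => T u e) -> test_function phi -> fsupp phi `<=` V -> u phi = 0.
Proof.
move=> cu oV [_ nu] tphi pV; have [B Bnear] := nu _ (test_seminorm oV tphi pV) 1.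
apply: cmod_eq0; apply/eqP; rewrite eq_le cmod_ge0 andbT; apply/ler_addgt0Pr => d d0.
have /cvgrPdist_lt/(_ (d / 2)) := hconvD_cvg cu tphi; rewrite divr_gt0// => /(_ isT) cv.
have B1 : 0 < `|B| + 1 by rewrite ltr_wpDl.
near (0 : R)^'+ => e.
have h1 : cmod (integralRm (fun p => T u e p * phi p)) <= B * e by near: e; exact: Bnear.
have h2 : `|0 - cmod (integralRm (fun p => T u e p * phi p) - u phi)| < d / 2 by near: e; exact: cv.
have e0 : 0 < e by near: e; exact: nbhs_right_gt.
have h3 : e < d / 2 / (`|B| + 1) by near: e; apply: nbhs_right_lt; rewrite !divr_gt0.
rewrite sub0r normrN ger0_norm ?cmod_ge0// in h2.
rewrite ltr_pdivlMr// in h3.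
have h4 : B * e <= `|B| * e by rewrite ler_wpM2r ?ler_norm// ltW.
have := cmodB (integralRm (fun p => T u e p * phi p))
  (integralRm (fun p => T u e p * phi p) - u phi).
rewrite opprB addrC subrK add0r => h5.
have : e * (`|B| + 1) = `|B| * e + e by ring.
by move: (`|B|) h3 h4 h5 => b *; lra.
Unshelve. all: by end_near. Qed.

(** The estimate holds near each point of V; a compact set needs finitely many of
    these neighborhoods. *)
Lemma vanish_negligible u (V : set H) : compact_distribution u -> open V ->
  (forall f, test_function f -> fsupp f `<=` V -> u f = 0) ->
  negligible_net V (fun e => T u e).
Proof.
move=> cu oV uV; have sn := reg_smooth_net true rho_schwartz cu.
apply: (negligible_estimate oV); first exact: smooth_netW sn.
move=> K s N cK KV.
have : near_covering K by exact/compact_near_coveringP.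
move=> /(_ nat \oo (fun C x => forall e, 0 < e < 1 -> cmod (partials s (T u e) x) <= C%:R * e ^+ N)).
case=> [x Kx|C _ CP]; last first.
  by exists C => e x e01 Kx; apply: (CP C) => //=.
have [d d0 off] := reg_off_support rho_schwartz cu oV (KV _ Kx) uV.
have [e e01|s' M|r N' rd||C CP] := @interpolate_complex _ _ (fun e => T u e) x d _ _ _ s (d / 2) N; last first.
- exists (ball x (d / 2), [set i | (C <= i)%N]) => /=.
    split; first by apply: nbhsx_ballx; rewrite divr_gt0.
    by exists C.
  move=> [y i] [/= yx Ci] e e01; have /andP[e0 e1] := e01.
  rewrite (le_trans (CP _ _ e01 _))//.
    by rewrite -ball_normE /= distrC in yx; exact: ltW.
  by rewrite ler_wpM2r ?ler_nat// exprn_ge0// ltW.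
- by rewrite ltr_pdivrMr// ltr_pMr// ltr1n.
- have [C CP] := off N'; exists C => e y e01 yr; apply: CP => //.
  by rewrite (le_trans yr)// ltW.
- exact: (reg_moderate true rho_schwartz cu).
- exact: smooth_net_smooth sn e01.
Qed.

Lemma hconvD_injective u v : compact_distribution u -> compact_distribution v ->
  distribution_eq u v <->
  gs_class setT (fun e => T u e) = gs_class setT (fun e => T v e).
Proof.
move=> cu cv; split=> [uv|E].
  congr gs_class; apply/funext => e; apply/funext => p.
  by rewrite /hconvD uv//; exact: mollify_quo_smooth.
have cw := distr_sub cu cv.
have nw : negligible_net setT (fun e => T (fun f => u f - v f) e).
  have : gs_class setT (fun e => T u e) (fun e => T u e).
    exact: (gs_class_self openT (hconvD_moderate cu)).
  by rewrite E => -[].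
move=> f sf; apply/eqP; rewrite -subr_eq0; apply/eqP.
apply: (distr_test_eq0 cw) sf => phi tphi.
exact: (negligible_vanish cw openT nw tphi).
Qed.

Lemma hconvD_supp u : compact_distribution u ->
  distribution_supp u = gs_supp (gs_class setT (fun e => T u e)).
Proof.
move=> cu; have mu := hconvD_moderate cu; rewrite /distribution_supp /gs_supp; congr (~` _).
rewrite (_ : [set V | _] = [set V : set H |
  open V /\ gs_restrict V (gs_class setT (fun e => T u e)) = gs_zero V])//.
apply/seteqP; split=> V [oV hV]; split=> //.
  by apply/gs_restrict_eq0 => //; exact: vanish_negligible.
move=> f tf fV; apply: (negligible_vanish cu oV _ tf fV).
exact/gs_restrict_eq0.
Qed.

End embedding.

Theorem proposition3p10 (R : realType) (n : nat)
    (rho : 'rV[R]_(n + n + 1) -> R[i])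
    (rho_schwartz : schwartz rho)
    (rho_int : integralRm rho = 1)
    (rho_moments : forall a : 'I_(n + n + 1) -> nat, (exists i, a i <> 0%N) ->
       integralRm (fun x => (monomial a x)%:C * rho x) = 0) :
  let T := fun (u : ('rV[R]_(n + n + 1) -> R[i]) -> R[i]) (e : R) =>
    hconvD (mollify rho e) u in
  [/\ (forall e : R, 0 < e < 1 ->
         exists2 K, conv_kernel (mollify rho e) K & localized_schwartz K),
      ((forall u, compact_distribution u ->
          [/\ moderate setT (T u), Gs setT (gs_class setT (T u))
            & cvg_distribution (T u) u]) /\
       (forall u v, compact_distribution u -> compact_distribution v ->
          distribution_eq u v <->
          gs_class setT (T u) = gs_class setT (T v))),
      (forall f, test_function f ->
         negligible_net setT (fun e p => hconv (mollify rho e) f p - f p))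
    & (forall u, compact_distribution u ->
         distribution_supp u = gs_supp (gs_class setT (T u)))].
Proof.
move=> T; split.
- move=> e e01; exists (hkernel rho e); first exact: hkernel_conv.
  exact: hkernel_localized.
- split=> [u cu|u v cu cv]; last exact: hconvD_injective.
  have mu := hconvD_moderate rho_schwartz cu.
  by split; [|exists (T u)|exact: hconvD_cvg].
- by move=> f tf; exact: hconv_negligible.
- by move=> u cu; exact: hconvD_supp.
Qed.
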